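(* Given a string \(s[1..n]\), we can build a data structure that takes \(nH_0(s) + O(n) + o(nH_0(s))\) bits such that later, given the endpoints \(i \le j\) of a substring \(s[i..j]\), in \(O(\log n\,(\log\log n)^2)\) time we can count how many distinct characters \(s[i..j]\) contains.
   Context: All logarithms are base 2. \(H_0(s)\) is the 0th-order empirical entropy of \(s\): if character \(a\) occurs \(n_a\) times in \(s\), then \(H_0(s) = \sum_{a} \frac{n_a}{n}\log\frac{n}{n_a}\), the sum over characters occurring in \(s\). Space is measured in bits and time in the standard word-RAM model with words of \(\Theta(\log n)\) bits; asymptotic notation is as \(n \to \infty\). *)

(* Defs.v *)
From Stdlib Require Import Reals List Arith.
Import ListNotations.
Open Scope R_scope.

(* A string s[1..n] is a list of characters; characters are naturals
   (an arbitrary, unrestricted alphabet). *)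
Definition log2 (x : R) : R := ln x / ln 2.

Definition distinct_chars (l : list nat) : list nat := nodup Nat.eq_dec l.

Definition H0 (s : list nat) : R :=
  let n := INR (length s) in
  fold_right
    (fun a acc =>
       let na := INR (count_occ Nat.eq_dec s a) in
       na / n * log2 (n / na) + acc)
    0 (distinct_chars s).

(* the substring s[i..j] (1-indexed, inclusive) *)
Definition substr (s : list nat) (i j : nat) : list nat :=
  firstn (S j - i) (skipn (i - 1) s).

Definition count_distinct (s : list nat) (i j : nat) : nat :=
  length (distinct_chars (substr s i j)).

(* Registers r_0, r_1, ... and memory cells each hold a w-bit word
   (a natural < 2^w); addresses are word values.  All arithmetic is
   modulo 2^w.  Each executed instruction costs one time unit. *)

Inductive instr : Type :=
| IConst (d k : nat)
| IAdd (d a b : nat)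
| ISub (d a b : nat)
| IMul (d a b : nat)
| IDiv (d a b : nat)        (* r_d := r_a / r_b  (0 if r_b = 0) *)
| IMod (d a b : nat)
| IAnd (d a b : nat)
| IOr  (d a b : nat)
| IXor (d a b : nat)
| IShl (d a b : nat)
| IShr (d a b : nat)
| ILt  (d a b : nat)
| ILoad (d a : nat)
| IStore (a b : nat)
| IJz (a t : nat)
| IJmp (t : nat)
| IHalt.

Record state : Type := mkState {
  pc  : nat;
  reg : nat -> nat;
  mem : nat -> nat
}.

Definition upd (f : nat -> nat) (x v : nat) : nat -> nat :=
  fun y => if Nat.eqb y x then v else f y.

Definition exec_instr (w : nat) (i : instr) (st : state) : state :=
  let W := (2 ^ w)%nat in
  let r := reg st in
  let next := S (pc st) in
  let setr d v := mkState next (upd r d (v mod W)%nat) (mem st) in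
  match i with
  | IConst d k => setr d k
  | IAdd d a b => setr d (r a + r b)%nat
  | ISub d a b => setr d (r a + (W - r b mod W))%nat
  | IMul d a b => setr d (r a * r b)%nat
  | IDiv d a b => setr d (r a / r b)%nat
  | IMod d a b => setr d (if Nat.eqb (r b) 0 then r a else (r a mod r b))%nat
  | IAnd d a b => setr d (Nat.land (r a) (r b))
  | IOr d a b => setr d (Nat.lor (r a) (r b))
  | IXor d a b => setr d (Nat.lxor (r a) (r b))
  | IShl d a b => setr d (r a * 2 ^ (r b))%nat
  | IShr d a b => setr d (r a / 2 ^ (r b))%nat
  | ILt d a b => setr d (if Nat.ltb (r a) (r b) then 1 else 0)%nat
  | ILoad d a => setr d (mem st (r a))
  | IStore a b => mkState next r (upd (mem st) (r a) (r b))
  | IJz a t => mkState (if Nat.eqb (r a) 0 then t else next) r (mem st)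
  | IJmp t => mkState t r (mem st)
  | IHalt => st
  end.

Definition step (w : nat) (p : list instr) (st : state) : option state :=
  match nth_error p (pc st) with
  | None => None
  | Some IHalt => None
  | Some i => Some (exec_instr w i st)
  end.

Fixpoint run (w : nat) (p : list instr) (fuel : nat) (st : state) : option state :=
  match step w p st with
  | None => Some st
  | Some st' =>
      match fuel with
      | O => None
      | S f => run w p f st'
      end
  end.

(* initial query state: memory holds the data structure D (a list of words)
   at addresses 0 .. |D|-1 (zero elsewhere); r_1 = i, r_2 = j, other
   registers 0; execution starts at instruction 0. *)
Definition init_state (D : list nat) (i j : nat) : state :=
  mkState 0
    (fun r => if Nat.eqb r 1 then i else if Nat.eqb r 2 then j else 0%nat)
    (fun a => nth a D 0%nat).

(* number of bits needed to write n, i.e. floor(log n) + 1 *)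
Definition lg (n : nat) : nat := S (Nat.log2 n).

(* Main.v *)
(* Let C(k) be the previous occurrence of the character at position
   k (0 if there is none): s[i..j] contains as many distinct characters as there
   are k in [i, j] with C(k) < i.  For the occurrences of one character the gaps
   k - C(k) telescope, so by concavity of the logarithm the sum of log (k - C(k))
   over all k is at most n H_0(s) + O(n).

   Positions are split into classes: one class per frequent character (more than
   n / sqrt(lg n) occurrences, so there are few of them and each is answered by
   comparing two ranks), one for the first occurrences of rare characters (always
   counted), and (lg lg n)^O(1) classes of the remaining positions according to
   the length of the gap rounded to b bits.  A position of a class of width b can
   only be counted if k < i + 2^b, and then C(k) modulo 2^(b+1) decides whether
   C(k) < i: a wavelet matrix of these residues answers the query in O(b) ranks.
   The sequence of classes is stored as a wavelet tree shaped by a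
   Shannon-Fano-Elias code.  A rare position has log (n / n_a) >= (lg lg n) / 2,
   so its O(lg lg lg n) bits of class code are within o(n H_0(s)).

   If w = lg n, only 2^w words are addressable, hence the structure must fit in
   n lg n bits whatever the entropy.  This is why widths b are also rounded
   according to lg n - b: a gap of y bits costs at most (lg n + y) / 2 bits, while
   on average a non-first occurrence has y <= lg n - (lg lg n) / 2. *)

Require Import Defs.
From Stdlib Require Import Reals List Arith Lia Lra FinFun.
Import ListNotations.
Open Scope bool_scope.
Open Scope nat_scope.

(** * Structured programs *)

(** The rank directory makes the worst case tight. Its counters take a fraction of order lg lg n /
    ([gam] lg n) of the space, and up to about n lg n bits are stored, so they cost order n lg lg n
    / [gam] bits. This is the same order as the roughly n (lg lg n) / 4 bits gained by the rounding
    of the widths, hence groups of 256 words.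

    The exponent of lg lg n in the time comes from the number of gap classes. Keeping about lg lg lg
    n significant bits of a width costs a factor 1 + O(1 / lg lg n) and leaves O((lg lg n)^2)
    widths, each answered by O(lg n) ranks. Frequent classes have codes of O(lg lg n) bits and no
    matrix, and cost less in total.

    Concavity enters through linear bounds: log x <= 2x for the entropy bound, a tangent near n /
    sqrt(lg n) for the worst case.

    The machine cannot count the ones of a word, so a rank uses a table for about (lg n) / 2 bits at
    a time. All parameters are read from a header, so one program serves every n and w. *)

Inductive cmd : Type :=
| Op (i : instr)
| Seq (a b : cmd)
| If (x : nat) (a b : cmd)
| While (x : nat) (a : cmd).

Notation "a ;; b" := (Seq a b) (at level 100, right associativity).

Fixpoint csize (c : cmd) : nat :=
  match c with
  | Op _ => 1
  | Seq a b => csize a + csize b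
  | If _ a b => 2 + csize a + csize b
  | While _ a => 2 + csize a
  end.

(** Jump targets are absolute, hence the argument [p], the address of the first emitted
    instruction. *)
Fixpoint compile (p : nat) (c : cmd) : list instr :=
  match c with
  | Op i => [i]
  | Seq a b => compile p a ++ compile (p + csize a) b
  | If x a b =>
      IJz x (p + 2 + csize a) :: compile (p + 1) a ++
      IJmp (p + 2 + csize a + csize b) :: compile (p + 2 + csize a) b
  | While x a =>
      IJz x (p + 2 + csize a) :: compile (p + 1) a ++ [IJmp p]
  end.

Lemma compile_length c : forall p, length (compile p c) = csize c.
Proof.
  induction c; intros p; cbn; rewrite ?length_app; cbn;
    rewrite ?length_app; cbn; rewrite ?IHc, ?IHc1, ?IHc2; lia.
Qed.

(** [IStore] is excluded along with the jumps: a query never writes, so the memory can be a fixed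
    parameter of the semantics. *)
Definition simple (i : instr) : bool :=
  match i with
  | IStore _ _ | IJz _ _ | IJmp _ | IHalt => false
  | _ => true
  end.

Definition eff (w : nat) (m : nat -> nat) (i : instr) (r : nat -> nat) :
  nat -> nat := reg (exec_instr w i (mkState 0 r m)).

(** The time is exact for the compiled code: the first branch of a conditional pays for [IJz] and
    for the [IJmp] over the second one, which pays for [IJz] only; each round of a loop pays for
    both jumps. *)
Inductive ev (w : nat) (m : nat -> nat) :
  cmd -> (nat -> nat) -> nat -> (nat -> nat) -> Prop :=
| EvOp i r : simple i = true -> ev w m (Op i) r 1 (eff w m i r)
| EvSeq a b r t r' t' r'' :
    ev w m a r t r' -> ev w m b r' t' r'' -> ev w m (Seq a b) r (t + t') r''
| EvIfT x a b r t r' :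
    r x <> 0 -> ev w m a r t r' -> ev w m (If x a b) r (1 + t + 1) r'
| EvIfF x a b r t r' :
    r x = 0 -> ev w m b r t r' -> ev w m (If x a b) r (1 + t) r'
| EvW0 x a r : r x = 0 -> ev w m (While x a) r 1 r
| EvWS x a r t r' t' r'' :
    r x <> 0 -> ev w m a r t r' -> ev w m (While x a) r' t' r'' ->
    ev w m (While x a) r (1 + t + 1 + t') r''.

(** Unlike [run], this does not ask the machine to halt, so executions of consecutive fragments
    compose. *)
Fixpoint steps (w : nat) (P : list instr) (t : nat) (st : state) : option state :=
  match t with
  | 0 => Some st
  | S t => match step w P st with None => None | Some st' => steps w P t st' end
  end.

Lemma steps_add w P t t' st st' st'' :
  steps w P t st = Some st' -> steps w P t' st' = Some st'' ->
  steps w P (t + t') st = Some st''.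
Proof.
  revert st; induction t as [|t IH]; intros st; cbn.
  - intros [= ->]; auto.
  - destruct (step w P st); [auto | discriminate].
Qed.

Lemma steps_run w P t st st' :
  steps w P t st = Some st' -> step w P st' = None -> run w P t st = Some st'.
Proof.
  revert st; induction t as [|t IH]; intros st; cbn.
  - intros [= ->] ->; reflexivity.
  - destruct (step w P st); [auto | discriminate].
Qed.

Definition code_at (P : list instr) (p : nat) (l : list instr) : Prop :=
  forall k x, nth_error l k = Some x -> nth_error P (p + k) = Some x.

Lemma code_at_app P p l1 l2 :
  code_at P p (l1 ++ l2) -> code_at P p l1 /\ code_at P (p + length l1) l2.
Proof.
  intros H; split; intros k x Hk.
  - apply H. rewrite nth_error_app1; auto.
    apply nth_error_Some; congruence.
  - rewrite <- Nat.add_assoc. apply H.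
    rewrite nth_error_app2 by lia.
    now replace (length l1 + k - length l1) with k by lia.
Qed.

Lemma code_at_cons P p i l :
  code_at P p (i :: l) -> nth_error P p = Some i /\ code_at P (p + 1) l.
Proof.
  intros H; split.
  - rewrite <- (Nat.add_0_r p). now apply H.
  - intros k x Hk. rewrite <- Nat.add_assoc. now apply (H (S k)).
Qed.

Lemma steps1 w P st i :
  nth_error P (pc st) = Some i -> i <> IHalt ->
  steps w P 1 st = Some (exec_instr w i st).
Proof.
  intros H Hi. cbn. unfold step. rewrite H. destruct i; congruence.
Qed.

Lemma exec_simple w i p r m :
  simple i = true ->
  exec_instr w i (mkState p r m) = mkState (S p) (eff w m i r) m.
Proof. destruct i; cbn; intros H; try discriminate; reflexivity. Qed.

Lemma compile_correct w m c r t r' :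
  ev w m c r t r' ->
  forall P p, code_at P p (compile p c) ->
  steps w P t (mkState p r m) = Some (mkState (p + csize c) r' m).
Proof.
  induction 1 as [i r Hs | a b r t r' t' r'' _ IHa _ IHb
    | x a b r t r' Hx _ IH | x a b r t r' Hx _ IH
    | x a r Hx | x a r t r' t' r'' Hx _ IHa _ IHw];
    intros P p HP; cbn [compile csize] in HP |- *.
  - apply code_at_cons in HP as [Hi _].
    erewrite steps1; [ | exact Hi | destruct i; discriminate].
    rewrite exec_simple, Nat.add_1_r by auto. reflexivity.
  - apply code_at_app in HP as [Ha Hb]. rewrite compile_length in Hb.
    eapply steps_add; [now apply IHa | rewrite Nat.add_assoc; now apply IHb].
  - apply code_at_cons in HP as [Hi HP]. apply code_at_app in HP as [Ha HP].
    rewrite compile_length in HP. apply code_at_cons in HP as [Hj _].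
    eapply steps_add; [eapply steps_add |].
    + eapply steps1; [exact Hi | discriminate].
    + cbn. rewrite (proj2 (Nat.eqb_neq _ _) Hx), <- Nat.add_1_r. now apply IH.
    + erewrite steps1; [ | exact Hj | discriminate]. cbn.
      do 2 f_equal. lia.
  - apply code_at_cons in HP as [Hi HP]. apply code_at_app in HP as [_ HP].
    rewrite compile_length in HP. apply code_at_cons in HP as [_ Hb].
    replace (p + 1 + csize a + 1) with (p + 2 + csize a) in Hb by lia.
    eapply steps_add.
    + eapply steps1; [exact Hi | discriminate].
    + cbn. rewrite Hx; cbn. rewrite IH by exact Hb. do 2 f_equal. lia.
  - apply code_at_cons in HP as [Hi HP].
    erewrite steps1; [ | exact Hi | discriminate]. cbn. rewrite Hx; cbn.
    do 2 f_equal. lia.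
  (* The closing [IJmp] enters the loop again at [p], so the hypothesis on its whole code is kept
     for the remaining rounds. *)
  - pose proof HP as HP0.
    apply code_at_cons in HP as [Hi HP]. apply code_at_app in HP as [Ha HP].
    rewrite compile_length in HP. apply code_at_cons in HP as [Hj _].
    eapply steps_add; [eapply steps_add; [eapply steps_add |] |].
    + eapply steps1; [exact Hi | discriminate].
    + cbn. rewrite (proj2 (Nat.eqb_neq _ _) Hx), <- Nat.add_1_r. now apply IHa.
    + eapply steps1; [exact Hj | discriminate].
    + cbn. now apply IHw.
Qed.

Definition wp (w : nat) (m : nat -> nat) (c : cmd) (T : nat)
  (Q : (nat -> nat) -> Prop) (r : nat -> nat) : Prop :=
  exists t r', ev w m c r t r' /\ t <= T /\ Q r'.

Lemma run_compile w m c T Q r :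
  wp w m c T Q r ->
  exists t st, t <= T /\
    run w (compile 0 c ++ [IHalt]) t (mkState 0 r m) = Some st /\ Q (reg st).
Proof.
  intros (t & r' & He & Ht & HQ).
  exists t, (mkState (csize c) r' m). split; [auto | split; [| auto]].
  apply steps_run.
  - apply (compile_correct _ _ _ _ _ _ He).
    intros k x Hk. cbn. rewrite nth_error_app1; auto.
    apply nth_error_Some; congruence.
  - unfold step. cbn. rewrite nth_error_app2 by (rewrite compile_length; lia).
    rewrite compile_length, Nat.sub_diag. reflexivity.
Qed.

(** * Proof rules for total correctness with a time bound *)

Section Ok.
Variables (w : nat) (m : nat -> nat).

Lemma ok_weaken c T T' (Q Q' : (nat -> nat) -> Prop) r :
  wp w m c T Q r -> T <= T' -> (forall r', Q r' -> Q' r') -> wp w m c T' Q' r.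
Proof. intros (t & r' & H & Ht & HQ) HT HQ'. exists t, r'. repeat split; auto; lia. Qed.

Lemma ok_seq a b T T' Q r :
  wp w m a T (wp w m b T' Q) r -> wp w m (Seq a b) (T + T') Q r.
Proof.
  intros (t & r' & H & Ht & (t' & r'' & H' & Ht' & HQ)).
  exists (t + t'), r''. repeat split; auto; [econstructor; eauto | lia].
Qed.

Lemma ok_step a b T Q r :
  wp w m a 1 (wp w m b T Q) r -> wp w m (Seq a b) (S T) Q r.
Proof. exact (ok_seq a b 1 T Q r). Qed.

Lemma ok_if x a b T Q r :
  (r x <> 0 -> wp w m a T Q r) -> (r x = 0 -> wp w m b T Q r) ->
  wp w m (If x a b) (2 + T) Q r.
Proof.
  intros Ha Hb. destruct (Nat.eq_dec (r x) 0) as [e|e].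
  - destruct (Hb e) as (t & r' & H & Ht & HQ).
    exists (1 + t), r'. repeat split; auto; [apply EvIfF; auto | lia].
  - destruct (Ha e) as (t & r' & H & Ht & HQ).
    exists (1 + t + 1), r'. repeat split; auto; [apply EvIfT; auto | lia].
Qed.

(** The index of the invariant bounds the rounds still to come and pays for them; the loop may stop
    while it is positive. *)
Lemma ok_while x a T (I : nat -> (nat -> nat) -> Prop) (Q : (nat -> nat) -> Prop) :
  (forall k r, I k r -> r x = 0 -> Q r) ->
  (forall k r, I k r -> r x <> 0 ->
     exists k', k = S k' /\ wp w m a T (I k') r) ->
  forall k r, I k r -> wp w m (While x a) (k * (2 + T) + 1) Q r.
Proof.
  intros H0 HS k. induction k as [k IH] using lt_wf_ind. intros r HI.
  destruct (Nat.eq_dec (r x) 0) as [e|e].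
  - exists 1, r. repeat split; [now apply EvW0 | lia | eauto].
  - destruct (HS k r HI e) as (k' & -> & t & r' & H & Ht & HI').
    destruct (IH k' ltac:(lia) r' HI') as (t' & r'' & H' & Ht' & HQ).
    exists (1 + t + 1 + t'), r''. repeat split; auto; [eapply EvWS; eauto | lia].
Qed.

(** This rule and the next unroll a loop whose rounds have different costs, as the loop over the
    classes does. *)
Lemma ok_while_done x a (Q : (nat -> nat) -> Prop) r :
  r x = 0 -> Q r -> wp w m (While x a) 1 Q r.
Proof. intros e HQ. exists 1, r. repeat split; auto. now apply EvW0. Qed.

Lemma ok_while_step x a T T' Q r :
  r x <> 0 -> wp w m a T (wp w m (While x a) T' Q) r ->
  wp w m (While x a) (2 + T + T') Q r.
Proof.
  intros e (t & r' & H & Ht & (t' & r'' & H' & Ht' & HQ)).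
  exists (1 + t + 1 + t'), r''. repeat split; auto; [eapply EvWS; eauto | lia].
Qed.

Lemma ok_op i T Q r :
  simple i = true -> Q (eff w m i r) -> wp w m (Op i) (S T) Q r.
Proof. intros H HQ. exists 1, (eff w m i r). repeat split; auto; [now constructor | lia]. Qed.

End Ok.

(** * Bit vectors with rank *)

Notation "'#' l" := (length l) (at level 10, l at level 9).

Definition nsum {T} (F : T -> nat) (l : list T) : nat := list_sum (map F l).

Lemma nsum_cons {T} (F : T -> nat) x l : nsum F (x :: l) = F x + nsum F l.
Proof. reflexivity. Qed.

Lemma nsum_le {T} (F F' : T -> nat) l :
  (forall x, In x l -> F x <= F' x) -> nsum F l <= nsum F' l.
Proof.
  induction l as [|x l IH]; intros H; [cbn; lia |]. rewrite !nsum_cons.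
  pose proof (H x (or_introl eq_refl)). specialize (IH (fun y Hy => H y (or_intror Hy))). lia.
Qed.

Lemma nsum_ext {T} (F F' : T -> nat) l :
  (forall x, In x l -> F x = F' x) -> nsum F l = nsum F' l.
Proof. intros H. unfold nsum. f_equal. now apply map_ext_in. Qed.

Lemma nsum_map {T U} (g : U -> T) (F : T -> nat) l : nsum F (map g l) = nsum (fun x => F (g x)) l.
Proof. unfold nsum. now rewrite map_map. Qed.

Lemma nsum_add {T} (F F' : T -> nat) l :
  nsum (fun x => F x + F' x) l = nsum F l + nsum F' l.
Proof. induction l; auto. rewrite !nsum_cons. lia. Qed.

Lemma nsum_mul {T} c (F : T -> nat) l : nsum (fun x => c * F x) l = c * nsum F l.
Proof. induction l as [|x l IH]; [cbn; lia |]. rewrite !nsum_cons. lia. Qed.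

Lemma nsum_const {T} c (l : list T) : nsum (fun _ => c) l = c * # l.
Proof. induction l as [|x l IH]; [cbn; lia |]. rewrite !nsum_cons. cbn. lia. Qed.

Lemma nsum_app {T} (F : T -> nat) l l' : nsum F (l ++ l') = nsum F l + nsum F l'.
Proof. unfold nsum. now rewrite map_app, list_sum_app. Qed.

Lemma nsum_filter_le {T} (F : T -> nat) (q : T -> bool) l : nsum F (filter q l) <= nsum F l.
Proof.
  induction l as [|x l IH]; [cbn; lia |]. cbn [filter]. rewrite nsum_cons.
  destruct (q x); rewrite ?nsum_cons; lia.
Qed.

Lemma pow2_pos k : 0 < 2 ^ k.
Proof. induction k; cbn; lia. Qed.

Lemma pow2_neq0 k : 2 ^ k <> 0.
Proof. pose proof (pow2_pos k); lia. Qed.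

#[local] Hint Resolve pow2_pos pow2_neq0 : core.

(** * Counting ones and packing bits and counters into words *)

Fixpoint cntr (f : nat -> bool) (s k : nat) : nat :=
  match k with
  | 0 => 0
  | S k => Nat.b2n (f s) + cntr f (S s) k
  end.

Fixpoint word (f : nat -> bool) (s k : nat) : nat :=
  match k with
  | 0 => 0
  | S k => Nat.b2n (f s) + 2 * word f (S s) k
  end.

Fixpoint popc (k x : nat) : nat :=
  match k with
  | 0 => 0
  | S k => x mod 2 + popc k (x / 2)
  end.

Fixpoint pack (kap : nat) (F : nat -> nat) (s k : nat) : nat :=
  match k with
  | 0 => 0
  | S k => F s + 2 ^ kap * pack kap F (S s) k
  end.

Lemma cntr_le f k : forall s, cntr f s k <= k.
Proof. induction k; intros s; cbn; [lia|]. specialize (IHk (S s)). destruct (f s); cbn; lia. Qed.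

Lemma cntr_add f a b : forall s, cntr f s (a + b) = cntr f s a + cntr f (s + a) b.
Proof.
  induction a; intros s; cbn; [now rewrite Nat.add_0_r |].
  rewrite IHa, Nat.add_succ_r. cbn. lia.
Qed.

Lemma word_bound f k : forall s, word f s k < 2 ^ k.
Proof. induction k; intros s; cbn; [lia|]. specialize (IHk (S s)). destruct (f s); cbn; lia. Qed.

Lemma word_add f a b : forall s, word f s (a + b) = word f s a + 2 ^ a * word f (s + a) b.
Proof.
  induction a; intros s; cbn [word Nat.add].
  - rewrite Nat.add_0_r. cbn. lia.
  - rewrite IHa, Nat.add_succ_r. cbn [Nat.add Nat.pow]. lia.
Qed.

Lemma word_mod f r k s : r <= k -> word f s k mod 2 ^ r = word f s r.
Proof.
  intros H. replace k with (r + (k - r)) by lia. rewrite word_add.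
  rewrite Nat.mul_comm, Nat.Div0.mod_add. apply Nat.mod_small, word_bound.
Qed.

Lemma popc_word f r : forall k s, r <= k -> popc k (word f s r) = cntr f s r.
Proof.
  induction r; intros k s H; cbn.
  - clear H. induction k; cbn [popc]; auto.
  - destruct k; [lia|]. cbn [popc].
    replace (Nat.b2n (f s) + (word f (S s) r + (word f (S s) r + 0)))
      with (Nat.b2n (f s) + word f (S s) r * 2) by lia.
    rewrite Nat.Div0.mod_add, Nat.div_add by lia.
    rewrite (Nat.div_small (Nat.b2n (f s)) 2), Nat.mod_small
      by (destruct (f s); cbn; lia).
    cbn [Nat.add]. rewrite IHr by lia. reflexivity.
Qed.

Lemma popc_add a b : forall x, popc (a + b) x = popc a x + popc b (x / 2 ^ a).
Proof.
  induction a; intros x; cbn [popc Nat.add].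
  - now rewrite Nat.pow_0_r, Nat.div_1_r.
  - rewrite IHa, Nat.Div0.div_div. cbn [Nat.pow]. lia.
Qed.

Lemma popc_mod a : forall x, popc a (x mod 2 ^ a) = popc a x.
Proof.
  induction a; intros x; cbn [popc]; auto.
  cbn [Nat.pow]. rewrite Nat.Div0.mod_mul_r.
  rewrite (Nat.mul_comm 2), Nat.Div0.mod_add, Nat.div_add by lia.
  rewrite Nat.Div0.mod_mod, (Nat.div_small (x mod 2)) by (apply Nat.mod_upper_bound; lia).
  cbn [Nat.add]. now rewrite IHa.
Qed.

Lemma popc_0 k : popc k 0 = 0.
Proof. induction k; cbn [popc]; auto. Qed.

Lemma popc_le k : forall x, popc k x <= k.
Proof.
  induction k; intros x; cbn [popc]; [lia|]. specialize (IHk (x / 2)).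
  pose proof (Nat.mod_upper_bound x 2). lia.
Qed.

Lemma pack_bound kap F k : forall s,
  (forall q, s <= q < s + k -> F q < 2 ^ kap) -> pack kap F s k < 2 ^ (kap * k).
Proof.
  induction k; intros s H; cbn [pack].
  - rewrite Nat.mul_0_r. cbn. lia.
  - rewrite Nat.mul_succ_r, Nat.add_comm, Nat.pow_add_r.
    specialize (H s ltac:(lia)) as H1.
    specialize (IHk (S s)). specialize (IHk ltac:(intros; apply H; lia)).
    rewrite Nat.add_comm, (Nat.mul_comm (2 ^ (kap * k))). nia.
Qed.

Lemma pack_get kap F k : forall s q,
  (forall q, s <= q < s + k -> F q < 2 ^ kap) -> q < k ->
  (pack kap F s k / 2 ^ (q * kap)) mod 2 ^ kap = F (s + q).
Proof.
  induction k; intros s q H Hq; [lia|]. cbn [pack].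
  assert (H1 : F s < 2 ^ kap) by (apply H; lia).
  destruct q as [|q].
  - cbn [Nat.mul]. rewrite Nat.pow_0_r, Nat.div_1_r, Nat.add_0_r.
    rewrite Nat.mul_comm, Nat.Div0.mod_add. now apply Nat.mod_small.
  - cbn [Nat.mul]. rewrite Nat.pow_add_r, <- Nat.Div0.div_div.
    rewrite (Nat.mul_comm (2 ^ kap) (pack _ _ _ _)), Nat.div_add by auto.
    rewrite (Nat.div_small (F s)) by auto. cbn [Nat.add].
    rewrite IHk by (try lia; intros; apply H; lia). f_equal; lia.
Qed.

(** Parameters of the layout: [w]-bit words, [kap]-bit relative counters,
    [A] groups of [gam] data words per block. *)
Record params := mkParams { pw : nat; pkap : nat; pA : nat; pgam : nat; ptau : nat }.

Section Layout.
Variable (P : params).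
Notation w := (pw P). Notation kap := (pkap P). Notation A := (pA P).
Notation gam := (pgam P). Notation tau := (ptau P).

(** Bits per group, bits per block, and words per block; the last adds two counter words to the
    data. *)
Definition gw := gam * w.
Definition bw := A * gw.
Definition sb := A * gam + 2.

(** The counter words are the rank before the block and, packed into one word, the ranks before its
    [A] groups relative to the block. *)
Definition blockwords (f : nat -> bool) (blk : nat) : list nat :=
  cntr f 0 (blk * bw) ::
  pack kap (fun q => cntr f (blk * bw) (q * gw)) 0 A ::
  map (fun q => word f (blk * bw + q * w) w) (seq 0 (A * gam)).

(** The extra block lets a rank at the end position [nu] read a stored counter even if [bw] divides
    [nu]. *)
Definition nblocks (nu : nat) := nu / bw + 1.

Definition vwords (f : nat -> bool) (nu : nat) : list nat :=
  flat_map (blockwords f) (seq 0 (nblocks nu)).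

(** The bound on the end address keeps the address arithmetic of a rank from wrapping around. *)
Definition vec (m : nat -> nat) (a : nat) (f : nat -> bool) (nu : nat) : Prop :=
  a + nblocks nu * sb <= 2 ^ w /\
  forall blk, blk < nblocks nu ->
    m (a + blk * sb) = cntr f 0 (blk * bw) /\
    m (a + blk * sb + 1) = pack kap (fun q => cntr f (blk * bw) (q * gw)) 0 A /\
    forall q, q < A * gam -> m (a + blk * sb + 2 + q) = word f (blk * bw + q * w) w.

Lemma blockwords_length f blk : length (blockwords f blk) = sb.
Proof. unfold blockwords, sb. cbn. rewrite length_map, length_seq. lia. Qed.

Lemma flat_map_length_const {T} (g : T -> list nat) l c :
  (forall x, In x l -> length (g x) = c) -> length (flat_map g l) = length l * c.
Proof.
  induction l; cbn; intros H; auto. rewrite length_app, IHl by auto.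
  rewrite (H a) by auto. lia.
Qed.

Lemma vwords_length f nu : length (vwords f nu) = nblocks nu * sb.
Proof.
  unfold vwords. rewrite (flat_map_length_const _ _ sb).
  - now rewrite length_seq.
  - intros; apply blockwords_length.
Qed.

Lemma nth_flat_map_const (g : nat -> list nat) c d k : forall s b q,
  (forall x, length (g x) = c) -> b < k -> q < c ->
  nth (b * c + q) (flat_map g (seq s k)) d = nth q (g (s + b)) d.
Proof.
  induction k; intros s b q H Hb Hq; [lia|]. cbn [seq flat_map].
  destruct b as [|b].
  - rewrite Nat.add_0_r. cbn. rewrite app_nth1; auto. rewrite H; auto.
  - rewrite app_nth2 by (rewrite H; cbn; lia). rewrite H.
    replace (S b * c + q - c) with (b * c + q) by lia.
    rewrite IHk by (auto; lia). f_equal. f_equal. lia.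
Qed.

Definition holds (m : nat -> nat) (a : nat) (l : list nat) : Prop :=
  forall k, k < length l -> m (a + k) = nth k l 0.

Lemma holds_app m a l1 l2 :
  holds m a (l1 ++ l2) <-> holds m a l1 /\ holds m (a + length l1) l2.
Proof.
  unfold holds. rewrite length_app. split.
  - intros H; split; intros k Hk.
    + rewrite H by lia. now apply app_nth1.
    + rewrite <- Nat.add_assoc, H by lia. rewrite app_nth2 by lia. f_equal; lia.
  - intros [H1 H2] k Hk. destruct (Nat.lt_ge_cases k (length l1)).
    + rewrite H1, app_nth1 by auto. auto.
    + rewrite app_nth2 by auto. rewrite <- H2 by lia. f_equal; lia.
Qed.

Lemma holds_cons m a x l :
  holds m a (x :: l) <-> m a = x /\ holds m (a + 1) l.
Proof.
  change (x :: l) with ([x] ++ l). rewrite holds_app. cbn.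
  unfold holds at 1. cbn. split; intros [H H']; split; auto.
  - rewrite <- (H 0) by lia. f_equal; lia.
  - intros [|k] Hk; [|lia]. now rewrite Nat.add_0_r.
Qed.

Lemma vec_of_holds m a f nu :
  holds m a (vwords f nu) -> a + length (vwords f nu) <= 2 ^ w -> vec m a f nu.
Proof.
  intros H Ha. rewrite vwords_length in Ha. split; auto.
  assert (HG : forall blk q, blk < nblocks nu -> q < sb ->
    m (a + blk * sb + q) = nth q (blockwords f blk) 0).
  { intros blk q Hb Hq. rewrite <- Nat.add_assoc. unfold holds in H.
    rewrite H.
    - unfold vwords. rewrite (nth_flat_map_const _ sb); auto.
      intros; apply blockwords_length.
    - rewrite vwords_length. nia. }
  intros blk Hb. unfold sb in HG at 1.
  rewrite <- (Nat.add_0_r (a + blk * sb)) at 1.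
  rewrite !HG by (auto; lia). split; [reflexivity | split; [reflexivity |]].
  intros q Hq. rewrite <- Nat.add_assoc, HG by (auto; lia).
  cbn [Nat.add]. unfold blockwords. cbn [nth].
  rewrite (nth_indep _ _ (word f (blk * bw + 0 * w) w))
    by (rewrite length_map, length_seq; auto).
  rewrite (map_nth (fun q => word f (blk * bw + q * w) w)), seq_nth by auto.
  reflexivity.
Qed.

End Layout.

(** * Proof rules for single instructions, under side conditions that exclude overflow *)

Arguments upd _ _ _ _ /.

Section Instr.
Variables (w : nat) (m : nat -> nat).
Implicit Types (Q : (nat -> nat) -> Prop) (r : nat -> nat).

Lemma ok_add d a b Q r :
  r a + r b < 2 ^ w -> Q (upd r d (r a + r b)) -> wp w m (Op (IAdd d a b)) 1 Q r.
Proof. intros H HQ. apply ok_op; auto. cbn -[upd]. now rewrite Nat.mod_small. Qed.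

Lemma ok_sub d a b Q r :
  r b <= r a -> r a < 2 ^ w -> Q (upd r d (r a - r b)) ->
  wp w m (Op (ISub d a b)) 1 Q r.
Proof.
  intros H H1 HQ. apply ok_op; auto. cbn -[upd].
  rewrite (Nat.mod_small (r b)) by lia.
  replace (r a + (2 ^ w - r b)) with (r a - r b + 1 * 2 ^ w) by lia.
  now rewrite Nat.Div0.mod_add, Nat.mod_small by lia.
Qed.

Lemma ok_mul d a b Q r :
  r a * r b < 2 ^ w -> Q (upd r d (r a * r b)) -> wp w m (Op (IMul d a b)) 1 Q r.
Proof. intros H HQ. apply ok_op; auto. cbn -[upd]. now rewrite Nat.mod_small. Qed.

Lemma div_le_self a b : a / b <= a.
Proof. destruct b; [cbn; lia |]. apply Nat.Div0.div_le_upper_bound. nia. Qed.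

Lemma ok_div d a b Q r :
  r a < 2 ^ w -> Q (upd r d (r a / r b)) -> wp w m (Op (IDiv d a b)) 1 Q r.
Proof.
  intros H HQ. apply ok_op; auto. cbn -[upd Nat.div]. rewrite Nat.mod_small; auto.
  pose proof (div_le_self (r a) (r b)). lia.
Qed.

Lemma ok_mod d a b Q r :
  r a < 2 ^ w -> r b <> 0 -> Q (upd r d (r a mod r b)) ->
  wp w m (Op (IMod d a b)) 1 Q r.
Proof.
  intros H Hb HQ. apply ok_op; auto. cbn -[upd Nat.modulo].
  rewrite (proj2 (Nat.eqb_neq _ _) Hb), (Nat.mod_small _ (2 ^ w)); auto.
  pose proof (Nat.Div0.mod_le (r a) (r b)). lia.
Qed.

Lemma ok_mov d a Q r :
  r a < 2 ^ w -> Q (upd r d (r a)) -> wp w m (Op (IOr d a a)) 1 Q r.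
Proof.
  intros H HQ. apply ok_op; auto. cbn -[upd Nat.modulo Nat.lor].
  now rewrite Nat.lor_diag, Nat.mod_small.
Qed.

Lemma ok_shl d a b Q r :
  r a * 2 ^ r b < 2 ^ w -> Q (upd r d (r a * 2 ^ r b)) ->
  wp w m (Op (IShl d a b)) 1 Q r.
Proof. intros H HQ. apply ok_op; auto. cbn -[upd]. now rewrite Nat.mod_small. Qed.

Lemma ok_shr d a b Q r :
  r a < 2 ^ w -> Q (upd r d (r a / 2 ^ r b)) -> wp w m (Op (IShr d a b)) 1 Q r.
Proof.
  intros H HQ. apply ok_op; auto. cbn -[upd Nat.div]. rewrite Nat.mod_small; auto.
  pose proof (div_le_self (r a) (2 ^ r b)). lia.
Qed.

Lemma ok_lt d a b Q r :
  0 < w -> Q (upd r d (if r a <? r b then 1 else 0)) ->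
  wp w m (Op (ILt d a b)) 1 Q r.
Proof.
  intros H HQ. assert (2 ^ 1 <= 2 ^ w) by (apply Nat.pow_le_mono_r; lia).
  apply ok_op; auto. cbn -[upd Nat.ltb]. rewrite Nat.mod_small; auto.
  destruct (r a <? r b); cbn in *; lia.
Qed.

Lemma ok_load d a Q r x :
  m (r a) = x -> x < 2 ^ w -> Q (upd r d x) -> wp w m (Op (ILoad d a)) 1 Q r.
Proof. intros <- H HQ. apply ok_op; auto. cbn -[upd]. now rewrite Nat.mod_small. Qed.

Lemma ok_const d k Q r :
  k < 2 ^ w -> Q (upd r d k) -> wp w m (Op (IConst d k)) 1 Q r.
Proof. intros H HQ. apply ok_op; auto. cbn -[upd]. now rewrite Nat.mod_small. Qed.

End Instr.

(** * The query program *)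

(* Registers: 0 result, 1 and 2 the query, 3-12 constants of the layout.  Every
   fragment leaves the registers below its first output register unchanged. *)
Definition pop_code : cmd :=
  While 34
    (Op (IMod 36 34 9) ;; Op (IAdd 36 36 10) ;; Op (ILoad 36 36) ;;
     Op (IAdd 31 31 36) ;; Op (IDiv 34 34 9)).

(* Register 31 := number of ones among the first r_30 bits of the vector at
   address r_23. *)
Definition rank_code : cmd :=
  Op (IDiv 32 30 4) ;; Op (IMod 33 30 4) ;; Op (IMul 32 32 5) ;; Op (IAdd 32 32 23) ;;
  Op (ILoad 31 32) ;; Op (IAdd 32 32 11) ;; Op (ILoad 34 32) ;;
  Op (IDiv 35 33 6) ;; Op (IMod 33 33 6) ;; Op (IMul 36 35 7) ;; Op (IShr 34 34 36) ;;
  Op (IMod 34 34 8) ;; Op (IAdd 31 31 34) ;;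
  Op (IMul 35 35 12) ;; Op (IAdd 32 32 35) ;; Op (IAdd 32 32 11) ;;
  Op (IDiv 35 33 3) ;; Op (IMod 33 33 3) ;; Op (IAdd 32 32 35) ;;
  Op (ILoad 34 32) ;; Op (IShl 36 11 33) ;; Op (IMod 34 34 36) ;;
  pop_code ;;
  While 35
    (Op (ISub 35 35 11) ;; Op (ISub 32 32 11) ;; Op (ILoad 34 32) ;; pop_code).

Definition pop_time (c : nat) := c * 7 + 1.
Definition rank_time (gam c : nat) := 22 + (pop_time c + (gam * (2 + (3 + pop_time c)) + 1)).

Ltac instr l := eapply ok_step; eapply l; cbn [upd Nat.eqb].

Section Run.
Variables (P : params) (m : nat -> nat) (tbl : nat).
Notation w := (pw P). Notation kap := (pkap P). Notation A := (pA P).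
Notation gam := (pgam P). Notation tau := (ptau P).
Notation ok := (wp w m).

Definition layout_regs (r : nat -> nat) : Prop :=
  r 3 = w /\ r 4 = bw P /\ r 5 = sb P /\ r 6 = gw P /\ r 7 = kap /\
  r 8 = 2 ^ kap /\ r 9 = 2 ^ tau /\ r 10 = tbl /\ r 11 = 1 /\ r 12 = gam.

Definition frame (k : nat) (r r' : nat -> nat) : Prop := forall x, x < k -> r' x = r x.

Lemma frame_cst k r r' : 13 <= k -> frame k r r' -> layout_regs r -> layout_regs r'.
Proof. unfold layout_regs, frame. intros Hk H. rewrite !H by lia. auto. Qed.

Lemma frame_refl k r : frame k r r.
Proof. intros x _; reflexivity. Qed.

Lemma frame_trans k k' r r' r'' : k <= k' -> frame k r r' -> frame k' r' r'' -> frame k r r''.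
Proof. intros Hk H H' x Hx. rewrite H' by lia. auto. Qed.

Lemma frame_upd k d v r r' : k <= d -> frame k r r' -> frame k r (upd r' d v).
Proof.
  intros Hk H x Hx. cbn. rewrite (proj2 (Nat.eqb_neq x d)) by lia. auto.
Qed.

(** [good_Akap] makes the relative counters of a block fit into one word, [good_count] makes each of
    them fit into [kap] bits. *)
Record good : Prop := {
  good_w : 0 < w;
  good_kap : kap < w;
  good_Akap : kap * A <= w;
  good_count : A * gw P < 2 ^ kap;
  good_gam : 0 < gam;
  good_A : 0 < A;
  good_tau : 0 < tau;
  good_tauw : tau < w;
  good_tbl : tbl + 2 ^ tau <= 2 ^ w;
  good_table : forall y, y < 2 ^ tau -> m (tbl + y) = popc tau y
}.

Hypothesis G : good.

Lemma pow_lt_w k : k < w -> 2 ^ k < 2 ^ w.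
Proof. intros; apply Nat.pow_lt_mono_r; lia. Qed.

(** Each round looks up [tau] bits in the table. The loop stops once no ones are left, so [c] is
    only a bound on the rounds. *)
Lemma pop_ok c r :
  layout_regs r -> r 34 < 2 ^ w -> r 34 < 2 ^ (tau * c) ->
  r 31 + popc (tau * c) (r 34) < 2 ^ w ->
  ok pop_code (pop_time c)
     (fun r' => r' 31 = r 31 + popc (tau * c) (r 34) /\
                r' 32 = r 32 /\ r' 33 = r 33 /\ r' 35 = r 35 /\ frame 31 r r') r.
Proof.
  intros Hc Hw Hx Hs.
  set (tot := r 31 + popc (tau * c) (r 34)) in *.
  eapply ok_weaken with (T := c * (2 + 5) + 1);
    [ apply ok_while with (I := fun k r' =>
        r' 34 < 2 ^ (tau * k) /\ r' 34 < 2 ^ w /\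
        r' 31 + popc (tau * k) (r' 34) = tot /\
        r' 32 = r 32 /\ r' 33 = r 33 /\ r' 35 = r 35 /\ frame 31 r r')
    | unfold pop_time; lia | intros r' H; exact H ].
  - intros k r' (_ & _ & H & H') e. rewrite e, popc_0 in H. split; [lia | auto].
  - intros k r' (H1 & H2 & H3 & H4 & H5 & H6 & H7) e.
    assert (Hc' : layout_regs r') by (apply (frame_cst 31 r); auto; lia).
    destruct Hc' as (_ & _ & _ & _ & _ & _ & E9 & E10 & E11 & E12).
    destruct k as [|k].
    { rewrite Nat.mul_0_r in H1. cbn in H1. lia. }
    exists k. split; auto.
    rewrite Nat.mul_succ_r, (Nat.add_comm _ tau) in H1, H3.
    rewrite popc_add in H3.
    assert (Hm : r' 34 mod 2 ^ tau < 2 ^ tau) by (apply Nat.mod_upper_bound; auto).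
    assert (Hm2 := good_tbl G).
    assert (Ht := good_table G _ Hm). rewrite popc_mod in Ht.
    instr ok_mod; rewrite ?E9, ?E10; [lia | auto |].
    instr ok_add; rewrite ?E9, ?E10; [lia |].
    instr ok_load; [ rewrite Nat.add_comm; exact Ht | lia |].
    instr ok_add; [lia |].
    eapply ok_div; cbn [upd Nat.eqb]; rewrite ?E9; [lia |].
    rewrite !Nat.add_assoc in *. repeat split; try lia.
    + apply Nat.Div0.div_lt_upper_bound. now rewrite <- Nat.pow_add_r.
    + pose proof (div_le_self (r' 34) (2 ^ tau)). lia.
    + repeat apply frame_upd; try lia. auto.
  - repeat split; auto; apply frame_refl.
Qed.

(** The position is split as [bw P * blk + gw P * grp + w * q + z]. The first two parts are answered
    by the counters; the last group leaves [q < gam] full words and [z] bits of one more word to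
    count by table. *)
Lemma rank_ok c f nu r :
  layout_regs r -> w <= tau * c -> vec P m (r 23) f nu -> r 30 <= nu -> nu < 2 ^ w ->
  ok rank_code (rank_time gam c)
     (fun r' => r' 31 = cntr f 0 (r 30) /\ frame 31 r r') r.
Proof.
  intros Hc Htc [Ha Hv] Hpos Hnu.
  assert (Hc' := Hc).
  destruct Hc' as (E3 & E4 & E5 & E6 & E7 & E8 & E9 & E10 & E11 & E12).
  pose proof (good_w G) as Gw. pose proof (good_kap G) as Gk.
  pose proof (good_Akap G) as GAk. pose proof (good_count G) as Gc.
  pose proof (good_gam G) as Gg. pose proof (good_A G) as GA.
  assert (Gww := Nat.pow_gt_lin_r 2 w ltac:(lia)).
  set (pos := r 30) in *. set (a := r 23) in *.
  assert (Hgw : 0 < gw P) by (unfold gw; nia).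
  assert (Hbw : 0 < bw P) by (unfold bw; nia).
  set (blk := pos / bw P). set (x := pos mod bw P).
  set (grp := x / gw P). set (y := x mod gw P).
  set (q := y / w). set (z := y mod w).
  assert (Dpos : pos = bw P * blk + x) by (apply Nat.div_mod; lia).
  assert (Dx : x = gw P * grp + y) by (apply Nat.div_mod; lia).
  assert (Dy : y = w * q + z) by (apply Nat.div_mod; lia).
  assert (Lx : x < bw P) by (apply Nat.mod_upper_bound; lia).
  assert (Ly : y < gw P) by (apply Nat.mod_upper_bound; lia).
  assert (Lz : z < w) by (apply Nat.mod_upper_bound; lia).
  assert (Lgrp : grp < A).
  { apply Nat.Div0.div_lt_upper_bound. unfold bw in Lx. lia. }
  assert (Lq : q < gam).
  { apply Nat.Div0.div_lt_upper_bound. unfold gw in Ly. lia. }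
  assert (Lblk : blk < nblocks P nu).
  { unfold nblocks. assert (blk <= nu / bw P) by (apply Nat.Div0.div_le_mono; auto). lia. }
  destruct (Hv blk Lblk) as (V1 & V2 & V3).
  assert (Hrel : forall g, g < A -> cntr f (blk * bw P) (g * gw P) < 2 ^ kap).
  { intros g Hg. pose proof (cntr_le f (g * gw P) (blk * bw P)).
    assert (g * gw P <= A * gw P) by (apply Nat.mul_le_mono_r; lia). lia. }
  assert (Hidx : (grp + 1) * gam <= A * gam) by (apply Nat.mul_le_mono_r; lia).
  assert (Hshift : grp * kap <= A * kap) by (apply Nat.mul_le_mono_r; lia).
  assert (Haddr : (blk + 1) * sb P <= nblocks P nu * sb P)
    by (apply Nat.mul_le_mono_r; lia).
  assert (Hsb : sb P = A * gam + 2) by reflexivity.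
  set (B := blk * bw P + grp * gw P).
  (* The summands stand in the order in which the program adds them: the partial word comes before
     the full words, which are then visited backwards. *)
  assert (Htot : cntr f 0 (blk * bw P) + cntr f (blk * bw P) (grp * gw P) +
                 (cntr f (B + q * w) z + cntr f B (q * w)) = cntr f 0 pos).
  { replace pos with (blk * bw P + (grp * gw P + (q * w + z))) by lia.
    rewrite !cntr_add. unfold B. cbn [Nat.add]. lia. }
  assert (Hle := cntr_le f pos 0).
  assert (Epack : (pack kap (fun g => cntr f (blk * bw P) (g * gw P)) 0 A
                    / 2 ^ (grp * kap)) mod 2 ^ kap = cntr f (blk * bw P) (grp * gw P)).
  { rewrite (pack_get kap _ A 0 grp); auto. intros g Hg; apply Hrel; lia. }
  assert (Bpack : pack kap (fun g => cntr f (blk * bw P) (g * gw P)) 0 A < 2 ^ w).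
  { eapply Nat.lt_le_trans; [apply pack_bound; intros; apply Hrel; lia |].
    apply Nat.pow_le_mono_r; lia. }
  assert (Hpz : 2 ^ z < 2 ^ w) by (apply pow_lt_w; auto).
  assert (Hpk : 2 ^ kap < 2 ^ w) by (apply pow_lt_w; auto).
  unfold rank_code, rank_time.
  instr ok_div; rewrite ?E4; fold pos; [lia | fold blk].
  instr ok_mod; rewrite ?E4; fold pos; [lia | lia | fold x].
  instr ok_mul; rewrite ?E5; [lia |].
  instr ok_add; fold a; [lia |].
  instr ok_load; [rewrite Nat.add_comm; exact V1 | lia |].
  instr ok_add; rewrite ?E11; [lia |].
  instr ok_load;
    [rewrite (Nat.add_comm _ a); exact V2 | lia |].
  instr ok_div; rewrite ?E6; [lia | fold grp].
  instr ok_mod; rewrite ?E6; [lia | lia | fold y].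
  instr ok_mul; rewrite ?E7; [lia |].
  instr ok_shr; [lia |].
  instr ok_mod; rewrite ?E8;
    [ | auto | rewrite Epack ].
  { eapply Nat.le_lt_trans; [apply div_le_self | lia]. }
  instr ok_add; [lia |].
  instr ok_mul; rewrite ?E12; [lia |].
  instr ok_add; [lia |].
  instr ok_add; rewrite ?E11; [lia |].
  instr ok_div; rewrite ?E3; [lia | fold q].
  instr ok_mod; rewrite ?E3; [lia | lia | fold z].
  instr ok_add; [lia |].
  instr ok_load.
  { replace (blk * sb P + a + 1 + grp * gam + 1 + q)
      with (a + blk * sb P + 2 + (grp * gam + q)) by lia.
    apply V3. lia. }
  { apply word_bound. }
  instr ok_shl; rewrite ?E11; [lia | rewrite Nat.mul_1_l].
  instr ok_mod; [apply word_bound | auto |].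
  rewrite word_mod by lia.
  replace (blk * bw P + (grp * gam + q) * w) with (B + q * w)
    by (unfold B, gw; lia).
  match goal with |- wp _ _ _ _ _ ?r0 => set (r1 := r0) end.
  assert (F1 : frame 31 r r1)
    by (unfold r1; repeat (apply frame_upd; [lia|]); apply frame_refl).
  assert (Htz : w <= tau * c) by auto.
  assert (Ep : popc (tau * c) (word f (B + q * w) z) = cntr f (B + q * w) z)
    by (apply popc_word; lia).
  eapply ok_seq. eapply ok_weaken; [apply (pop_ok c r1) | apply le_n |].
  - apply (frame_cst 31 r); auto. lia.
  - cbn. pose proof (word_bound f z (B + q * w)). lia.
  - cbn. eapply Nat.lt_le_trans; [apply word_bound | apply Nat.pow_le_mono_r; lia].
  - cbn. rewrite Ep. lia.
  - intros r2 (R31 & R32 & _ & R35 & F2).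
    unfold r1 in R31, R32, R35. cbn [upd Nat.eqb] in R31, R32, R35.
    rewrite Ep in R31. clearbody r1.
    eapply ok_weaken; [ apply ok_while with (k := q) (T := 3 + pop_time c) (I := fun k r' =>
        k <= q /\ r' 35 = k /\ r' 32 = a + blk * sb P + 2 + (grp * gam + k) /\
        r' 31 + cntr f B (k * w) = cntr f 0 pos /\ frame 31 r r')
      | apply Nat.add_le_mono_r, Nat.mul_le_mono_r; lia
      | intros r' H'; exact H' ].
    + intros k r' (_ & -> & _ & H & H') ->. cbn in H. split; [lia | auto].
    + intros k r' (Hk & H1 & H2 & H3 & H4) e.
      destruct k as [|k]; [lia|]. exists k. split; auto.
      assert (Hc' : layout_regs r') by (apply (frame_cst 31 r); auto; lia).
      destruct Hc' as (_ & _ & _ & _ & _ & _ & _ & _ & E11' & _).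
      cbn [Nat.mul] in H3. rewrite Nat.add_comm with (n := w), cntr_add in H3.
      assert (Ep' : popc (tau * c) (word f (B + k * w) w) = cntr f (B + k * w) w)
        by (apply popc_word; lia).
      instr ok_sub; rewrite ?E11', ?H1; [lia | lia |].
      instr ok_sub; rewrite ?E11', ?H2; [lia | lia |].
      instr ok_load.
      { replace (a + blk * sb P + 2 + (grp * gam + S k) - 1)
          with (a + blk * sb P + 2 + (grp * gam + k)) by lia.
        apply V3. lia. }
      { apply word_bound. }
      replace (blk * bw P + (grp * gam + k) * w) with (B + k * w)
        by (unfold B, gw; lia).
      eapply ok_weaken; [apply (pop_ok c) | apply le_n |].
      * apply (frame_cst 31 r); auto; [lia |].
        repeat (apply frame_upd; [lia|]); auto.
      * cbn. apply word_bound.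
      * cbn. eapply Nat.lt_le_trans; [apply word_bound | apply Nat.pow_le_mono_r; lia].
      * cbn. rewrite Ep'. lia.
      * cbn. rewrite Ep'. intros r3 (Q31 & Q32 & _ & Q35 & F3).
        repeat split; try lia.
        eapply frame_trans; [ | | exact F3]; [lia |].
        repeat (apply frame_upd; [lia|]); auto.
    + repeat split; try lia.
      eapply frame_trans; [ | exact F1 | exact F2]; lia.
Qed.
End Run.

(** * Wavelet trees and wavelet matrices *)

Definition ones (V : list bool) := # (filter (fun b => b) V).
Definition zeros (V : list bool) := # (filter negb V).

Lemma ones_zeros V : ones V + zeros V = # V.
Proof. unfold ones, zeros. induction V as [|[] V IH]; cbn; lia. Qed.

Lemma ones_app V V' : ones (V ++ V') = ones V + ones V'.
Proof. unfold ones. now rewrite filter_app, length_app. Qed.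

Lemma ones_map {T} (f : T -> bool) X : ones (map f X) = # (filter f X).
Proof. unfold ones. induction X; cbn; auto. destruct (f a); cbn; auto. Qed.

Lemma zeros_map {T} (f : T -> bool) X :
  zeros (map f X) = # (filter (fun x => negb (f x)) X).
Proof. unfold zeros. induction X; cbn; auto. destruct (f a); cbn; auto. Qed.

Lemma cntr_shift f g k : forall s s',
  (forall q, q < k -> f (s + q) = g (s' + q)) -> cntr f s k = cntr g s' k.
Proof.
  induction k; intros s s' H; cbn; auto. f_equal.
  - specialize (H 0 ltac:(lia)). rewrite !Nat.add_0_r in H. now rewrite H.
  - apply IHk. intros q Hq. specialize (H (S q) ltac:(lia)).
    now rewrite !Nat.add_succ_r in H.
Qed.

(** A range is represented by cutting the list into what precedes it, the range, and what follows
    it; ranks at its ends then become counts on these pieces. *)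
Lemma cntr_list V1 V2 : cntr (fun k => nth k (V1 ++ V2) false) 0 (# V1) = ones V1.
Proof.
  induction V1 as [|b V IH]; cbn; auto.
  rewrite (cntr_shift _ (fun k => nth k (V ++ V2) false) _ 1 0) by (intros; reflexivity).
  rewrite IH. unfold ones. destruct b; reflexivity.
Qed.

Section Instr.
Variables (w : nat) (m : nat -> nat).

Lemma ok_and1 d a b (Q : (nat -> nat) -> Prop) r :
  0 < w -> r b = 1 -> Q (upd r d (r a mod 2)) -> wp w m (Op (IAnd d a b)) 1 Q r.
Proof.
  intros H Hb HQ. apply ok_op; auto. cbn -[upd Nat.modulo Nat.land].
  rewrite Hb. rewrite (Nat.land_ones (r a) 1 : Nat.land (r a) 1 = _).
  change (2 ^ 1) with 2. rewrite Nat.mod_small; auto.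
  assert (2 ^ 1 <= 2 ^ w) by (apply Nat.pow_le_mono_r; lia). cbn [Nat.pow] in *.
  pose proof (Nat.mod_upper_bound (r a) 2). lia.
Qed.
End Instr.

(* One wavelet step at the vector of address r_23: the range r_26, r_27 moves to
   the zeros or (offset by r_24) to the ones; in the latter case r_28 collects
   the zeros of the range. *)
Definition step_code : cmd :=
  Op (IOr 30 26 26) ;; rank_code ;; Op (IOr 29 31 31) ;; Op (IOr 30 27 27) ;;
  rank_code ;;
  If 25
    (Op (ISub 32 27 26) ;; Op (ISub 33 31 29) ;; Op (ISub 32 32 33) ;;
     Op (IAdd 28 28 32) ;; Op (IAdd 26 24 29) ;; Op (IAdd 27 24 31))
    (Op (ISub 26 26 29) ;; Op (ISub 27 27 31)).

(** Compares with r_1 from the most significant of r_21 bits down. Where r_1 has a 1, the elements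
    of the range with a 0 are smaller and are counted; the search continues among the elements that
    agree with r_1. *)
Definition less_code : cmd :=
  While 21
    (Op (ISub 21 21 11) ;; Op (ILoad 23 22) ;; Op (IAdd 22 22 11) ;;
     Op (ILoad 24 22) ;; Op (IAdd 22 22 11) ;; Op (IShr 25 1 21) ;;
     Op (IAnd 25 25 11) ;; step_code).

(** In a tree every child has its own vector, so the range starts there without an offset and r_24
    stays 0; the directory gives the code bit where that of a matrix gives the number of zeros. *)
Definition walk_code : cmd :=
  Op (IConst 24 0) ;;
  While 21
    (Op (ISub 21 21 11) ;; Op (ILoad 23 22) ;; Op (IAdd 22 22 11) ;;
     Op (ILoad 25 22) ;; Op (IAdd 22 22 11) ;; Op (IConst 28 0) ;; step_code).

Definition step_time (gam c : nat) := 1 + (rank_time gam c + (2 + (rank_time gam c + 8))).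
Definition loop_time (gam c : nat) := 9 + step_time gam c.

(** One level of a wavelet matrix: the stable partition by bit [e], zeros first. *)
Definition part (e : nat) (X : list nat) : list nat :=
  filter (fun x => negb (Nat.testbit x e)) X ++ filter (fun x => Nat.testbit x e) X.

Section Run.
Variables (P : params) (m : nat -> nat) (tbl : nat).
Notation w := (pw P).
Notation ok := (wp w m).
Notation gam := (pgam P).
Notation cst := (layout_regs P tbl).
Hypothesis G : good P m tbl.
Variable c : nat.
Hypothesis Hc : w <= ptau P * c.

Definition vecl (a : nat) (V : list bool) : Prop :=
  # V < 2 ^ w /\ vec P m a (fun k => nth k V false) (# V).

Lemma step_ok V1 VY V2 r :
  cst r -> vecl (r 23) (V1 ++ VY ++ V2) ->
  r 26 = # V1 -> r 27 = # V1 + # VY -> r 28 + # VY < 2 ^ w ->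
  (r 25 <> 0 -> r 24 + ones (V1 ++ VY) < 2 ^ w) ->
  ok step_code (step_time gam c)
    (fun r' => frame 26 r r' /\
       if r 25 =? 0 then r' 26 = zeros V1 /\ r' 27 = zeros V1 + zeros VY /\ r' 28 = r 28
       else r' 26 = r 24 + ones V1 /\ r' 27 = r 24 + ones V1 + ones VY /\
            r' 28 = r 28 + zeros VY) r.
Proof.
  intros Cr [HV1 HV2] R26 R27 R28 Hz. rewrite !length_app in HV1.
  pose proof (ones_zeros V1) as OZ1. pose proof (ones_zeros VY) as OZY.
  unfold step_code, step_time. rewrite ones_app in Hz.
  instr ok_mov; [lia |].
  eapply ok_seq. eapply ok_weaken; [eapply (rank_ok P m tbl G c) | apply le_n |].
  - apply (frame_cst P tbl 30 r); auto; [lia |]. apply frame_upd; [lia | apply frame_refl].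
  - exact Hc.
  - exact HV2.
  - cbn. rewrite length_app. lia.
  - rewrite !length_app. lia.
  - cbn [upd Nat.eqb]. rewrite R26, cntr_list. intros r1 [R31 F1].
    assert (F1' : frame 30 r r1).
    { eapply frame_trans; [ | | exact F1]; [lia |]. apply frame_upd; [lia | apply frame_refl]. }
    instr ok_mov; [lia |].
    instr ok_mov; [rewrite F1' by lia; lia |].
    rewrite (F1' 27) by lia.
    eapply ok_seq. eapply ok_weaken; [eapply (rank_ok P m tbl G c) | apply le_n |].
    + apply (frame_cst P tbl 29 r); auto; [lia |].
      do 2 (apply frame_upd; [lia |]). intros x Hx; apply F1'; lia.
    + exact Hc.
    + cbn. rewrite (F1' 23) by lia. exact HV2.
    + cbn. rewrite R27, !length_app. lia.
    + rewrite !length_app. lia.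
    + cbn [upd Nat.eqb].
      rewrite R27, <- length_app, app_assoc, cntr_list, ones_app, length_app.
      intros r2 [R31' F2].
      assert (E29 : r2 29 = ones V1) by (rewrite F2 by lia; exact R31).
      assert (F2' : frame 29 r r2).
      { intros x Hx. rewrite F2 by lia. cbn.
        rewrite (proj2 (Nat.eqb_neq x 29)), (proj2 (Nat.eqb_neq x 30)) by lia.
        apply F1'. lia. }
      eapply ok_weaken; [eapply ok_if with (T := 6) | lia | intros r' H; exact H];
        rewrite (F2' 25) by lia; intros e25.
      * rewrite (proj2 (Nat.eqb_neq _ _) e25).
        specialize (Hz e25).
        instr ok_sub; rewrite ?F2' by lia; [lia | lia |].
        instr ok_sub; rewrite ?F2', ?E29, ?R31' by lia;
          [lia | lia |].
        instr ok_sub; [lia | lia |].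
        instr ok_add; rewrite ?F2' by lia; [lia |].
        instr ok_add; rewrite ?E29, ?F2' by lia; [lia |].
        eapply ok_add; cbn [upd Nat.eqb]; rewrite ?R31', ?F2' by lia; [lia |].
        cbn [upd Nat.eqb]. repeat split; try lia.
        repeat (apply frame_upd; [lia |]). intros x Hx; apply F2'; lia.
      * rewrite e25. cbn [Nat.eqb].
        eapply ok_weaken; [ | | intros r' H; exact H].
        { instr ok_sub; rewrite ?E29, ?F2' by lia;
            [lia | lia |].
          eapply ok_sub; cbn [upd Nat.eqb]; rewrite ?R31', ?F2' by lia; [lia | lia |].
          cbn [upd Nat.eqb]. rewrite ?F2' by lia. repeat split; try lia.
          repeat (apply frame_upd; [lia |]). intros x Hx; apply F2'; lia. }
        lia.
Qed.

(* [wmat ptr e X]: at [ptr] starts the directory of a wavelet matrix of the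
   low [e] bits of [X]. *)
Fixpoint wmat (ptr e : nat) (X : list nat) : Prop :=
  match e with
  | 0 => True
  | S e' =>
      vecl (m ptr) (map (fun x => Nat.testbit x e') X) /\ m ptr < 2 ^ w /\
      m (ptr + 1) = zeros (map (fun x => Nat.testbit x e') X) /\
      wmat (ptr + 2) e' (part e' X)
  end.

Definition bitsel (b : nat) (v : bool) (X : list nat) : list nat :=
  filter (fun x => Bool.eqb (Nat.testbit x b) v) X.

Lemma bitsel_zeros b X : # (bitsel b false X) = zeros (map (fun x => Nat.testbit x b) X).
Proof. rewrite zeros_map. reflexivity. Qed.

Lemma bitsel_ones b X : # (bitsel b true X) = ones (map (fun x => Nat.testbit x b) X).
Proof.
  rewrite ones_map. unfold bitsel. f_equal. apply filter_ext. intros x.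
  now destruct (Nat.testbit x b).
Qed.

Lemma part_bitsel b X : part b X = bitsel b false X ++ bitsel b true X.
Proof.
  unfold part, bitsel. f_equal.
  apply filter_ext. intros x. now destruct (Nat.testbit x b).
Qed.

Lemma bitsel_app b v X Y : bitsel b v (X ++ Y) = bitsel b v X ++ bitsel b v Y.
Proof. apply filter_app. Qed.

Lemma bitsel_split b X : # (bitsel b false X) + # (bitsel b true X) = # X.
Proof.
  rewrite bitsel_zeros, bitsel_ones, Nat.add_comm, ones_zeros. apply length_map.
Qed.

Lemma part_length b X : # (part b X) = # X.
Proof. rewrite part_bitsel, length_app. apply bitsel_split. Qed.

(** Because [part] is stable, the elements of the range with a given bit are again contiguous; those
    with a 1 come after all the zeros of the level, whose number is r_24. *)
Lemma matrix_step_ok b v X1 Y X2 r :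
  cst r -> vecl (r 23) (map (fun x => Nat.testbit x b) (X1 ++ Y ++ X2)) ->
  r 24 = # (bitsel b false (X1 ++ Y ++ X2)) -> r 25 = Nat.b2n v ->
  r 26 = # X1 -> r 27 = # X1 + # Y -> r 28 + # Y < 2 ^ w ->
  ok step_code (step_time gam c)
    (fun r' => frame 26 r r' /\
       (exists X1' X2', part b (X1 ++ Y ++ X2) = X1' ++ bitsel b v Y ++ X2' /\
          r' 26 = # X1' /\ r' 27 = # X1' + # (bitsel b v Y)) /\
       r' 28 = r 28 + if v then # (bitsel b false Y) else 0) r.
Proof.
  intros Cr HV R24 R25 R26 R27 R28. assert (Hn := proj1 HV). rewrite length_map in Hn.
  rewrite !map_app in HV.
  assert (Happ : forall u, # (bitsel b u (X1 ++ Y ++ X2)) =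
    # (bitsel b u X1) + (# (bitsel b u Y) + # (bitsel b u X2))).
  { intros u. now rewrite !bitsel_app, !length_app. }
  pose proof (bitsel_split b (X1 ++ Y ++ X2)) as HS.
  eapply ok_weaken; [apply (step_ok (map (fun x => Nat.testbit x b) X1)
    (map (fun x => Nat.testbit x b) Y) (map (fun x => Nat.testbit x b) X2)); auto
    | apply le_n |].
  - now rewrite length_map.
  - now rewrite !length_map.
  - now rewrite length_map.
  - intros _. rewrite ones_app, <- !bitsel_ones, R24. rewrite !Happ in *. lia.
  - intros r' [F Hr']. split; auto. rewrite <- !bitsel_zeros, <- !bitsel_ones, R24, R25 in Hr'.
    rewrite part_bitsel.
    destruct v; cbn [Nat.b2n Nat.eqb] in Hr'; destruct Hr' as (Q26 & Q27 & Q28);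
      (split; [| lia]).
    + exists (bitsel b false (X1 ++ Y ++ X2) ++ bitsel b true X1), (bitsel b true X2).
      rewrite length_app. split; [| lia].
      now rewrite (bitsel_app b true X1), (bitsel_app b true Y), !app_assoc.
    + exists (bitsel b false X1), (bitsel b false X2 ++ bitsel b true (X1 ++ Y ++ X2)).
      split; [| lia].
      now rewrite (bitsel_app b false X1), (bitsel_app b false Y), <- !app_assoc.
Qed.

Definition below (i e x : nat) : bool := x mod 2 ^ e <? i mod 2 ^ e.

Lemma mod_succ x e : x mod 2 ^ S e = x mod 2 ^ e + 2 ^ e * Nat.b2n (Nat.testbit x e).
Proof.
  rewrite Nat.testbit_spec'. replace (2 ^ S e) with (2 ^ e * 2) by (cbn; lia).
  apply Nat.Div0.mod_mul_r.
Qed.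

Lemma below_succ i e x :
  below i (S e) x =
  match Nat.testbit i e, Nat.testbit x e with
  | true, false => true
  | false, true => false
  | _, _ => below i e x
  end.
Proof.
  unfold below. rewrite !mod_succ.
  assert (Hx := Nat.mod_upper_bound x (2 ^ e) (pow2_neq0 e)).
  assert (Hi := Nat.mod_upper_bound i (2 ^ e) (pow2_neq0 e)).
  destruct (Nat.testbit i e), (Nat.testbit x e); cbn [Nat.b2n];
    destruct (Nat.ltb_spec (x mod 2 ^ e) (i mod 2 ^ e));
    match goal with |- (?a <? ?b) = _ => destruct (Nat.ltb_spec a b) end; lia.
Qed.

(** This is the accounting of one round of [less_code]: the first summand is added to r_28, the
    second is left to the lower levels. *)
Lemma below_count i e Y :
  # (filter (below i (S e)) Y) =
  (if Nat.testbit i e then # (bitsel e false Y) else 0) +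
  # (filter (below i e) (bitsel e (Nat.testbit i e) Y)).
Proof.
  unfold bitsel. induction Y as [|x Y IH]; cbn [filter length].
  - destruct (Nat.testbit i e); reflexivity.
  - rewrite below_succ. destruct (Nat.testbit i e), (Nat.testbit x e);
      cbn [Bool.eqb filter length]; try destruct (below i e x); cbn [length]; lia.
Qed.

Lemma less_ok e : forall X1 Y X2 ptr i r,
  cst r -> r 1 = i -> r 21 = e -> r 22 = ptr -> i < 2 ^ w ->
  wmat ptr e (X1 ++ Y ++ X2) -> # (X1 ++ Y ++ X2) < 2 ^ w ->
  ptr + 2 * e < 2 ^ w -> e < 2 ^ w ->
  r 26 = # X1 -> r 27 = # X1 + # Y -> r 28 + # Y < 2 ^ w ->
  ok less_code (e * loop_time gam c + 1)
    (fun r' => frame 21 r r' /\ r' 22 = ptr + 2 * e /\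
               r' 28 = r 28 + # (filter (below i e) Y)) r.
Proof.
  intros X1 Y X2 ptr i r Cr R1 R21 R22 Hi HW Hn Hptr He R26 R27 R28.
  set (tot := r 28 + # (filter (below i e) Y)).
  eapply ok_weaken; [apply ok_while with (k := e) (T := 7 + step_time gam c)
     (I := fun k r' => exists X1 Y X2,
        frame 21 r r' /\ r' 21 = k /\ r' 22 + 2 * k = ptr + 2 * e /\ k <= e /\
        wmat (r' 22) k (X1 ++ Y ++ X2) /\ # (X1 ++ Y ++ X2) < 2 ^ w /\
        r' 26 = # X1 /\ r' 27 = # X1 + # Y /\ r' 28 + # Y < 2 ^ w /\
        r' 28 + # (filter (below i k) Y) = tot)
    | unfold loop_time; lia | intros r' H; exact H].
  - intros k r' (X1' & Y' & X2' & F & H1 & H2 & _ & _ & _ & _ & _ & _ & H3) e0.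
    rewrite H1 in e0. subst k. rewrite e0 in H2, H3.
    split; [auto | split; [lia|]]. rewrite <- H3.
    enough (filter (below i 0) Y' = []) as -> by (cbn; lia).
    clear. induction Y'; auto.
  - clearbody tot. clear X1 Y X2 HW Hn R26 R27 R28.
    intros k r' (X1 & Y & X2 & F & H1 & H2 & Hk & HW & Hn & R26 & R27 & R28 & Ht) e0.
    destruct k as [|k]; [lia |]. exists k. split; auto.
    cbn [wmat] in HW. destruct HW as (HV & Hp & HZ & HW).
    assert (E11 : r' 11 = 1) by (rewrite F by lia; apply Cr).
    assert (Gw := good_w P m tbl G).
    assert (E1 : r' 1 = i) by (rewrite F by lia; auto).
    pose proof (bitsel_split k (X1 ++ Y ++ X2)) as HS. rewrite <- bitsel_zeros in HZ.
    change (7 + step_time gam c) with (S (S (S (S (S (S (S (step_time gam c)))))))).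
    instr ok_sub; rewrite ?E11, ?H1; [lia | lia |].
    instr ok_load; [reflexivity | exact Hp |].
    instr ok_add; rewrite ?E11; [lia |].
    instr ok_load; [exact HZ | lia |].
    instr ok_add; rewrite ?E11; [lia |].
    instr ok_shr; rewrite ?E1; [lia |].
    instr ok_and1; rewrite ?E11; [lia | lia |].
    replace (S k - 1) with k by lia. rewrite <- Nat.testbit_spec'.
    match goal with |- wp _ _ _ _ _ ?r0 => set (r1 := r0) end.
    assert (F1 : frame 21 r' r1)
      by (unfold r1; repeat (apply frame_upd; [lia|]); apply frame_refl).
    assert (E21 : r1 21 = k) by reflexivity.
    assert (E22 : r1 22 = r' 22 + 2) by (unfold r1; cbn [upd Nat.eqb]; lia).
    assert (E28 : r1 28 = r' 28) by reflexivity.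
    eapply ok_weaken; [apply (matrix_step_ok k (Nat.testbit i k) X1 Y X2); auto
      | apply le_n |].
    + apply (frame_cst P tbl 21 r); [lia | | auto]. intros x Hx. rewrite F1, F by lia. auto.
    + intros r2 (F2 & (X1' & X2' & Epart & Q26 & Q27) & Q28).
      rewrite E28 in Q28. clearbody r1. rewrite below_count in Ht.
      exists X1', (bitsel k (Nat.testbit i k) Y), X2'.
      pose proof (bitsel_split k Y).
      rewrite <- Epart, part_length, (F2 21), (F2 22), E21, E22 by lia.
      repeat split; auto; try lia.
      * intros x Hx. rewrite F2, F1, F by lia. reflexivity.
      * destruct (Nat.testbit i k); lia.
  - exists X1, Y, X2. subst ptr; repeat split; auto; lia.
Qed.

(* The directory of the path of a code: [xs] are the remaining codes of the
   elements at the current node. *)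
Fixpoint wpath (ptr : nat) (code : list bool) (xs : list (list bool)) : Prop :=
  match code with
  | [] => True
  | b :: code' =>
      vecl (m ptr) (map (hd false) xs) /\ m ptr < 2 ^ w /\ m (ptr + 1) = Nat.b2n b /\
      wpath (ptr + 2) code' (map (@tl bool) (filter (fun x => Bool.eqb (hd false x) b) xs))
  end.

Definition child (b : bool) (xs : list (list bool)) : list (list bool) :=
  map (@tl bool) (filter (fun x => Bool.eqb (hd false x) b) xs).

Definition walk (code : list bool) (xs : list (list bool)) : list (list bool) :=
  fold_left (fun xs b => child b xs) code xs.

Lemma child_app b xs ys : child b (xs ++ ys) = child b xs ++ child b ys.
Proof. unfold child. now rewrite filter_app, map_app. Qed.

Lemma child_true xs : # (child true xs) = ones (map (hd false) xs).
Proof.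
  unfold child. rewrite length_map, ones_map. f_equal. apply filter_ext.
  intros [|[] x]; reflexivity.
Qed.

Lemma child_false xs : # (child false xs) = zeros (map (hd false) xs).
Proof.
  unfold child. rewrite length_map, zeros_map. reflexivity.
Qed.

Lemma walk_ok code X1 Y X2 ptr r :
  cst r -> r 21 = # code -> r 22 = ptr ->
  wpath ptr code (X1 ++ Y ++ X2) -> # (X1 ++ Y ++ X2) < 2 ^ w ->
  ptr + 2 * # code < 2 ^ w ->
  r 26 = # X1 -> r 27 = # X1 + # Y ->
  ok walk_code (# code * loop_time gam c + 2)
    (fun r' => frame 21 r r' /\ r' 22 = ptr + 2 * # code /\
               r' 26 = # (walk code X1) /\ r' 27 = # (walk code X1) + # (walk code Y)) r.
Proof.
  intros Cr R21 R22 HW Hn Hptr R26 R27.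
  assert (Gw := good_w P m tbl G).
  assert (Gww := Nat.pow_gt_lin_r 2 w ltac:(lia)).
  set (L1 := # (walk code X1)). set (LY := # (walk code Y)).
  unfold walk_code.
  eapply ok_weaken with (T := S (# code * loop_time gam c + 1));
    [| lia | intros ? HQ; exact HQ].
  eapply ok_step, ok_const; [lia |].
  eapply ok_weaken; [apply ok_while with (k := # code) (T := 7 + step_time gam c)
     (I := fun k r' => exists code' X1 Y X2,
        frame 21 r r' /\ r' 21 = k /\ k = # code' /\ r' 22 + 2 * k = ptr + 2 * # code /\
        wpath (r' 22) code' (X1 ++ Y ++ X2) /\ # (X1 ++ Y ++ X2) < 2 ^ w /\
        r' 24 = 0 /\
        r' 26 = # X1 /\ r' 27 = # X1 + # Y /\
        # (walk code' X1) = L1 /\ # (walk code' Y) = LY)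
    | unfold loop_time; lia | intros r' H; exact H].
  - intros k r' (code' & X1' & Y' & X2' & F & H1 & H1' & H2 & _ & _ & _ & H3 & H4 & H5 & H6) e0.
    destruct code'; [ | cbn in H1'; lia]. cbn in *. repeat split; auto; lia.
  - clearbody L1 LY. clear X1 Y X2 HW Hn R26 R27.
    intros k r' (code' & X1 & Y & X2 & F & H1 & H1' & H2 & HW & Hn & R24 & R26 & R27 & HL1 & HLY) e0.
    destruct code' as [|b code']; [cbn in H1'; lia |].
    exists (# code'). split; [auto |].
    cbn [wpath] in HW. destruct HW as (HV & Hp & HZ & HW).
    assert (Cr' : cst r') by (apply (frame_cst P tbl 21 r); auto; lia).
    assert (E11 : r' 11 = 1) by apply Cr'.
    rewrite !map_app in HV. cbn [length] in H1'.
    rewrite !length_app in Hn.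
    change (7 + step_time gam c) with (S (S (S (S (S (S (S (step_time gam c)))))))).
    eapply ok_weaken with (T := S (S (S (S (S (S (step_time gam c))))))); [| lia | intros ? HQ; exact HQ].
    instr ok_sub; rewrite ?E11, ?H1; [lia | lia |].
    instr ok_load; [reflexivity | exact Hp |].
    instr ok_add; rewrite ?E11; [lia |].
    instr ok_load; [exact HZ | destruct b; cbn; lia |].
    instr ok_add; rewrite ?E11; [lia |].
    instr ok_const; [lia |].
    match goal with |- wp _ _ _ _ _ ?r0 => set (r1 := r0) end.
    assert (F1 : frame 21 r' r1)
      by (unfold r1; repeat (apply frame_upd; [lia|]); apply frame_refl).
    assert (E21 : r1 21 = # code') by (unfold r1; cbn [upd Nat.eqb]; lia).
    assert (E22 : r1 22 = r' 22 + 2) by (unfold r1; cbn [upd Nat.eqb]; lia).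
    assert (E24 : r1 24 = 0) by exact R24.
    eapply ok_weaken; [apply (step_ok (map (hd false) X1)
       (map (hd false) Y) (map (hd false) X2)) | apply le_n |].
    + apply (frame_cst P tbl 21 r'); auto; lia.
    + exact HV.
    + unfold r1. cbn [upd Nat.eqb]. now rewrite length_map.
    + unfold r1. cbn [upd Nat.eqb]. now rewrite !length_map.
    + unfold r1. cbn [upd Nat.eqb]. rewrite !length_map. lia.
    + intros _. rewrite E24, ones_app.
      pose proof (ones_zeros (map (hd false) X1)) as OZ1.
      pose proof (ones_zeros (map (hd false) Y)) as OZ2.
      rewrite !length_map in OZ1, OZ2. lia.
    + unfold r1 at 2. cbn [upd Nat.eqb]. rewrite E24. clearbody r1. intros r2 [F2 Hr2].
      assert (F3 : frame 21 r r2).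
      { intros x Hx. rewrite F2, F1, F by lia. reflexivity. }
      exists code', (child b X1), (child b Y), (child b X2).
      replace (r' 22 + 2) with (r2 22) in HW by (rewrite F2, E22 by lia; auto).
      fold (child b (X1 ++ Y ++ X2)) in HW. rewrite !child_app in HW.
      assert (Hlen : forall xs, # (child b xs) <= # xs).
      { intros xs. unfold child. rewrite length_map. apply filter_length_le. }
      rewrite !length_app.
      pose proof (Hlen X1). pose proof (Hlen Y). pose proof (Hlen X2).
      assert (Hr2' : r2 26 = # (child b X1) /\ r2 27 = # (child b X1) + # (child b Y)).
      { destruct b; cbn [Nat.b2n Nat.eqb] in Hr2;
          rewrite ?child_true, ?child_false; intuition. }
      destruct Hr2' as (Q26 & Q27).
      repeat split; auto; try lia.
      * rewrite F2, E21 by lia; auto.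
      * rewrite F2, E22 by lia. lia.
      * rewrite F2, E24 by lia; auto.
  - exists code, X1, Y, X2.
    repeat split; auto; cbn [upd Nat.eqb]; try lia; [apply frame_upd; [lia | apply frame_refl] | rewrite R22; auto].
Qed.

End Run.

(* With r_25 the value of bit r_16: r_20 := number of elements of the current
   range having that bit, r_28 := number of those that are moreover below r_1 in
   their low r_16 bits. *)
Definition half_code : cmd :=
  Op (ILoad 23 22) ;; Op (IAdd 22 22 11) ;; Op (ILoad 24 22) ;; Op (IAdd 22 22 11) ;;
  Op (IConst 28 0) ;; step_code ;; Op (ISub 20 27 26) ;; Op (IConst 28 0) ;;
  Op (IOr 21 16 16) ;; less_code.

(** Evaluates [gapsel_count]: the top level of the matrix is entered twice from the saved range,
    once for the elements that agree with [i] in bit [b] and once for the others, whose count is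
    complemented. *)
Definition gap_code : cmd :=
  Op (IOr 17 26 26) ;; Op (IOr 18 27 27) ;; Op (IOr 14 22 22) ;;
  Op (IShr 19 1 16) ;; Op (IAnd 19 19 11) ;; Op (IOr 25 19 19) ;;
  half_code ;; Op (IAdd 0 0 28) ;;
  Op (IOr 26 17 17) ;; Op (IOr 27 18 18) ;; Op (IOr 22 14 14) ;; Op (ISub 25 11 19) ;;
  half_code ;; Op (IAdd 0 0 20) ;; Op (ISub 0 0 28).

(** The window ends at the smaller of j and i - 1 + 2^b. Testing j - i shifted right by b first
    avoids forming 2^b, which would overflow for the width [w] given to classes without gaps. *)
Definition class_code : cmd :=
  Op (ILoad 15 22) ;; Op (IAdd 22 22 11) ;; Op (ILoad 16 22) ;; Op (IAdd 22 22 11) ;;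
  Op (ILoad 21 22) ;; Op (IAdd 22 22 11) ;;
  Op (ISub 26 1 11) ;; Op (ISub 20 2 1) ;; Op (IShr 20 20 16) ;;
  If 20 (Op (IShl 27 11 16) ;; Op (IAdd 27 27 26)) (Op (IOr 27 2 2)) ;;
  walk_code ;;
  If 15
    (Op (ISub 20 15 11) ;;
     If 20 gap_code (Op (ISub 20 27 26) ;; Op (IAdd 0 0 20)))
    (Op (ILt 20 26 27) ;; Op (IAdd 0 0 20)).

Definition half_time gam c b := 8 + step_time gam c + (b * loop_time gam c + 1).
Definition gap_time gam c b := 13 + 2 * half_time gam c b.
Definition class_time gam c kd l b :=
  21 + (l * loop_time gam c + 2) + gap_time gam c (if kd =? 2 then b else 0).

Section Run.
Variables (P : params) (m : nat -> nat) (tbl : nat).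
Notation w := (pw P).
Notation ok := (wp w m).
Notation gam := (pgam P).
Notation cst := (layout_regs P tbl).
Hypothesis G : good P m tbl.
Variable c : nat.
Hypothesis Hc : w <= ptau P * c.

Lemma half_ok b v X1 Y X2 ptr i r :
  cst r -> r 1 = i -> r 16 = b -> r 22 = ptr -> i < 2 ^ w -> b < 2 ^ w ->
  wmat P m ptr (S b) (X1 ++ Y ++ X2) -> # (X1 ++ Y ++ X2) < 2 ^ w ->
  ptr + 2 * S b < 2 ^ w -> r 25 = Nat.b2n v ->
  r 26 = # X1 -> r 27 = # X1 + # Y ->
  ok half_code (half_time gam c b)
    (fun r' => frame 20 r r' /\ r' 22 = ptr + 2 * S b /\
               r' 20 = # (bitsel b v Y) /\
               r' 28 = # (filter (below i b) (bitsel b v Y))) r.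
Proof.
  intros Cr R1 R16 R22 Hi Hb HW Hn Hptr R25 R26 R27.
  assert (E11 : r 11 = 1) by apply Cr.
  assert (Gw := good_w P m tbl G).
  cbn [wmat] in HW. destruct HW as (HV & Hp & HZ & HW).
  pose proof (bitsel_split b (X1 ++ Y ++ X2)) as HS. rewrite <- bitsel_zeros in HZ.
  pose proof (bitsel_split b Y) as HSY.
  unfold half_code, half_time.
  eapply ok_weaken; [ | | intros ? HQ; exact HQ].
  1: instr ok_load; [rewrite R22; reflexivity | exact Hp |].
  1: instr ok_add; rewrite ?E11, ?R22; [lia |].
  1: instr ok_load; [exact HZ | lia |].
  1: instr ok_add; rewrite ?E11; [lia |].
  1: instr ok_const; [lia |].
  1: match goal with |- wp _ _ _ _ _ ?r0 => set (r1 := r0) end.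
  1: assert (F1 : frame 20 r r1)
      by (unfold r1; repeat (apply frame_upd; [lia|]); apply frame_refl).
  1: assert (E22 : r1 22 = ptr + 2) by (unfold r1; cbn [upd Nat.eqb]; lia).
  1: eapply ok_seq, ok_weaken;
      [apply (matrix_step_ok P m tbl G c Hc b v X1 Y X2); auto | apply le_n |].
  - rewrite !length_app in Hn. unfold r1. cbn [upd Nat.eqb]. lia.
  - intros r2 (F2 & (X1' & X2' & Epart & Q26 & Q27) & _). clearbody r1.
    assert (F3 : frame 20 r r2) by (intros x Hx; rewrite F2, F1 by lia; auto).
    assert (Hl := f_equal (@length nat) Epart). rewrite part_length, !length_app in Hl.
    rewrite !length_app in Hn.
    assert (HY : r2 27 - r2 26 = # (bitsel b v Y)) by lia.
    instr ok_sub; [lia | lia |]. rewrite HY.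
    instr ok_const; [lia |].
    instr ok_mov; rewrite (F3 16), ?R16 by lia; [lia |].
    match goal with |- wp _ _ _ _ _ ?r0 => set (r3 := r0) end.
    assert (F4 : frame 20 r r3).
    { unfold r3. apply frame_upd; [lia|]. apply frame_upd; [lia|]. apply frame_upd; [lia|]. auto. }
    eapply ok_weaken; [apply (less_ok P m tbl G c Hc b X1' (bitsel b v Y) X2' (ptr + 2) i) | apply le_n |].
    + apply (frame_cst P tbl 20 r); auto; lia.
    + rewrite F4 by lia. auto.
    + reflexivity.
    + unfold r3. cbn [upd Nat.eqb]. rewrite F2 by lia. auto.
    + auto.
    + rewrite <- Epart. auto.
    + rewrite !length_app. lia.
    + lia.
    + auto.
    + exact Q26.
    + exact Q27.
    + unfold r3. cbn [upd Nat.eqb].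
      assert (# (bitsel b v Y) <= # Y) by apply filter_length_le. lia.
    + intros r4 (F5 & Q22 & Q28).
      assert (E20 : r3 20 = # (bitsel b v Y)) by reflexivity.
      assert (E28 : r3 28 = 0) by reflexivity. rewrite E28 in Q28. clearbody r3.
      repeat split; try lia.
      * intros x Hx. rewrite F5, F4 by lia. auto.
      * rewrite F5 by lia. auto.
  - cbn [Nat.add]. lia.
Qed.

(** Decides x < i from the low b + 1 bits of both, for x at distance less than 2^b from i; see
    [gapsel_correct]. *)
Definition gapsel (i b x : nat) : bool :=
  if Bool.eqb (Nat.testbit x b) (Nat.testbit i b) then below i b x
  else negb (below i b x).

Lemma gapsel_count i b Y :
  # (filter (gapsel i b) Y) =
  # (filter (below i b) (bitsel b (Nat.testbit i b) Y)) +
  (# (bitsel b (negb (Nat.testbit i b)) Y) -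
   # (filter (below i b) (bitsel b (negb (Nat.testbit i b)) Y))).
Proof.
  assert (H : # (filter (below i b) (bitsel b (negb (Nat.testbit i b)) Y)) <=
          # (bitsel b (negb (Nat.testbit i b)) Y)) by apply filter_length_le.
  enough (# (filter (gapsel i b) Y) +
    # (filter (below i b) (bitsel b (negb (Nat.testbit i b)) Y)) =
    # (filter (below i b) (bitsel b (Nat.testbit i b) Y)) +
    # (bitsel b (negb (Nat.testbit i b)) Y)) by lia.
  clear H. unfold bitsel, gapsel. induction Y as [|x Y IH]; cbn [filter length]; auto.
  destruct (Nat.testbit x b), (Nat.testbit i b), (below i b x) eqn:E;
    cbn [Bool.eqb negb filter length] in IH |- *; rewrite ?E; cbn [negb filter length]; rewrite ?E; cbn [length]; lia.
Qed.

Lemma gap_ok b X1 Y X2 ptr i r :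
  cst r -> r 1 = i -> r 16 = b -> r 22 = ptr -> i < 2 ^ w -> b < 2 ^ w ->
  wmat P m ptr (S b) (X1 ++ Y ++ X2) -> # (X1 ++ Y ++ X2) < 2 ^ w ->
  ptr + 2 * S b < 2 ^ w -> r 0 + # Y < 2 ^ w ->
  r 26 = # X1 -> r 27 = # X1 + # Y ->
  ok gap_code (gap_time gam c b)
    (fun r' => (forall x, 1 <= x < 14 -> r' x = r x) /\ r' 22 = ptr + 2 * S b /\
               r' 0 = r 0 + # (filter (gapsel i b) Y)) r.
Proof.
  intros Cr R1 R16 R22 Hi Hb HW Hn Hptr R0 R26 R27.
  assert (E11 : r 11 = 1) by apply Cr.
  assert (Gw := good_w P m tbl G).
  assert (Hlen := Hn). rewrite !length_app in Hlen.
  rewrite gapsel_count. set (v := Nat.testbit i b).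
  assert (L1 : # (filter (below i b) (bitsel b (negb v) Y)) <= # (bitsel b (negb v) Y))
    by apply filter_length_le.
  assert (L2 : # (filter (below i b) (bitsel b v Y)) <= # (bitsel b v Y))
    by apply filter_length_le.
  assert (L3 : # (bitsel b v Y) + # (bitsel b (negb v) Y) = # Y).
  { pose proof (bitsel_split b Y). destruct v; cbn [negb]; lia. }
  unfold gap_code, gap_time.
  eapply ok_weaken; [ | | intros ? HQ; exact HQ].
  1: instr ok_mov; [lia |].
  1: instr ok_mov; [lia |].
  1: instr ok_mov; [lia |].
  1: instr ok_shr; rewrite ?R1, ?R16; [lia |].
  1: instr ok_and1; rewrite ?E11; [lia | lia |].
  1: rewrite <- Nat.testbit_spec'; fold v.
  1: instr ok_mov; [destruct v; cbn; lia |].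
  1: match goal with |- wp _ _ _ _ _ ?r0 => set (r1 := r0) end.
  1: assert (F1 : frame 14 r r1)
      by (unfold r1; repeat (apply frame_upd; [lia|]); apply frame_refl).
  1: eapply ok_seq, ok_weaken; [apply (half_ok b v X1 Y X2 ptr i) | apply le_n |];
     try assumption; try reflexivity.
  - intros r2 (F2 & _ & _ & Q28).
    assert (F2' : frame 14 r r2) by (intros x Hx; rewrite F2, F1 by lia; auto).
    assert (E17 : r2 17 = # X1) by (rewrite F2 by lia; exact R26).
    assert (E18 : r2 18 = # X1 + # Y) by (rewrite F2 by lia; exact R27).
    assert (E14 : r2 14 = ptr) by (rewrite F2 by lia; exact R22).
    assert (E19 : r2 19 = Nat.b2n v) by (rewrite F2 by lia; reflexivity).
    assert (E16 : r2 16 = b) by (rewrite F2 by lia; exact R16).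
    assert (E0 : r2 0 = r 0) by (apply F2'; lia).
    assert (E11' : r2 11 = 1) by (rewrite F2' by lia; auto). clearbody r1.
    instr ok_add; [lia |].
    instr ok_mov; [lia |].
    instr ok_mov; [lia |].
    instr ok_mov; [lia |].
    instr ok_sub; rewrite ?E11', ?E19;
      [destruct v; cbn; lia | lia |].
    match goal with |- wp _ _ _ _ _ ?r0 => set (r3 := r0) end.
    assert (F3 : forall x, 1 <= x < 20 -> r3 x = r2 x).
    { intros x Hx. unfold r3. cbn.
      do 5 (rewrite (proj2 (Nat.eqb_neq x _)) by lia). reflexivity. }
    assert (Cr3 : cst r3).
    { assert (Cr2 : cst r2) by (apply (frame_cst P tbl 14 r); auto; lia).
      unfold layout_regs in Cr2 |- *. rewrite !F3 by lia. auto. }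
    eapply ok_seq, ok_weaken; [apply (half_ok b (negb v) X1 Y X2 ptr i) | apply le_n |];
      try assumption.
    + rewrite F3, F2' by lia. auto.
    + unfold r3. cbn [upd Nat.eqb]. destruct v; reflexivity.
    + intros r4 (F4 & Q22 & Q20 & Q28').
      assert (E0' : r3 0 = r 0 + # (filter (below i b) (bitsel b v Y)))
        by (unfold r3; cbn [upd Nat.eqb]; lia).
      assert (E04 : r4 0 = r3 0) by (apply F4; lia). clearbody r3.
      instr ok_add; [lia |].
      eapply ok_sub; cbn [upd Nat.eqb]; [lia | lia |].
      cbn [upd Nat.eqb]. repeat split; try lia.
      intros x Hx. rewrite (proj2 (Nat.eqb_neq x _)) by lia.
      rewrite F4, F3, F2' by lia. auto.
  - lia.
Qed.

(* The contribution of a class: 0 a frequent character, 1 the first occurrences,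
   2 a gap class with previous occurrences [Y] in the window. *)
Definition contrib (kd i b EY : nat) (Y : list nat) : nat :=
  match kd with
  | 0 => if 0 <? EY then 1 else 0
  | 1 => EY
  | _ => # (filter (gapsel i b) Y)
  end.

Definition wclass (ptr kd b : nat) (code : list bool) (xs : list (list bool)) (X : list nat) : Prop :=
  m ptr = kd /\ m (ptr + 1) = b /\ m (ptr + 2) = # code /\
  wpath P m (ptr + 3) code xs /\
  (kd = 2 -> wmat P m (ptr + 3 + 2 * # code) (S b) X).

Definition class_len (kd b l : nat) := 3 + 2 * l + (if kd =? 2 then 2 * S b else 0).

(** The walk turns the window of positions into a range of ranks within the class, and the matrix of
    the class is indexed by these ranks. Hence [C1] and [CY] are as long as the results of the two
    walks. *)
Lemma class_ok kd b code X1 Y X2 C1 CY C2 ptr i j r :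
  cst r -> r 1 = i -> r 2 = j -> r 22 = ptr -> 1 <= i <= j -> j < 2 ^ w ->
  kd <= 2 -> b < 2 ^ w ->
  wclass ptr kd b code (X1 ++ Y ++ X2) (C1 ++ CY ++ C2) -> # (X1 ++ Y ++ X2) < 2 ^ w ->
  # X1 = i - 1 -> # Y + (i - 1) = min j (i - 1 + 2 ^ b) ->
  (kd = 2 -> # C1 = # (walk code X1) /\ # CY = # (walk code Y) /\ # (C1 ++ CY ++ C2) < 2 ^ w) ->
  ptr + class_len kd b (# code) < 2 ^ w ->
  r 0 + # (walk code Y) < 2 ^ w ->
  # (walk code X1) + # (walk code Y) < 2 ^ w ->
  ok class_code (class_time gam c kd (# code) b)
    (fun r' => (forall x, 1 <= x < 14 -> r' x = r x) /\
               r' 22 = ptr + class_len kd b (# code) /\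
               r' 0 = r 0 + contrib kd i b (# (walk code Y)) CY) r.
Proof.
  intros Cr R1 R2 R22 Hij Hj Hkd Hb (M0 & M1 & M2 & HP & HM) Hn HX1 HY HC Hptr R0 Hw.
  assert (E11 : r 11 = 1) by apply Cr.
  assert (Gw := good_w P m tbl G).
  assert (Gww := Nat.pow_gt_lin_r 2 w ltac:(lia)).
  assert (H2w : 2 ^ 1 <= 2 ^ w) by (apply Nat.pow_le_mono_r; lia). cbn [Nat.pow] in H2w.
  unfold class_len in Hptr.
  assert (Hp : ptr + 3 + 2 * # code < 2 ^ w) by (destruct (kd =? 2); lia).
  assert (Hkd4 : kd < 2 ^ w).
  { destruct (Nat.eqb_spec kd 2); lia. }
  unfold class_code, class_time.
  eapply ok_weaken; [ | | intros ? HQ; exact HQ].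
  1: instr ok_load; rewrite ?R22; [exact M0 | lia |].
  1: instr ok_add; rewrite ?E11, ?R22; [lia |].
  1: instr ok_load; [exact M1 | lia |].
  1: instr ok_add; rewrite ?E11; [lia |].
  1: instr ok_load;
     [rewrite <- Nat.add_assoc; exact M2 | lia |].
  1: instr ok_add; rewrite ?E11; [lia |].
  1: instr ok_sub; rewrite ?E11, ?R1; [lia | lia |].
  1: instr ok_sub; rewrite ?R1, ?R2; [lia | lia |].
  1: instr ok_shr; [lia |].
  1: match goal with |- wp _ _ _ _ _ ?r0 => set (r1 := r0) end.
  1: assert (F1 : frame 14 r r1)
      by (unfold r1; repeat (apply frame_upd; [lia|]); apply frame_refl).
  1: assert (E20 : r1 20 = (j - i) / 2 ^ b) by reflexivity.
  1: assert (E26 : r1 26 = i - 1) by reflexivity.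
  1: assert (E21 : r1 21 = # code) by reflexivity.
  1: assert (E16 : r1 16 = b) by reflexivity.
  1: assert (E15 : r1 15 = kd) by reflexivity.
  1: assert (E22 : r1 22 = ptr + 3) by (unfold r1; cbn [upd Nat.eqb]; lia).
  1: eapply ok_seq.
  1: apply ok_weaken with (T := 4) (Q := fun r2 => r2 27 = i - 1 + # Y /\
       forall x, x <> 27 -> r2 x = r1 x); [| apply le_n |].
  1: { clearbody r1. apply ok_if with (T := 2); intros e.
    - assert (2 ^ b <= j - i).
      { rewrite E20 in e. apply Nat.nlt_ge. intros Hlt. now rewrite Nat.div_small in e. }
      instr ok_shl; rewrite ?(F1 11), ?E11, ?E16 by lia; [lia |].
      eapply ok_add; cbn [upd Nat.eqb]; [lia |].
      cbn [upd Nat.eqb]. split; [lia |]. intros x Hx.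
      now rewrite (proj2 (Nat.eqb_neq x 27)).
    - assert (j - i < 2 ^ b).
      { rewrite E20 in e. apply Nat.div_small_iff in e; auto. }
      apply ok_weaken with (T := 1) (Q := fun r2 => r2 27 = i - 1 + # Y /\
       forall x, x <> 27 -> r2 x = r1 x); [|lia|auto].
      eapply ok_mov; cbn [upd Nat.eqb]; rewrite ?(F1 2), ?R2 by lia; [lia |].
      cbn [upd Nat.eqb]. split; [lia |]. intros x Hx.
      now rewrite (proj2 (Nat.eqb_neq x 27)). }
  1: intros r2 (Q27 & F2).
  1: assert (F2' : frame 14 r r2) by (intros x Hx; rewrite F2, F1 by lia; auto).
  1: rewrite <- (F2 26), <- (F2 21), <- (F2 16), <- (F2 15), <- (F2 22) in * by lia.
  1: clear F2; clearbody r1.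
  1: eapply ok_seq, ok_weaken; [apply (walk_ok P m tbl G c Hc code X1 Y X2 (ptr + 3)) | apply le_n |].
  - apply (frame_cst P tbl 14 r); auto; lia.
  - auto.
  - auto.
  - auto.
  - auto.
  - lia.
  - lia.
  - lia.
  - intros r3 (F3 & Q22 & Q26 & Q27').
    assert (F3' : frame 14 r r3) by (intros x Hx; rewrite F3, F2' by lia; auto).
    assert (Cr3 : cst r3) by (apply (frame_cst P tbl 14 r); auto; lia).
    rewrite <- (F3 16), <- (F3 15) in * by lia. clear F3 F2'.
    assert (E03 : r3 0 = r 0) by (apply F3'; lia).
    apply (ok_if w m 15 _ _ (3 + gap_time gam c (if kd =? 2 then b else 0))); intros e; rewrite E15 in e.
    + eapply ok_weaken; [ | | intros ? HQ; exact HQ].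
      1: instr ok_sub; rewrite ?(F3' 11), ?E11, ?E15 by lia;
         [lia | lia |].
      1: apply ok_if with (T := gap_time gam c (if kd =? 2 then b else 0)); cbn [upd Nat.eqb]; intros e'.
      * assert (kd = 2) as -> by lia. destruct (HC eq_refl) as (HC1 & HCY & HCn).
        eapply ok_weaken; [apply (gap_ok b C1 CY C2 (ptr + 3 + 2 * # code) i) | apply le_n |];
          try (cbn [upd Nat.eqb]; lia).
        -- apply (frame_cst P tbl 14 r3); [lia | apply frame_upd; [lia | apply frame_refl] | auto].
        -- cbn [upd Nat.eqb]. rewrite F3' by lia. auto.
        -- auto.
        -- cbn [upd Nat.eqb]. cbn [Nat.eqb] in Hptr. lia.
        -- cbn [upd Nat.eqb]. intros r4 (F4 & Q22' & Q0).
           unfold class_len. cbn [Nat.eqb contrib]. repeat split; try lia.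
           intros x Hx. rewrite F4 by lia. rewrite (proj2 (Nat.eqb_neq x 20)) by lia.
           apply F3'. lia.
      * assert (kd = 1) as -> by lia.
        eapply ok_weaken with (T := 2); [ | unfold gap_time; lia | intros ? HQ; exact HQ].
        instr ok_sub; [lia | lia |].
        eapply ok_add; cbn [upd Nat.eqb]; [lia |].
        cbn [upd Nat.eqb]. unfold class_len. cbn [Nat.eqb contrib].
        repeat split; try lia.
        intros x Hx. rewrite !(proj2 (Nat.eqb_neq x _)) by lia. apply F3'. lia.
      * lia.
    + assert (kd = 0) as -> by lia.
      eapply ok_weaken with (T := 2); [ | unfold gap_time; lia | intros ? HQ; exact HQ].
      instr ok_lt; [lia |].
      eapply ok_add; cbn [upd Nat.eqb].
      { rewrite E03. destruct (Nat.ltb_spec (r3 26) (r3 27)); lia. }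
      cbn [upd Nat.eqb]. unfold class_len. cbn [Nat.eqb contrib].
      repeat split; try lia.
      * intros x Hx. rewrite !(proj2 (Nat.eqb_neq x _)) by lia. apply F3'. lia.
      * rewrite E03, Q26, Q27'.
        destruct (Nat.ltb_spec (# (walk code X1)) (# (walk code X1) + # (walk code Y))),
          (Nat.ltb_spec 0 (# (walk code Y))); lia.
  - lia.
Qed.

(** * Class descriptors and the loop over them *)

Record desc := mkDesc { dkind : nat; dbits : nat; dcode : list bool }.

Variables (n : nat) (cd : nat -> list bool) (cv : nat -> nat).

Definition code_eqb (x y : list bool) : bool :=
  if list_eq_dec Bool.bool_dec x y then true else false.

Definition members (code : list bool) (ps : list nat) : list nat :=
  filter (fun p => code_eqb (cd p) code) ps.

Definition unambiguous (code : list bool) : Prop :=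
  forall p, p < n ->
    (exists z, code = cd p ++ z) \/ (exists z, cd p = code ++ z) -> cd p = code.

(** Exhausted codes survive a step for the bit 0, because [hd] defaults to false, and longer codes
    survive to the end. The hypothesis excludes proper prefixes and proper extensions, so only
    copies of [code] remain. *)
Lemma walk_count code : forall xs,
  (forall x, In x xs -> (exists z, code = x ++ z) \/ (exists z, x = code ++ z) -> x = code) ->
  # (walk code xs) = # (filter (fun x => code_eqb x code) xs).
Proof.
  unfold walk. induction code as [|b code IH]; intros xs H; cbn [fold_left].
  - f_equal. symmetry. apply forallb_filter_id, forallb_forall.
    intros x Hx. unfold code_eqb. rewrite (H x Hx) by (right; eexists; reflexivity).
    reflexivity.
  - rewrite IH.
    + clear IH. unfold child. induction xs as [|x xs IHxs]; auto.
      specialize (IHxs (fun y Hy => H y (or_intror Hy))).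
      destruct x as [|b' x].
      { exfalso. specialize (H [] (or_introl eq_refl) (or_introl (ex_intro _ (b :: code) eq_refl))).
        discriminate. }
      cbn [filter hd]. unfold code_eqb at 2.
      destruct (Bool.eqb b' b) eqn:Eb.
      * apply Bool.eqb_prop in Eb as ->. cbn [map tl filter]. unfold code_eqb at 1.
        destruct (list_eq_dec Bool.bool_dec x code) as [->|Hne];
          destruct (list_eq_dec Bool.bool_dec (b :: _) (b :: code)) as [e|Hne'];
          cbn [length]; try congruence.
      * destruct (list_eq_dec Bool.bool_dec (b' :: x) (b :: code)) as [e|Hne]; auto.
        injection e as -> _. rewrite Bool.eqb_reflx in Eb. discriminate.
    + intros x Hx Hpre. unfold child in Hx. apply in_map_iff in Hx as (y & <- & Hy).
      apply filter_In in Hy as [Hy Hb]. apply Bool.eqb_prop in Hb.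
      destruct y as [|b' y].
      { specialize (H [] Hy (or_introl (ex_intro _ (b :: code) eq_refl))). discriminate. }
      cbn [hd tl] in *. subst b'.
      assert (e : b :: y = b :: code).
      { apply H; auto. destruct Hpre as [[z ->]|[z ->]]; [left|right]; exists z; reflexivity. }
      now injection e.
Qed.

Lemma walk_members code s k :
  unambiguous code -> s + k <= n ->
  # (walk code (map cd (seq s k))) = # (members code (seq s k)).
Proof.
  intros Hu Hk. rewrite walk_count.
  - unfold members. induction (seq s k) as [|p l IH]; auto. cbn [map filter].
    destruct (code_eqb (cd p) code); cbn [length]; congruence.
  - intros x Hx. apply in_map_iff in Hx as (p & <- & Hp). apply in_seq in Hp.
    apply Hu. lia.
Qed.

(** Positions count from 0 while [i] and [j] count from 1, so the query is the half-open range from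
    [i - 1] to [j]. *)
Definition window (i j b : nat) : nat := min j (i - 1 + 2 ^ b) - (i - 1).

Definition dcontrib (i j : nat) (d : desc) : nat :=
  let ps := members (dcode d) (seq (i - 1) (window i j (dbits d))) in
  contrib (dkind d) i (dbits d) (# ps) (map cv ps).

Fixpoint wstream (ptr : nat) (ds : list desc) : Prop :=
  match ds with
  | [] => True
  | d :: ds' =>
      wclass ptr (dkind d) (dbits d) (dcode d) (map cd (seq 0 n))
        (map cv (members (dcode d) (seq 0 n))) /\
      wstream (ptr + class_len (dkind d) (dbits d) (# (dcode d))) ds'
  end.

Definition stream_len (ds : list desc) : nat :=
  nsum (fun d => class_len (dkind d) (dbits d) (# (dcode d))) ds.

Definition population (ds : list desc) : nat :=
  nsum (fun d => # (members (dcode d) (seq 0 n))) ds.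

Definition loop_code : cmd := While 13 (class_code ;; Op (ISub 13 13 11)).

(** The 3 stands for the two jumps of a round and the decrement of its counter. *)
Definition stream_time (ds : list desc) : nat :=
  nsum (fun d => class_time gam c (dkind d) (# (dcode d)) (dbits d) + 3) ds + 1.

Lemma seq_split a k b : a + k = b -> seq 0 b = seq 0 a ++ seq a k.
Proof. intros <-. apply seq_app. Qed.

Lemma dcontrib_le i j d :
  dkind d <= 2 -> dcontrib i j d <= # (members (dcode d) (seq (i - 1) (window i j (dbits d)))).
Proof.
  intros Hk. unfold dcontrib. set (ps := members _ _).
  destruct (dkind d) as [|[|k]]; cbn [contrib].
  - destruct (Nat.ltb_spec 0 (# ps)); lia.
  - lia.
  - rewrite <- (length_map cv ps). apply filter_length_le.
Qed.

(** A class contributes at most its number of members, so the bound on [population] keeps the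
    accumulator r_0 below 2^w in every round. *)
Lemma loop_ok i j ds : forall ptr r,
  cst r -> r 1 = i -> r 2 = j -> r 22 = ptr -> r 13 = # ds ->
  1 <= i <= j -> j <= n -> n < 2 ^ w ->
  (forall d, In d ds -> dkind d <= 2 /\ dbits d < 2 ^ w /\ unambiguous (dcode d)) ->
  wstream ptr ds -> ptr + stream_len ds < 2 ^ w -> # ds < 2 ^ w ->
  r 0 + population ds <= n ->
  ok loop_code (stream_time ds)
    (fun r' => r' 0 = r 0 + nsum (dcontrib i j) ds) r.
Proof.
  induction ds as [|d ds IH]; intros ptr r Cr R1 R2 R22 R13 Hij Hjn Hn Hds HS Hptr Hlen Hpop.
  - cbn. apply ok_while_done; [exact R13 | lia].
  - cbn [wstream] in HS. destruct HS as [HS1 HS2].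
    destruct (Hds d (or_introl eq_refl)) as (Hk & Hb & Hu).
    unfold stream_len, population, stream_time in *. rewrite !nsum_cons in *.
    cbn [length] in *.
    set (k := window i j (dbits d)). set (hi := i - 1 + k).
    assert (Hpow := pow2_pos (dbits d)).
    assert (Hhi : hi = min j (i - 1 + 2 ^ dbits d)) by (unfold hi, k, window; lia).
    assert (Hsplit : seq 0 n = seq 0 (i - 1) ++ seq (i - 1) k ++ seq hi (n - hi)).
    { rewrite (seq_split (i - 1) (n - (i - 1)) n) by lia. f_equal.
      replace (n - (i - 1)) with (k + (n - hi)) by lia.
      rewrite seq_app. reflexivity. }
    assert (Hmem : members (dcode d) (seq 0 n) = members (dcode d) (seq 0 (i - 1)) ++
       members (dcode d) (seq (i - 1) k) ++ members (dcode d) (seq hi (n - hi))).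
    { rewrite Hsplit. unfold members. now rewrite !filter_app. }
    assert (Hml := f_equal (@length nat) Hmem). rewrite !length_app in Hml.
    assert (Hc1 : dcontrib i j d <= # (members (dcode d) (seq (i - 1) k)))
      by (apply dcontrib_le; auto).
    rewrite Hmem in HS1. rewrite Hsplit in HS1 at 1. rewrite !map_app in HS1.
    assert (Hmn : # (members (dcode d) (seq 0 n)) <= n).
    { rewrite <- (length_seq n 0) at 2. apply filter_length_le. }
    eapply ok_weaken; [eapply ok_while_step | | intros r' H'; exact H'].
    + lia.
    + eapply ok_seq, ok_weaken; [
        apply (class_ok (dkind d) (dbits d) (dcode d)
          (map cd (seq 0 (i - 1))) (map cd (seq (i - 1) k)) (map cd (seq hi (n - hi)))
          (map cv (members (dcode d) (seq 0 (i - 1)))) (map cv (members (dcode d) (seq (i - 1) k)))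
          (map cv (members (dcode d) (seq hi (n - hi)))) ptr i j r Cr R1 R2 R22 Hij)
        | apply le_n | ].
      * lia.
      * auto.
      * auto.
      * auto.
      * rewrite <- !map_app, length_map, <- Hsplit, length_seq. auto.
      * rewrite length_map, length_seq. auto.
      * rewrite length_map, length_seq. lia.
      * intros _. rewrite <- !map_app, !length_map, !walk_members by (auto; lia).
        rewrite <- Hmem. repeat split; lia.
      * lia.
      * rewrite walk_members by (auto; lia). lia.
      * rewrite !walk_members by (auto; lia). lia.
      * intros r' (F & Q22 & Q0). rewrite walk_members in Q0 by (auto; lia).
        change (contrib _ _ _ _ _) with (dcontrib i j d) in Q0.
        assert (Cr' : cst r').
        { unfold layout_regs in Cr |- *. rewrite !F by lia. auto. }
        assert (E11 : r' 11 = 1) by apply Cr'.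
        eapply ok_sub; cbn [upd Nat.eqb]; rewrite ?E11, ?(F 13) by lia; [lia | lia |].
        eapply ok_weaken; [eapply IH with (ptr := ptr + class_len (dkind d) (dbits d) (# (dcode d)))
          | apply le_n |]; auto; cbn [upd Nat.eqb]; try lia.
        -- rewrite F by lia. auto.
        -- rewrite F by lia. auto.
        -- intros d' Hd'. apply Hds. now right.
    + lia.
Qed.

End Run.

(** Everything that depends on the string or on the word size comes from the 12 header words, so
    [prog] is one fixed program. *)
Definition init_code : cmd :=
  Op (IConst 3 0) ;; Op (ILoad 3 3) ;; Op (IConst 4 1) ;; Op (ILoad 4 4) ;;
  Op (IConst 5 2) ;; Op (ILoad 5 5) ;; Op (IConst 6 3) ;; Op (ILoad 6 6) ;;
  Op (IConst 7 4) ;; Op (ILoad 7 7) ;; Op (IConst 8 5) ;; Op (ILoad 8 8) ;;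
  Op (IConst 9 6) ;; Op (ILoad 9 9) ;; Op (IConst 10 7) ;; Op (ILoad 10 10) ;;
  Op (IConst 11 8) ;; Op (ILoad 11 11) ;; Op (IConst 12 9) ;; Op (ILoad 12 12) ;;
  Op (IConst 13 10) ;; Op (ILoad 13 13) ;; Op (IConst 22 11) ;; Op (ILoad 22 22) ;;
  loop_code.

Definition prog : list instr := compile 0 init_code ++ [IHalt].

(** * The data structure *)

(** The tree is completed to depth [h] with empty nodes and listed in preorder. The index of a child
    then depends only on the index and depth of its parent, as [path_rec] exploits. *)
Fixpoint node_vectors (h : nat) (xs : list (list bool)) : list (list bool) :=
  match h with
  | 0 => []
  | S h' =>
      let ys := filter (fun x => match x with [] => false | _ => true end) xs in
      map (hd false) ys :: node_vectors h' (child false ys) ++ node_vectors h' (child true ys)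
  end.

Fixpoint matrix_vectors (e : nat) (X : list nat) : list (list bool) :=
  match e with
  | 0 => []
  | S e' => map (fun x => Nat.testbit x e') X :: matrix_vectors e' (part e' X)
  end.

Section Build.
Variables (P : params) (n : nat) (cd : nat -> list bool) (cv : nat -> nat).
Variables (h : nat) (ds : list desc).
Notation w := (pw P).
Notation tau := (ptau P).

Definition dvalues (d : desc) : list nat := map cv (members cd (dcode d) (seq 0 n)).

Definition payload (d : desc) : list (list bool) :=
  if dkind d =? 2 then matrix_vectors (S (dbits d)) (dvalues d) else [].

Definition vectors : list (list bool) :=
  node_vectors h (map cd (seq 0 n)) ++ flat_map payload ds.

Definition vsize (V : list bool) : nat := nblocks P (# V) * sb P.

Fixpoint vaddrs (a : nat) (VS : list (list bool)) : list nat :=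
  match VS with
  | [] => []
  | V :: VS' => a :: vaddrs (a + vsize V) VS'
  end.

Definition vbase : nat := 12 + 2 ^ tau.

Definition addr (q : nat) : nat := nth q (vaddrs vbase vectors) 0.

Fixpoint path_rec (h off : nat) (code : list bool) : list nat :=
  match h, code with
  | S h', b :: code' =>
      addr off :: Nat.b2n b :: path_rec h' (if b then off + 2 ^ h' else off + 1) code'
  | _, _ => []
  end.

Fixpoint matrix_rec (off e : nat) (X : list nat) : list nat :=
  match e with
  | 0 => []
  | S e' =>
      addr off :: zeros (map (fun x => Nat.testbit x e') X) ::
      matrix_rec (off + 1) e' (part e' X)
  end.

(** [off] is the index in [vectors] of the next matrix level to be referenced. *)
Fixpoint stream (off : nat) (ds : list desc) : list nat :=
  match ds with
  | [] => []
  | d :: ds' =>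
      [dkind d; dbits d; # (dcode d)] ++ path_rec h 0 (dcode d) ++
      (if dkind d =? 2 then matrix_rec off (S (dbits d)) (dvalues d) else []) ++
      stream (if dkind d =? 2 then off + S (dbits d) else off) ds'
  end.

Definition vector_words : list nat :=
  flat_map (fun V => vwords P (fun k => nth k V false) (# V)) vectors.

(** The order is that in which [init_code] fills the registers 3 to 13 and 22; the entry 12 is the
    address of the table that follows the header. *)
Definition header : list nat :=
  [w; bw P; sb P; gw P; pkap P; 2 ^ pkap P; 2 ^ tau; 12; 1; pgam P; # ds;
   vbase + # vector_words].

Definition data : list nat :=
  header ++ map (popc tau) (seq 0 (2 ^ tau)) ++ vector_words ++ stream (2 ^ h - 1) ds.

Lemma node_vectors_length k : forall xs, # (node_vectors k xs) = 2 ^ k - 1.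
Proof.
  induction k; intros xs; cbn [node_vectors length]; auto.
  rewrite length_app, !IHk. cbn. pose proof (pow2_pos k). lia.
Qed.

Lemma matrix_vectors_length e : forall X, # (matrix_vectors e X) = e.
Proof. induction e; intros X; cbn [matrix_vectors length]; auto. Qed.

Lemma path_rec_length code : forall k off, # code <= k -> # (path_rec k off code) = 2 * # code.
Proof.
  induction code; intros k off H; destruct k; cbn in *; auto; [lia |].
  rewrite IHcode by lia. lia.
Qed.

Lemma matrix_rec_length e : forall off X, # (matrix_rec off e X) = 2 * e.
Proof. induction e; intros off X; cbn [matrix_rec length]; auto. rewrite IHe. lia. Qed.

Lemma stream_length ds' : forall off,
  (forall d, In d ds' -> # (dcode d) <= h) -> # (stream off ds') = stream_len ds'.
Proof.
  induction ds' as [|d ds' IH]; intros off H; auto.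
  unfold stream_len in *. cbn [stream]. rewrite nsum_cons.
  rewrite !length_app, path_rec_length, IH by (intros; apply H; cbn; auto).
  unfold class_len at 2. cbn [length]. destruct (dkind d =? 2).
  - rewrite matrix_rec_length. lia.
  - cbn [length]. lia.
Qed.

Lemma vector_words_length :
  # vector_words = nsum vsize vectors.
Proof.
  unfold vector_words. induction vectors; auto. cbn [flat_map].
  rewrite length_app, vwords_length, IHl, nsum_cons. reflexivity.
Qed.

Lemma vaddrs_vec m VS : forall a q,
  holds m a (flat_map (fun V => vwords P (fun k => nth k V false) (# V)) VS) ->
  a + # (flat_map (fun V => vwords P (fun k => nth k V false) (# V)) VS) <= 2 ^ w ->
  (forall V, In V VS -> # V < 2 ^ w) ->
  q < # VS ->
  vecl P m (nth q (vaddrs a VS) 0) (nth q VS []) /\ nth q (vaddrs a VS) 0 < 2 ^ w.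
Proof.
  induction VS as [|V VS IH]; intros a q H Ha HV Hq; [cbn in Hq; lia |].
  cbn [flat_map] in H, Ha. apply holds_app in H as [H1 H2].
  rewrite length_app in Ha. assert (Hl := Ha). rewrite vwords_length in Ha, H2.
  destruct q as [|q]; cbn [vaddrs nth].
  - split; [split |].
    + apply HV; cbn; auto.
    + apply vec_of_holds; auto. lia.
    + assert (0 < nblocks P (# V) * sb P); [|lia].
      unfold nblocks, sb. nia.
  - unfold vsize. apply IH; auto; [lia | intros; apply HV; cbn; auto | cbn in Hq; lia].
Qed.

(** * The memory image satisfies what the query program expects *)

Section Run.
Variables (c : nat).
Let m := fun a => nth a data 0.

Hypothesis Hw : 0 < w.
Hypothesis Hkap : pkap P < w.
Hypothesis HAkap : pkap P * pA P <= w.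
Hypothesis Hcount : pA P * gw P < 2 ^ pkap P.
Hypothesis Hgam : 0 < pgam P.
Hypothesis HA : 0 < pA P.
Hypothesis Htau : 0 < tau.
Hypothesis Htauw : tau < w.
Hypothesis Hc : w <= tau * c.
Hypothesis Hdata : # data < 2 ^ w.
Hypothesis Hn : n < 2 ^ w.
Hypothesis Hbw : bw P < 2 ^ w.
Hypothesis Hsb : sb P < 2 ^ w.
Hypothesis Hds : forall d, In d ds ->
  dkind d <= 2 /\ dbits d < 2 ^ w /\ # (dcode d) <= h /\ unambiguous n cd (dcode d).
Hypothesis Hpop : population n cd ds <= n.

Lemma data_holds : holds m 0 data.
Proof. intros k Hk. reflexivity. Qed.

Lemma data_length :
  # data = 12 + (2 ^ tau + (# vector_words + stream_len ds)).
Proof.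
  unfold data. rewrite !length_app, length_map, length_seq, stream_length.
  - reflexivity.
  - intros d Hd. apply (Hds d Hd).
Qed.

Lemma data_split :
  holds m 0 header /\ holds m 12 (map (popc tau) (seq 0 (2 ^ tau))) /\
  holds m vbase vector_words /\
  holds m (vbase + # vector_words) (stream (2 ^ h - 1) ds).
Proof.
  pose proof data_holds as H. unfold data in H at 1.
  apply holds_app in H as [H1 H]. apply holds_app in H as [H2 H].
  apply holds_app in H as [H3 H4].
  rewrite length_map, length_seq in H3, H4. cbn [length Nat.add header] in *.
  split; [exact H1 | split; [exact H2 | split; [exact H3 | exact H4]]].
Qed.

Lemma data_good : good P m 12.
Proof.
  pose proof data_length as HL.
  constructor; auto; [lia |].
  intros y Hy. destruct data_split as (_ & H & _).
  rewrite H by (rewrite length_map, length_seq; auto).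
  rewrite (nth_indep _ _ (popc tau 0)) by (rewrite length_map, length_seq; auto).
  rewrite map_nth, seq_nth by auto. reflexivity.
Qed.

Lemma node_vectors_bound k : forall xs V, In V (node_vectors k xs) -> # V <= # xs.
Proof.
  induction k; intros xs V HV; cbn [node_vectors] in HV; [destruct HV |].
  set (ys := filter _ xs) in *.
  assert (# ys <= # xs) by apply filter_length_le.
  assert (Hchild : forall b, # (child b ys) <= # ys).
  { intros b. unfold child. rewrite length_map. apply filter_length_le. }
  destruct HV as [<-|HV].
  - rewrite length_map. auto.
  - apply in_app_iff in HV as [HV|HV]; apply IHk in HV.
    + specialize (Hchild false). lia.
    + specialize (Hchild true). lia.
Qed.

Lemma matrix_vectors_bound e : forall X V, In V (matrix_vectors e X) -> # V = # X.
Proof.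
  induction e; intros X V HV; cbn [matrix_vectors] in HV; [destruct HV |].
  destruct HV as [<-|HV].
  - apply length_map.
  - apply IHe in HV. now rewrite part_length in HV.
Qed.

Lemma dvalues_length d : # (dvalues d) <= n.
Proof.
  unfold dvalues. rewrite length_map. rewrite <- (length_seq n 0) at 2.
  apply filter_length_le.
Qed.

Lemma vectors_bound V : In V vectors -> # V <= n.
Proof.
  unfold vectors. intros HV. apply in_app_iff in HV as [HV|HV].
  - apply node_vectors_bound in HV. now rewrite length_map, length_seq in HV.
  - apply in_flat_map in HV as (d & _ & HV). unfold payload in HV.
    destruct (dkind d =? 2); [|destruct HV].
    apply matrix_vectors_bound in HV. rewrite HV. apply dvalues_length.
Qed.

Lemma addr_vec q : q < # vectors ->
  vecl P m (addr q) (nth q vectors []) /\ addr q < 2 ^ w.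
Proof.
  intros Hq. pose proof data_length. unfold addr.
  apply vaddrs_vec; auto.
  - apply data_split.
  - fold vector_words. unfold vbase. lia.
  - intros V HV. apply vectors_bound in HV. lia.
Qed.

Lemma wpath_holds code : forall k off xs ptr,
  # code <= k ->
  (forall x, In x xs -> (exists z, code = x ++ z) \/ (exists z, x = code ++ z) -> x = code) ->
  off + (2 ^ k - 1) <= # vectors ->
  (forall q, q < 2 ^ k - 1 -> nth (off + q) vectors [] = nth q (node_vectors k xs) []) ->
  holds m ptr (path_rec k off code) ->
  wpath P m ptr code xs.
Proof.
  induction code as [|b code IH]; intros k off xs ptr Hk Hu Hoff HV HM; cbn [wpath]; auto.
  destruct k as [|k]; [cbn in Hk; lia |]. cbn [length] in Hk.
  cbn [path_rec] in HM. apply holds_cons in HM as [M0 HM]. apply holds_cons in HM as [M1 HM].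
  assert (Hp := pow2_pos k). cbn [Nat.pow] in Hoff, HV.
  (* An exhausted code would be a proper prefix of the code being followed, so [node_vectors] drops
     nothing on this path. *)
  assert (Hys : filter (fun x => match x with [] => false | _ => true end) xs = xs).
  { apply forallb_filter_id, forallb_forall. intros [|b' x] Hx; auto.
    specialize (Hu [] Hx (or_introl (ex_intro _ (b :: code) eq_refl))). discriminate. }
  cbn [node_vectors] in HV. rewrite Hys in HV.
  destruct (addr_vec off ltac:(lia)) as [Hv Ha].
  pose proof (HV 0 ltac:(lia)) as HV0. cbn [nth] in HV0. rewrite Nat.add_0_r in HV0.
  rewrite HV0 in Hv. rewrite M0. split; [auto | split; [auto | split; [auto |]]].
  fold (child b xs).
  assert (Hlen0 := node_vectors_length k (child false xs)).
  assert (Hlen1 := node_vectors_length k (child true xs)).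
  apply (IH k (if b then off + 2 ^ k else off + 1)).
  - lia.
  - intros x Hx Hpre. unfold child in Hx. apply in_map_iff in Hx as (y & <- & Hy).
    apply filter_In in Hy as [Hy Hb]. apply Bool.eqb_prop in Hb.
    destruct y as [|b' y].
    { specialize (Hu [] Hy (or_introl (ex_intro _ (b :: code) eq_refl))). discriminate. }
    cbn [hd tl] in *. subst b'.
    assert (e : b :: y = b :: code).
    { apply Hu; auto. destruct Hpre as [[z ->]|[z ->]]; [left|right]; exists z; reflexivity. }
    now injection e.
  - destruct b; lia.
  - intros q Hq. destruct b.
    + replace (off + 2 ^ k + q) with (off + S (# (node_vectors k (child false xs)) + q)) by lia.
      rewrite HV by lia. cbn [nth]. rewrite app_nth2 by lia. f_equal. lia.
    + replace (off + 1 + q) with (off + S q) by lia.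
      rewrite HV by lia. cbn [nth]. rewrite app_nth1 by lia. reflexivity.
  - replace (ptr + 2) with (ptr + 1 + 1) by lia. exact HM.
Qed.

Lemma wmat_holds e : forall off X ptr,
  off + e <= # vectors ->
  (forall q, q < e -> nth (off + q) vectors [] = nth q (matrix_vectors e X) []) ->
  holds m ptr (matrix_rec off e X) ->
  wmat P m ptr e X.
Proof.
  induction e as [|e IH]; intros off X ptr Hoff HV HM; cbn [wmat]; auto.
  cbn [matrix_rec] in HM. apply holds_cons in HM as [M0 HM]. apply holds_cons in HM as [M1 HM].
  destruct (addr_vec off ltac:(lia)) as [Hv Ha].
  pose proof (HV 0 ltac:(lia)) as HV0. cbn [nth matrix_vectors] in HV0.
  rewrite Nat.add_0_r in HV0. rewrite HV0 in Hv. rewrite M0.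
  split; [auto | split; [auto | split; [auto |]]].
  apply (IH (off + 1)).
  - lia.
  - intros q Hq. replace (off + 1 + q) with (off + S q) by lia. apply (HV (S q)). lia.
  - replace (ptr + 2) with (ptr + 1 + 1) by lia. exact HM.
Qed.

Lemma wstream_holds ds' : forall off ptr,
  (forall d, In d ds' -> In d ds) ->
  (forall q, nth (off + q) vectors [] = nth q (flat_map payload ds') []) ->
  off + # (flat_map payload ds') <= # vectors ->
  holds m ptr (stream off ds') ->
  wstream P m n cd cv ptr ds'.
Proof.
  induction ds' as [|d ds' IH]; intros off ptr Hin HV Hlen HM; cbn [wstream]; auto.
  cbn [stream flat_map] in *. rewrite length_app in Hlen.
  assert (Hpl : payload d = if dkind d =? 2 then matrix_vectors (S (dbits d)) (dvalues d) else [])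
    by reflexivity.
  rewrite Hpl in Hlen, HV. clear Hpl.
  apply holds_app in HM as [M1 HM]. apply holds_app in HM as [M2 HM].
  apply holds_app in HM as [M3 HM]. cbn [length] in M2, M3, HM.
  destruct (Hds d (Hin d (or_introl eq_refl))) as (Hk & Hb & Hl & Hu).
  rewrite path_rec_length in M3, HM by auto.
  split; [split; [| split; [| split; [| split]]] |].
  - apply holds_cons in M1. apply M1.
  - apply holds_cons in M1 as [_ M1]. apply holds_cons in M1. apply M1.
  - apply holds_cons in M1 as [_ M1]. apply holds_cons in M1 as [_ M1].
    apply holds_cons in M1. rewrite <- Nat.add_assoc in M1. apply M1.
  - apply (wpath_holds (dcode d) h 0); auto.
    + intros x Hx. apply in_map_iff in Hx as (p & <- & Hp). apply in_seq in Hp.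
      apply Hu. lia.
    + unfold vectors. rewrite length_app, node_vectors_length. lia.
    + intros q Hq. unfold vectors. rewrite app_nth1; [reflexivity |].
      rewrite node_vectors_length. auto.
  - intros e2. rewrite e2 in *. cbn [Nat.eqb] in *.
    apply (wmat_holds (S (dbits d)) off).
    + rewrite matrix_vectors_length in Hlen. lia.
    + intros q Hq. rewrite HV, app_nth1; [reflexivity |].
      now rewrite matrix_vectors_length.
    + exact M3.
  - destruct (Nat.eqb_spec (dkind d) 2) as [e2|e2].
    + apply (IH (off + S (dbits d))).
      * intros; apply Hin; cbn; auto.
      * intros q. rewrite <- Nat.add_assoc, HV, app_nth2; rewrite matrix_vectors_length; [|lia].
        f_equal. lia.
      * rewrite matrix_vectors_length in Hlen. lia.
      * rewrite matrix_rec_length in HM. unfold class_len. rewrite e2.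
        cbn [Nat.eqb]. replace (ptr + (3 + 2 * # (dcode d) + 2 * S (dbits d)))
          with (ptr + 3 + 2 * # (dcode d) + 2 * S (dbits d)) by lia. exact HM.
    + apply (IH off).
      * intros; apply Hin; cbn; auto.
      * exact HV.
      * cbn [length] in Hlen. lia.
      * cbn [length] in HM. unfold class_len.
        rewrite (proj2 (Nat.eqb_neq _ _) e2).
        replace (ptr + (3 + 2 * # (dcode d) + 0))
          with (ptr + 3 + 2 * # (dcode d) + 0) by lia. exact HM.
Qed.

Lemma stream_len_ge ds' : # ds' <= stream_len ds'.
Proof.
  unfold stream_len. induction ds'; auto. rewrite nsum_cons. cbn [length].
  unfold class_len at 1. lia.
Qed.

Lemma header_bound : Forall (fun x => x < 2 ^ w) header.
Proof.
  pose proof data_length as HL. pose proof (stream_len_ge ds).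
  assert (Hgw : gw P <= bw P) by (unfold bw; nia).
  assert (Hga : pgam P <= gw P) by (unfold gw; nia).
  assert (Hww := Nat.pow_gt_lin_r 2 w ltac:(lia)).
  assert (2 ^ pkap P < 2 ^ w) by (apply Nat.pow_lt_mono_r; lia).
  unfold header, vbase. repeat (constructor; [lia |]). constructor.
Qed.

Lemma path_rec_bound code : forall k off,
  off + (2 ^ k - 1) <= # vectors -> Forall (fun x => x < 2 ^ w) (path_rec k off code).
Proof.
  assert (Hww := Nat.pow_gt_lin_r 2 w ltac:(lia)).
  induction code as [|b code IH]; intros k off Hoff; destruct k as [|k];
    cbn [path_rec]; try constructor.
  - cbn [Nat.pow] in Hoff. pose proof (pow2_pos k). apply addr_vec. lia.
  - cbn [Nat.pow] in Hoff. pose proof (pow2_pos k).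
    constructor; [destruct b; cbn; lia |]. apply IH. destruct b; lia.
Qed.

Lemma matrix_rec_bound e : forall off X,
  off + e <= # vectors -> # X <= n -> Forall (fun x => x < 2 ^ w) (matrix_rec off e X).
Proof.
  induction e as [|e IH]; intros off X Hoff HX; cbn [matrix_rec]; constructor.
  - apply addr_vec. lia.
  - constructor.
    + rewrite zeros_map. eapply Nat.le_lt_trans; [apply filter_length_le | lia].
    + apply IH; [lia |]. now rewrite part_length.
Qed.

Lemma stream_bound ds' : forall off,
  (forall d, In d ds' -> In d ds) ->
  off + # (flat_map payload ds') <= # vectors ->
  Forall (fun x => x < 2 ^ w) (stream off ds').
Proof.
  assert (Hww := Nat.pow_gt_lin_r 2 w ltac:(lia)).
  pose proof data_length as HL.
  induction ds' as [|d ds' IH]; intros off Hin Hlen; cbn [stream]; [constructor |].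
  cbn [flat_map] in Hlen. rewrite length_app in Hlen.
  assert (Hpl : payload d = if dkind d =? 2 then matrix_vectors (S (dbits d)) (dvalues d) else [])
    by reflexivity.
  rewrite Hpl in Hlen. clear Hpl.
  destruct (Hds d (Hin d (or_introl eq_refl))) as (Hk & Hb & Hl & Hu).
  assert (Hsl : class_len (dkind d) (dbits d) (# (dcode d)) <= stream_len ds).
  { assert (Hd := Hin d (or_introl eq_refl)). unfold stream_len. clear -Hd.
    induction ds as [|d' l IH]; [destruct Hd |]. rewrite nsum_cons.
    destruct Hd as [->|Hd]; [lia | specialize (IH Hd); lia]. }
  unfold class_len in Hsl.
  rewrite !Forall_app; repeat split.
  - repeat (constructor; [lia |]). constructor.
  - apply path_rec_bound. unfold vectors. rewrite length_app, node_vectors_length. lia.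
  - destruct (dkind d =? 2); [|constructor]. apply matrix_rec_bound.
    + rewrite matrix_vectors_length in Hlen. lia.
    + apply dvalues_length.
  - apply IH; [intros; apply Hin; cbn; auto |].
    destruct (dkind d =? 2); [rewrite matrix_vectors_length in Hlen |]; cbn [length] in Hlen; lia.
Qed.

Lemma vector_words_bound : Forall (fun x => x < 2 ^ w) vector_words.
Proof.
  apply Forall_forall. unfold vector_words. intros x Hx.
  apply in_flat_map in Hx as (V & HV & Hx). apply vectors_bound in HV.
  apply in_flat_map in Hx as (blk & Hblk & Hx). apply in_seq in Hblk.
  cbn [blockwords In] in Hx. destruct Hx as [<-|[<-|Hx]].
  - destruct (Nat.le_gt_cases (blk * bw P) (# V)) as [Hle|Hgt].
    + eapply Nat.le_lt_trans; [apply cntr_le | lia].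
    + exfalso. unfold nblocks in Hblk.
      assert (blk <= # V / bw P) by lia.
      pose proof (Nat.Div0.mul_div_le (# V) (bw P)). nia.
  - eapply Nat.lt_le_trans; [apply pack_bound | apply Nat.pow_le_mono_r; lia].
    intros q Hq. eapply Nat.le_lt_trans; [apply cntr_le | nia].
  - apply in_map_iff in Hx as (q & <- & _). apply word_bound.
Qed.

Lemma data_bound : Forall (fun x => x < 2 ^ w) data.
Proof.
  unfold data. rewrite !Forall_app; repeat split.
  - apply header_bound.
  - apply Forall_forall. intros x Hx. apply in_map_iff in Hx as (y & <- & _).
    eapply Nat.le_lt_trans; [apply popc_le |].
    pose proof (Nat.pow_gt_lin_r 2 w ltac:(lia)). lia.
  - apply vector_words_bound.
  - apply stream_bound; auto. unfold vectors. rewrite length_app, node_vectors_length. lia.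
Qed.

(** 24 is the number of instructions that load the header into registers. *)
Lemma query_ok i j :
  1 <= i <= j -> j <= n ->
  exists T st, T <= 24 + stream_time P c ds /\
    run w prog T (init_state data i j) = Some st /\
    reg st 0 = nsum (dcontrib cd cv i j) ds.
Proof.
  intros Hij Hj.
  destruct data_split as (Hh & _ & _ & Hs). pose proof data_length as HL.
  pose proof (stream_len_ge ds).
  assert (Hww := Nat.pow_gt_lin_r 2 w ltac:(lia)).
  assert (Hm : forall q, q < 12 -> m q = nth q header 0) by (intros q Hq; apply (Hh q Hq)).
  assert (Hb : forall q, q < 12 -> nth q header 0 < 2 ^ w).
  { intros q Hq. pose proof header_bound as HB. rewrite Forall_forall in HB.
    apply HB, nth_In. exact Hq. }
  enough (Hok : wp w m init_code (24 + stream_time P c ds)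
    (fun r' => r' 0 = nsum (dcontrib cd cv i j) ds)
    (reg (init_state data i j))).
  { destruct (run_compile _ _ _ _ _ _ Hok) as (T & st & HT & Hrun & HQ).
    exists T, st. auto. }
  change (24 + stream_time P c ds) with
    (S (S (S (S (S (S (S (S (S (S (S (S (S (S (S (S (S (S (S (S (S (S (S (S
      (stream_time P c ds))))))))))))))))))))))))).
  unfold init_code.
  do 12 (eapply ok_step, ok_const; [lia |];
    instr ok_load;
      [apply Hm; lia | apply Hb; lia |]).
  cbn [nth header].
  match goal with |- wp _ _ _ _ _ ?r0 => set (r1 := r0) end.
  assert (E0 : r1 0 = 0) by reflexivity.
  eapply ok_weaken; [apply (loop_ok P m 12 data_good c Hc n cd cv i j ds
      (vbase + # vector_words)) | apply le_n |]; auto.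
  - unfold layout_regs. repeat split; reflexivity.
  - intros d Hd. destruct (Hds d Hd) as (? & ? & _ & ?). auto.
  - apply (wstream_holds ds (2 ^ h - 1)); auto.
    + intros q. unfold vectors. rewrite app_nth2; rewrite node_vectors_length; [|lia].
      f_equal. lia.
    + unfold vectors. rewrite length_app, node_vectors_length. lia.
  - unfold vbase. lia.
  - lia.
Qed.

End Run.
End Build.

(** * Previous occurrences *)

(* One plus the position of the last [a] among the first [q] characters, or 0. *)
Fixpoint last_occ (f : nat -> nat) (a q : nat) : nat :=
  match q with
  | 0 => 0
  | S q' => if f q' =? a then q else last_occ f a q'
  end.

Definition prev (f : nat -> nat) (p : nat) : nat := last_occ f (f p) p.

Lemma last_occ_le f a q : last_occ f a q <= q.
Proof. induction q; cbn; auto. destruct (f q =? a); lia. Qed.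

Lemma last_occ_lt f a i q :
  last_occ f a q <= i <-> (forall x, i <= x < q -> f x <> a).
Proof.
  induction q as [|q IH]; cbn [last_occ].
  - split; [lia | lia].
  - destruct (Nat.eqb_spec (f q) a) as [e|e].
    + split; intros H.
      * intros x Hx. lia.
      * destruct (Nat.le_gt_cases (S q) i); auto.
        exfalso. apply (H q); auto. lia.
    + rewrite IH. split; intros H x Hx.
      * destruct (Nat.eq_dec x q) as [->|]; auto. apply H. lia.
      * apply H. lia.
Qed.

Lemma nodup_snoc (l : list nat) x :
  # (nodup Nat.eq_dec (l ++ [x])) =
  # (nodup Nat.eq_dec l) + (if in_dec Nat.eq_dec x l then 0 else 1).
Proof.
  induction l as [|y l IH]; [reflexivity |]. cbn [app nodup].
  destruct (in_dec Nat.eq_dec y (l ++ [x])) as [Hy|Hy];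
    destruct (in_dec Nat.eq_dec y l) as [Hy'|Hy'];
    destruct (in_dec Nat.eq_dec x l) as [Hx|Hx];
    destruct (in_dec Nat.eq_dec x (y :: l)) as [Hx'|Hx'];
    cbn [length]; rewrite ?in_app_iff in *; cbn [In] in *; try lia;
    exfalso; intuition congruence.
Qed.

(** Appending a position adds a new character exactly when its previous occurrence lies before the
    range. As [prev] is one plus a position counted from 0, this reads [<= i]. *)
Lemma distinct_prev f i k :
  # (nodup Nat.eq_dec (map f (seq i k))) =
  # (filter (fun p => prev f p <=? i) (seq i k)).
Proof.
  induction k as [|k IH]; [reflexivity |].
  rewrite seq_S, map_app, filter_app, length_app. cbn [map filter].
  rewrite nodup_snoc, IH. f_equal.
  pose proof (last_occ_lt f (f (i + k)) i (i + k)) as H.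
  destruct (in_dec Nat.eq_dec (f (i + k)) (map f (seq i k))) as [Hin|Hin].
  - apply in_map_iff in Hin as (x & e & Hx). apply in_seq in Hx.
    destruct (Nat.leb_spec (prev f (i + k)) i) as [Hle|Hle]; auto.
    exfalso. apply (proj1 H Hle x); auto.
  - rewrite (proj2 (Nat.leb_le (prev f (i + k)) i)); auto.
    apply H. intros x Hx e. apply Hin, in_map_iff. exists x. split; auto.
    apply in_seq. lia.
Qed.

(** Only the first occurrence inside the range has its predecessor outside, so a frequent character
    is settled by asking whether it occurs at all. *)
Lemma single_prev f a i k :
  # (filter (fun p => (f p =? a) && (prev f p <=? i)) (seq i k)) =
  if 0 <? # (filter (fun p => f p =? a) (seq i k)) then 1 else 0.
Proof.
  induction k as [|k IH]; [reflexivity |].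
  rewrite seq_S, !filter_app, !length_app, IH. cbn [filter].
  destruct (Nat.eqb_spec (f (i + k)) a) as [e|e]; cbn [andb].
  - pose proof (last_occ_lt f (f (i + k)) i (i + k)) as H.
    destruct (Nat.leb_spec (prev f (i + k)) i) as [Hle|Hle].
    + assert (E : # (filter (fun p => f p =? a) (seq i k)) = 0).
      { destruct (filter (fun p => f p =? a) (seq i k)) as [|x l] eqn:E; auto.
        assert (Hx : In x (filter (fun p => f p =? a) (seq i k))) by (rewrite E; cbn; auto).
        apply filter_In in Hx as [Hx Hfx]. apply in_seq in Hx. apply Nat.eqb_eq in Hfx.
        exfalso. apply (proj1 H Hle x); [lia | congruence]. }
      rewrite E. reflexivity.
    + assert (E : 0 < # (filter (fun p => f p =? a) (seq i k))).
      { apply Nat.neq_0_lt_0. intros E. unfold prev in Hle.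
        apply (proj1 (Nat.lt_nge _ _) Hle), H. intros x Hx ex.
        assert (Hin : In x (filter (fun p => f p =? a) (seq i k))).
        { apply filter_In. split; [apply in_seq; lia |]. apply Nat.eqb_eq. congruence. }
        destruct (filter (fun p => f p =? a) (seq i k)); [destruct Hin | discriminate]. }
      rewrite !(proj2 (Nat.ltb_lt _ _)) by lia. reflexivity.
  - cbn [length]. rewrite !Nat.add_0_r. reflexivity.
Qed.

Lemma substr_map (s : list nat) i j :
  1 <= i <= j -> j <= # s ->
  substr s i j = map (fun k => nth k s 0) (seq (i - 1) (j - (i - 1))).
Proof.
  intros Hij Hj. unfold substr. replace (S j - i) with (j - (i - 1)) by lia.
  set (a := i - 1) in *. set (k := j - a). assert (Hk : a + k <= # s) by lia.
  clearbody a k. clear Hij Hj i j.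
  revert a Hk. induction k as [|k IH]; intros a Hk; [reflexivity |].
  cbn [seq map]. rewrite <- IH by lia.
  assert (Hs : skipn a s = nth a s 0 :: skipn (S a) s).
  { clear IH. revert s Hk. induction a; intros [|x s] Hk; cbn in *; try lia; auto.
    apply IHa. lia. }
  rewrite Hs. reflexivity.
Qed.

(** The quotients of x and i by 2^b differ by at most 1, so bit b tells whether they are equal. If
    so, the remainders decide. If not, the larger number has the smaller remainder, as the distance
    is below 2^b, and the comparison is reversed. *)
Lemma gapsel_correct i b x :
  x < i + 2 ^ b -> i < x + 2 ^ b -> gapsel i b x = (x <? i).
Proof.
  intros H1 H2. unfold gapsel, below.
  pose proof (Nat.testbit_spec' x b) as Bx. pose proof (Nat.testbit_spec' i b) as Bi.
  pose proof (pow2_pos b) as HD. set (D := 2 ^ b) in *.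
  pose proof (Nat.div_mod x D ltac:(lia)) as Dx. pose proof (Nat.div_mod i D ltac:(lia)) as Di.
  pose proof (Nat.mod_upper_bound x D ltac:(lia)). pose proof (Nat.mod_upper_bound i D ltac:(lia)).
  set (qx := x / D) in *. set (qi := i / D) in *.
  set (rx := x mod D) in *. set (ri := i mod D) in *. clearbody D qx qi rx ri.
  assert (Hq : qx = qi \/ qx = qi + 1 \/ qi = qx + 1) by nia.
  destruct (Bool.eqb (Nat.testbit x b) (Nat.testbit i b)) eqn:E.
  - apply Bool.eqb_prop in E. rewrite E in Bx.
    assert (qx = qi).
    { destruct Hq as [|[->| ->]]; auto; exfalso; clear -Bx Bi.
      - pose proof (Nat.div_mod qi 2 ltac:(lia)). pose proof (Nat.div_mod (qi + 1) 2 ltac:(lia)). lia.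
      - pose proof (Nat.div_mod qx 2 ltac:(lia)). pose proof (Nat.div_mod (qx + 1) 2 ltac:(lia)). lia. }
    subst qx. destruct (Nat.ltb_spec rx ri), (Nat.ltb_spec x i); nia.
  - apply Bool.eqb_false_iff in E.
    assert (qx <> qi).
    { intros ->. apply E. destruct (Nat.testbit x b), (Nat.testbit i b); cbn in *; congruence. }
    destruct (Nat.ltb_spec rx ri), (Nat.ltb_spec x i); cbn; auto; nia.
Qed.

(** * Classes of positions *)

Inductive cls : Type :=
| Freq (a : nat)
| First
| Gap (b : nat).

Definition cls_eq_dec (x y : cls) : {x = y} + {x <> y}.
Proof. decide equality; apply Nat.eq_dec. Defined.

Definition cls_eqb (x y : cls) : bool := if cls_eq_dec x y then true else false.

Lemma cls_eqb_eq x y : cls_eqb x y = true <-> x = y.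
Proof. unfold cls_eqb. destruct (cls_eq_dec x y); split; congruence. Qed.

Lemma sum_classes {T} (g : T -> cls) (Q : T -> bool) CL l :
  NoDup CL -> (forall p, In p l -> In (g p) CL) ->
  nsum (fun k => # (filter (fun p => cls_eqb (g p) k && Q p) l)) CL = # (filter Q l).
Proof.
  intros HN H. induction l as [|p l IH].
  - cbn [filter length]. now rewrite nsum_const.
  - assert (Hp : In (g p) CL) by (apply H; cbn; auto).
    specialize (IH (fun q Hq => H q (or_intror Hq))).
    transitivity ((if Q p then 1 else 0) +
      nsum (fun k => # (filter (fun p => cls_eqb (g p) k && Q p) l)) CL).
    2: { rewrite IH. cbn [filter]. destruct (Q p); reflexivity. }
    clear IH H. induction CL as [|k CL IHC]; [destruct Hp |].
    inversion HN as [|? ? Hk HN']; subst. rewrite !nsum_cons. cbn [filter]. destruct (cls_eq_dec (g p) k) as [e|e].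
    + unfold cls_eqb at 1. destruct (cls_eq_dec (g p) k) as [_|]; [|congruence].
      rewrite (nsum_ext _ (fun k => # (filter (fun p => cls_eqb (g p) k && Q p) l)) CL).
      * cbn [andb]. destruct (Q p); cbn [length]; lia.
      * intros k' Hk'. unfold cls_eqb at 1.
        destruct (cls_eq_dec (g p) k'); [congruence | reflexivity].
    + unfold cls_eqb at 1. destruct (cls_eq_dec (g p) k) as [|_]; [congruence |].
      destruct Hp as [->|Hp]; [congruence |].
      specialize (IHC HN' Hp). cbn [filter andb] in *. lia.
Qed.

Section Classes.
Variables (s : list nat) (freq : nat -> bool) (bits : nat -> nat) (w : nat).
Notation n := (# s).
Let f := fun k => nth k s 0.

Definition gap (p : nat) : nat := p + 1 - prev f p.

Definition cls_of (p : nat) : cls :=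
  if freq (f p) then Freq (f p)
  else if prev f p =? 0 then First else Gap (bits (gap p)).

Definition kind (k : cls) : nat :=
  match k with Freq _ => 0 | First => 1 | Gap _ => 2 end.

(** Width [w] makes the window of a class without gaps the whole query, since n < 2^w. *)
Definition width (k : cls) : nat :=
  match k with Gap b => b | _ => w end.

Variables (CL : list cls) (code : cls -> list bool).
Hypothesis CL_nodup : NoDup CL.
Hypothesis CL_all : forall p, p < n -> In (cls_of p) CL.
Hypothesis code_free : forall k k', In k CL -> In k' CL ->
  (exists z, code k = code k' ++ z) -> k = k'.
Hypothesis bits_gap : forall p, p < n -> gap p < 2 ^ bits (gap p).
Hypothesis Hnw : n < 2 ^ w.

Definition pcode (p : nat) : list bool := code (cls_of p).

Definition descs : list desc := map (fun k => mkDesc (kind k) (width k) (code k)) CL.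

Lemma pcode_unambiguous k : In k CL -> unambiguous n pcode (code k).
Proof.
  intros Hk p Hp [Hz|Hz]; unfold pcode in *.
  - now rewrite (code_free k (cls_of p)) by auto.
  - now rewrite (code_free (cls_of p) k) by auto.
Qed.

Lemma members_cls k i l : In k CL -> i + l <= n ->
  members pcode (code k) (seq i l) = filter (fun p => cls_eqb (cls_of p) k) (seq i l).
Proof.
  intros Hk Hl. unfold members. apply filter_ext_in. intros p Hp. apply in_seq in Hp.
  unfold code_eqb, cls_eqb, pcode.
  destruct (list_eq_dec Bool.bool_dec (code (cls_of p)) (code k)) as [e|e],
    (cls_eq_dec (cls_of p) k) as [e'|e']; auto; exfalso.
  - apply e', code_free; auto; [apply CL_all; lia |]. exists []. now rewrite app_nil_r.
  - congruence.
Qed.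

Lemma dcontrib_cls k i j : In k CL -> 1 <= i <= j -> j <= n ->
  dcontrib pcode (prev f) i j (mkDesc (kind k) (width k) (code k)) =
  # (filter (fun p => cls_eqb (cls_of p) k && (prev f p <=? i - 1))
       (seq (i - 1) (j - (i - 1)))).
Proof.
  intros Hk Hij Hj. unfold dcontrib. cbn [dkind dbits dcode].
  assert (Hwin : i - 1 + window i j (width k) <= n).
  { unfold window. pose proof (pow2_pos (width k)). lia. }
  rewrite members_cls by auto.
  destruct k as [a| |b]; cbn [kind width contrib] in *.
  - replace (window i j w) with (j - (i - 1)) by (unfold window; lia).
    assert (E : forall p, cls_eqb (cls_of p) (Freq a) = freq a && (f p =? a)).
    { intros p. unfold cls_of.
      destruct (Nat.eqb_spec (f p) a) as [->|e].
      - destruct (freq a); cbn [andb].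
        + now apply cls_eqb_eq.
        + destruct (prev f p =? 0); reflexivity.
      - rewrite Bool.andb_false_r. destruct (freq (f p)).
        + unfold cls_eqb. destruct (cls_eq_dec _ _); [congruence | auto].
        + destruct (prev f p =? 0); reflexivity. }
    rewrite (filter_ext _ _ E).
    rewrite (filter_ext (fun p => cls_eqb (cls_of p) (Freq a) && (prev f p <=? i - 1))
      (fun p => freq a && ((f p =? a) && (prev f p <=? i - 1))))
      by (intros p; now rewrite E, Bool.andb_assoc).
    destruct (freq a); cbn [andb].
    + rewrite single_prev. reflexivity.
    + clear. induction (seq (i - 1) (j - (i - 1))); auto.
  - replace (window i j w) with (j - (i - 1)) by (unfold window; lia).
    f_equal. apply filter_ext. intros p. unfold cls_of.
    destruct (freq (f p)); [reflexivity |].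
    destruct (Nat.eqb_spec (prev f p) 0) as [->|e]; [|reflexivity].
    cbn. reflexivity.
  - transitivity (# (filter (fun p => cls_eqb (cls_of p) (Gap b) && (prev f p <=? i - 1))
        (seq (i - 1) (window i j b)))).
    + set (g := fun p => cls_eqb (cls_of p) (Gap b)).
      (* Inside the window, p < i - 1 + 2^b and the gap is below 2^b, so [prev f p] is within 2^b of
         i on both sides. *)
      assert (E : forall p, i - 1 <= p < i - 1 + window i j b -> g p = true ->
         gapsel i b (prev f p) = (prev f p <=? i - 1)).
      { intros p Hp Hg. apply cls_eqb_eq in Hg.
        assert (Hpn : p < n) by lia. specialize (bits_gap p Hpn).
        assert (Hb : bits (gap p) = b).
        { unfold cls_of in Hg. destruct (freq (f p)); [discriminate |].
          destruct (prev f p =? 0); [discriminate | now injection Hg]. }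
        rewrite Hb in bits_gap. unfold gap in bits_gap. unfold window in Hp.
        pose proof (last_occ_le f (f p) p). fold (prev f p) in *.
        rewrite gapsel_correct by lia.
        destruct (Nat.ltb_spec (prev f p) i), (Nat.leb_spec (prev f p) (i - 1)); lia. }
      assert (Hin : forall p, In p (seq (i - 1) (window i j b)) ->
        i - 1 <= p < i - 1 + window i j b) by (intros p Hp; now apply in_seq).
      induction (seq (i - 1) (window i j b)) as [|p l IH]; auto.
      cbn [filter map]. fold (g p) in *.
      specialize (IH (fun q Hq => Hin q (or_intror Hq))).
      destruct (g p) eqn:Eg; cbn [andb map filter].
      * rewrite E by (auto; apply Hin; cbn; auto).
        destruct (prev f p <=? i - 1); cbn [length]; rewrite IH; auto.
      * exact IH.
    (* Past the window a gap below 2^b places the previous occurrence inside the query, so nothing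
       is counted there. *)
    + replace (j - (i - 1)) with (window i j b + (j - (i - 1) - window i j b))
        by (unfold window; lia).
      rewrite seq_app, filter_app, length_app.
      enough (# (filter (fun p => cls_eqb (cls_of p) (Gap b) && (prev f p <=? i - 1))
        (seq (i - 1 + window i j b) (j - (i - 1) - window i j b))) = 0) by lia.
      apply length_zero_iff_nil.
      destruct (filter _ _) as [|p l] eqn:El; auto. exfalso.
      assert (Hp : In p (p :: l)) by (cbn; auto). rewrite <- El in Hp.
      apply filter_In in Hp as [Hp Hq]. apply in_seq in Hp.
      apply Bool.andb_true_iff in Hq as [Hc Hq]. apply cls_eqb_eq in Hc.
      apply Nat.leb_le in Hq.
      assert (Hpn : p < n) by (unfold window in Hp; lia). specialize (bits_gap p Hpn).
      assert (Hb : bits (gap p) = b).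
      { unfold cls_of in Hc. destruct (freq (f p)); [discriminate |].
        destruct (prev f p =? 0); [discriminate | now injection Hc]. }
      rewrite Hb in bits_gap. unfold gap, window in *. lia.
Qed.

Lemma descs_correct i j : 1 <= i <= j -> j <= n ->
  nsum (dcontrib pcode (prev f) i j) descs = count_distinct s i j.
Proof.
  intros Hij Hj. unfold descs. rewrite nsum_map.
  rewrite (nsum_ext _ (fun k => # (filter (fun p => cls_eqb (cls_of p) k &&
      (prev f p <=? i - 1)) (seq (i - 1) (j - (i - 1)))))).
  - rewrite sum_classes; auto.
    + unfold count_distinct, distinct_chars. rewrite substr_map by auto.
      symmetry. apply distinct_prev.
    + intros p Hp. apply in_seq in Hp. apply CL_all. lia.
  - intros k Hk. apply dcontrib_cls; auto.
Qed.

Lemma population_descs : population n pcode descs <= n.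
Proof.
  unfold population, descs. rewrite nsum_map. cbn [dcode].
  rewrite (nsum_ext _ (fun k => # (filter (fun p => cls_eqb (cls_of p) k && true) (seq 0 n)))).
  - rewrite sum_classes; auto.
    + rewrite <- (length_seq n 0) at 2. apply filter_length_le.
    + intros p Hp. apply in_seq in Hp. apply CL_all. lia.
  - intros k Hk. rewrite members_cls by auto. f_equal. apply filter_ext.
    intros p. now rewrite Bool.andb_true_r.
Qed.

(** * Number of stored bits *)

Definition total (VS : list (list bool)) : nat := nsum (@length bool) VS.

Lemma total_app VS VS' : total (VS ++ VS') = total VS + total VS'.
Proof. apply nsum_app. Qed.

(** Every bit of a code is stored in one node at most; bits deeper than [h] are not stored. *)
Lemma node_vectors_total h : forall xs,
  total (node_vectors h xs) <= total xs.
Proof.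
  induction h as [|h IH]; intros xs; cbn [node_vectors]; [cbn; lia |].
  set (ys := filter _ xs).
  assert (E : # ys + (total (child false ys) + total (child true ys)) = total xs).
  { subst ys. clear IH. unfold child, total, nsum, list_sum.
    induction xs as [|[|[] x] xs IH]; cbn in *; auto; lia. }
  pose proof (IH (child false ys)) as H0. pose proof (IH (child true ys)) as H1.
  change (total (?a :: ?b)) with (# a + total b).
  rewrite length_map, total_app. lia.
Qed.

Lemma matrix_vectors_total e : forall X, total (matrix_vectors e X) = e * # X.
Proof.
  induction e; intros X; cbn [matrix_vectors]; auto.
  change (total (?a :: ?b)) with (# a + total b).
  rewrite IHe, part_length, length_map. lia.
Qed.

(** What one position stores: its code in the tree and, in a gap class, one bit for each of the b +
    1 levels of the matrix. *)
Definition bit_cost (k : cls) : nat :=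
  # (code k) + match k with Gap b => S b | _ => 0 end.

Lemma sum_by_class (v : cls -> nat) l : (forall p, In p l -> In (cls_of p) CL) ->
  nsum (fun k => v k * # (filter (fun p => cls_eqb (cls_of p) k) l)) CL =
  nsum (fun p => v (cls_of p)) l.
Proof.
  intros H. induction l as [|p l IH].
  - rewrite (nsum_ext _ (fun _ => 0)) by (intros; apply Nat.mul_0_r).
    now rewrite nsum_const.
  - rewrite nsum_cons, <- IH by (intros; apply H; cbn; auto).
    assert (Hp : In (cls_of p) CL) by (apply H; cbn; auto).
    clear -CL_nodup Hp. induction CL as [|k L IH]; [destruct Hp |].
    inversion CL_nodup as [|? ? Hk HN']; subst. rewrite !nsum_cons.
    destruct (cls_eq_dec (cls_of p) k) as [e|e].
    + rewrite (nsum_ext (fun k => v k * # (filter (fun p => cls_eqb (cls_of p) k) (p :: l)))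
       (fun k => v k * # (filter (fun p => cls_eqb (cls_of p) k) l)) L).
      * cbn [filter]. unfold cls_eqb at 1. destruct (cls_eq_dec (cls_of p) k); [|congruence].
        cbn [length]. rewrite e. lia.
      * intros k' Hk'. cbn [filter]. unfold cls_eqb at 1.
        destruct (cls_eq_dec (cls_of p) k'); [congruence | reflexivity].
    + destruct Hp as [->|Hp]; [congruence |]. specialize (IH HN' Hp). rewrite IH.
      cbn [filter]. unfold cls_eqb at 1. destruct (cls_eq_dec (cls_of p) k); [congruence |]. lia.
Qed.

Lemma vectors_total h :
  total (vectors n pcode (prev f) h descs) <= nsum (fun p => bit_cost (cls_of p)) (seq 0 n).
Proof.
  set (v := fun k => match k with Gap b => S b | _ => 0 end).
  unfold vectors. rewrite total_app.
  assert (E : total (flat_map (payload n pcode (prev f)) descs) =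
    nsum (fun p => v (cls_of p)) (seq 0 n)).
  { rewrite <- (sum_by_class v) by (intros p Hp; apply in_seq in Hp; apply CL_all; lia).
    unfold descs.
    assert (Hin : forall k, In k CL -> In k CL) by auto. revert Hin.
    generalize CL at 1 3 4 as L. induction L as [|k L IH]; intros Hin; [reflexivity |].
    cbn [map flat_map]. rewrite total_app, nsum_cons, IH by (intros; apply Hin; cbn; auto).
    f_equal. unfold payload, dvalues. cbn [dkind dbits dcode].
    rewrite members_cls by (auto; apply Hin; cbn; auto).
    destruct k; cbn [kind width Nat.eqb]; auto.
    rewrite matrix_vectors_total, length_map. reflexivity. }
  rewrite E. pose proof (node_vectors_total h (map pcode (seq 0 n))) as H.
  unfold total at 2 in H. rewrite nsum_map in H.
  change (nsum (fun p => bit_cost (cls_of p)) (seq 0 n))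
    with (nsum (fun p => # (pcode p) + v (cls_of p)) (seq 0 n)).
  rewrite nsum_add. lia.
Qed.

End Classes.

(** * Shannon-Fano-Elias codes *)

Section Code.
Variables (M : nat) (W : cls -> nat).

Fixpoint cumul (CL : list cls) (k : cls) : nat :=
  match CL with
  | [] => 0
  | k' :: CL' => if cls_eq_dec k' k then 0 else W k' + cumul CL' k
  end.

Variable CL : list cls.

(** Twice the midpoint of the interval from [cumul] to [cumul + W], which keeps it integral. The
    code consists of its leading bits as an (M + 1)-bit number, without the last [log2 (W k)]. *)
Definition midpoint (k : cls) : nat := 2 * cumul CL k + W k.

Definition sfe_code (k : cls) : list bool :=
  map (fun q => Nat.testbit (midpoint k) (M - q)) (seq 0 (S M - Nat.log2 (W k))).

Hypothesis W_pos : forall k, In k CL -> 0 < W k.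
Hypothesis W_sum : nsum W CL <= 2 ^ M.

Lemma sfe_code_length k : # (sfe_code k) = S M - Nat.log2 (W k).
Proof. unfold sfe_code. now rewrite length_map, length_seq. Qed.

Lemma cumul_bound k L : In k L -> cumul L k + W k <= nsum W L.
Proof.
  induction L as [|k' L IH]; intros Hk; [destruct Hk |].
  rewrite nsum_cons. cbn [cumul].
  destruct (cls_eq_dec k' k) as [->|e]; [lia |].
  destruct Hk as [->|Hk]; [congruence |]. specialize (IH Hk). lia.
Qed.

Lemma cumul_sep k k' L : In k L -> In k' L -> k <> k' ->
  cumul L k + W k <= cumul L k' \/ cumul L k' + W k' <= cumul L k.
Proof.
  induction L as [|x L IH]; intros Hk Hk' Hne; [destruct Hk |]. cbn [cumul].
  destruct (cls_eq_dec x k) as [->|e]; destruct (cls_eq_dec k k') as [->|]; try congruence.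
  - lia.
  - destruct (cls_eq_dec x k') as [->|e']; [lia |].
    destruct Hk as [->|Hk]; [congruence |]. destruct Hk' as [->|Hk']; [congruence |].
    specialize (IH Hk Hk' Hne). lia.
Qed.

Lemma midpoint_sep k k' : In k CL -> In k' CL -> k <> k' ->
  midpoint k + W k' <= midpoint k' \/ midpoint k' + W k' <= midpoint k.
Proof.
  intros Hk Hk' Hne. unfold midpoint.
  destruct (cumul_sep k k' CL Hk Hk' Hne); lia.
Qed.

Lemma midpoint_bound k : In k CL -> midpoint k < 2 ^ S M.
Proof.
  intros Hk. pose proof (cumul_bound k CL Hk). pose proof (W_pos k Hk).
  unfold midpoint. cbn [Nat.pow]. lia.
Qed.

Lemma testbit_high x e q : x < 2 ^ e -> e <= q -> Nat.testbit x q = false.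
Proof.
  intros Hx Hq. destruct (Nat.eq_dec x 0) as [->|Hx0]; [apply Nat.bits_0 |].
  apply Nat.bits_above_log2. apply Nat.log2_lt_pow2; [lia |].
  eapply Nat.lt_le_trans; [exact Hx | apply Nat.pow_le_mono_r; lia].
Qed.

(** If the code of k' is a prefix of that of k, the midpoints agree above bit [e = log2 (W k')] and
    so differ by less than 2^e, which is at most [W k']; [midpoint_sep] forbids this for distinct
    classes. *)
Lemma sfe_code_free k k' : In k CL -> In k' CL ->
  (exists z, sfe_code k = sfe_code k' ++ z) -> k = k'.
Proof.
  intros Hk Hk' [z Hz]. destruct (cls_eq_dec k k') as [|Hne]; auto. exfalso.
  set (e := Nat.log2 (W k')).
  assert (HW : 2 ^ e <= W k') by (apply Nat.log2_spec, W_pos; auto).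
  assert (He : e <= M).
  { apply Nat.pow_le_mono_r_iff with (a := 2); [lia |].
    pose proof (cumul_bound k' CL Hk'). lia. }
  assert (Hdiv : midpoint k / 2 ^ e = midpoint k' / 2 ^ e).
  { apply Nat.bits_inj. intros q. rewrite !Nat.div_pow2_bits.
    destruct (Nat.le_gt_cases (S M) (q + e)) as [Hq|Hq].
    - rewrite !(testbit_high _ (S M)); auto using midpoint_bound.
    - assert (Hlen : # (sfe_code k') = S M - e) by apply sfe_code_length.
      assert (Hlen' := f_equal (@length bool) Hz).
      rewrite length_app, Hlen, sfe_code_length in Hlen'.
      assert (Hn := f_equal (fun l => nth (M - (q + e)) l false) Hz). cbn beta in Hn.
      rewrite app_nth1 in Hn by lia. unfold sfe_code in Hn.
      rewrite (nth_indep _ false (Nat.testbit (midpoint k) (M - 0))) in Hn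
        by (rewrite length_map, length_seq; lia).
      rewrite (map_nth (fun q => Nat.testbit (midpoint k) (M - q))) in Hn.
      rewrite (nth_indep _ false (Nat.testbit (midpoint k') (M - 0))) in Hn
        by (rewrite length_map, length_seq; lia).
      rewrite (map_nth (fun q => Nat.testbit (midpoint k') (M - q))) in Hn.
      rewrite !seq_nth in Hn by lia. cbn [Nat.add] in Hn.
      replace (M - (M - (q + e))) with (q + e) in Hn by lia. exact Hn. }
  pose proof (Nat.div_mod (midpoint k) (2 ^ e) (pow2_neq0 e)) as D1.
  pose proof (Nat.div_mod (midpoint k') (2 ^ e) (pow2_neq0 e)) as D2.
  pose proof (Nat.mod_upper_bound (midpoint k) (2 ^ e) (pow2_neq0 e)).
  pose proof (Nat.mod_upper_bound (midpoint k') (2 ^ e) (pow2_neq0 e)).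
  rewrite Hdiv in D1. destruct (midpoint_sep k k' Hk Hk' Hne); lia.
Qed.

End Code.

(** * Widths of the gap classes *)

(* [round L G y] is the width used for gaps of [y] bits: rounded up to few
   significant bits, and such that its distance to [L] is a power of two at least
   half that of [y]. *)
Definition round (L G y : nat) : nat :=
  let e := Nat.log2 y - G in
  min ((y + (2 ^ e - 1)) / 2 ^ e * 2 ^ e) (if y <? L then L - 2 ^ Nat.log2 (L - y) else L).

Lemma round_ge L G y : y <= L -> y <= round L G y.
Proof.
  intros HL. unfold round. set (e := Nat.log2 y - G).
  apply Nat.min_glb.
  - pose proof (pow2_pos e).
    pose proof (Nat.div_mod (y + (2 ^ e - 1)) (2 ^ e) ltac:(lia)).
    pose proof (Nat.mod_upper_bound (y + (2 ^ e - 1)) (2 ^ e) ltac:(lia)). lia.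
  - destruct (Nat.ltb_spec y L) as [H|H]; [|lia].
    destruct (Nat.log2_spec (L - y)) as [H1 _]; lia.
Qed.

Lemma round_le L G y : round L G y <= L.
Proof.
  unfold round. etransitivity; [apply Nat.le_min_r |].
  destruct (Nat.ltb_spec y L); lia.
Qed.

Lemma round_half L G y : y <= L -> 2 * round L G y <= L + y.
Proof.
  intros HL. unfold round.
  assert (H : (if y <? L then L - 2 ^ Nat.log2 (L - y) else L) * 2 <= L + y).
  { destruct (Nat.ltb_spec y L) as [H|H]; [|lia].
    destruct (Nat.log2_spec (L - y)) as [_ H1]; [lia |]. cbn [Nat.pow] in H1. lia. }
  etransitivity; [apply Nat.mul_le_mono_l, Nat.le_min_r | lia].
Qed.

(** Rounding up to a multiple of 2^e adds at most 2^e - 1, and [e] is chosen so that this is at most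
    the fraction 2^-G of y. *)
Lemma round_rel L G y : 0 < y -> 2 ^ G * round L G y <= 2 ^ G * y + y.
Proof.
  intros Hy. unfold round. set (e := Nat.log2 y - G).
  etransitivity; [apply Nat.mul_le_mono_l, Nat.le_min_l |].
  pose proof (pow2_pos e).
  pose proof (Nat.Div0.mul_div_le (y + (2 ^ e - 1)) (2 ^ e)) as Hd.
  assert (Hz : 2 ^ G * (2 ^ e - 1) <= y).
  { destruct (Nat.le_gt_cases (Nat.log2 y) G) as [Hle|Hgt].
    - replace e with 0 by (unfold e; lia). cbn. lia.
    - assert (2 ^ G * 2 ^ e = 2 ^ Nat.log2 y).
      { rewrite <- Nat.pow_add_r. f_equal. unfold e. lia. }
      pose proof (proj1 (Nat.log2_spec y Hy)). nia. }
  nia.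
Qed.

Lemma round_values L G y g : 0 < y <= L -> L < 2 ^ g ->
  In (round L G y)
    (flat_map (fun e => map (fun q => q * 2 ^ e) (seq 0 (2 ^ S G + 1))) (seq 0 g) ++
     map (fun e => L - 2 ^ e) (seq 0 g) ++ [L]).
Proof.
  intros Hy HL. unfold round. set (e := Nat.log2 y - G).
  assert (Hlog : forall z, 0 < z <= L -> Nat.log2 z < g).
  { intros z Hz. apply Nat.log2_lt_pow2; lia. }
  apply in_or_app.
  destruct (Nat.min_spec ((y + (2 ^ e - 1)) / 2 ^ e * 2 ^ e)
    (if y <? L then L - 2 ^ Nat.log2 (L - y) else L)) as [[_ ->]|[_ ->]].
  - left. apply in_flat_map. exists e. split.
    + apply in_seq. pose proof (Hlog y Hy). unfold e. lia.
    + apply in_map_iff. eexists. split; [reflexivity |]. apply in_seq.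
      split; [lia |]. pose proof (pow2_pos e).
      assert (Hy2 := proj2 (Nat.log2_spec y ltac:(lia))).
      assert (y < 2 ^ S G * 2 ^ e).
      { rewrite <- Nat.pow_add_r. eapply Nat.lt_le_trans; [exact Hy2 |].
        apply Nat.pow_le_mono_r; unfold e; lia. }
      replace (0 + (2 ^ S G + 1)) with (S (2 ^ S G)) by lia.
      apply Nat.Div0.div_lt_upper_bound. nia.
  - right. apply in_or_app. destruct (Nat.ltb_spec y L) as [H|H].
    + left. apply in_map_iff. eexists. split; [reflexivity |].
      apply in_seq. pose proof (Hlog (L - y) ltac:(lia)). lia.
    + right. cbn. auto.
Qed.

Definition widths (L G : nat) : list nat :=
  nodup Nat.eq_dec (map (round L G) (seq 1 L)).

(** The candidates of [round_values] number (2^(G+1) + 1) g + g + 1 with g < 2^(G+1). This bound is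
    the origin of [class_bits]. *)
Lemma widths_length L G g : L < 2 ^ g -> g < 2 ^ S G -> # (widths L G) <= 2 ^ (2 * G + 4).
Proof.
  intros HL Hg. unfold widths.
  etransitivity.
  - apply (NoDup_incl_length (NoDup_nodup _ _) (l' :=
     flat_map (fun e => map (fun q => q * 2 ^ e) (seq 0 (2 ^ S G + 1))) (seq 0 g) ++
     map (fun e => L - 2 ^ e) (seq 0 g) ++ [L])).
    intros b Hb. apply nodup_In, in_map_iff in Hb as (y & <- & Hy). apply in_seq in Hy.
    apply round_values; auto. lia.
  - rewrite !length_app, (flat_map_length_const _ _ (2 ^ S G + 1))
      by (intros; rewrite length_map, length_seq; auto).
    rewrite length_map, length_seq. cbn [length].
    replace (2 * G + 4) with (S G + S G + 2) by lia. rewrite !Nat.pow_add_r.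
    pose proof (pow2_pos (S G)). cbn [Nat.pow] in *. nia.
Qed.

Lemma widths_in L G y : 0 < y <= L -> In (round L G y) (widths L G).
Proof.
  intros Hy. apply nodup_In, in_map, in_seq. lia.
Qed.

(** * Size of the data structure *)

Lemma nsum_group {T} (g : T -> nat) (F : T -> nat) A l :
  NoDup A -> (forall p, In p l -> In (g p) A) ->
  nsum F l = nsum (fun a => nsum (fun p => if g p =? a then F p else 0) l) A.
Proof.
  intros HN H. induction l as [|p l IH].
  - cbn. clear. induction A; cbn in *; auto.
  - rewrite nsum_cons, IH by (intros; apply H; cbn; auto).
    assert (Hp : In (g p) A) by (apply H; cbn; auto).
    rewrite (Nat.add_comm (F p)).
    rewrite <- (Nat.add_cancel_r _ _ 0), Nat.add_0_r.
    transitivity (nsum (fun a => nsum (fun p => if g p =? a then F p else 0) l) A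
       + nsum (fun a => if g p =? a then F p else 0) A).
    + f_equal. clear -HN Hp. induction A as [|a A IH]; [destruct Hp |].
      inversion HN as [|? ? Ha HN']; subst. rewrite nsum_cons.
      destruct (Nat.eqb_spec (g p) a) as [e|e].
      * enough (nsum (fun a => if g p =? a then F p else 0) A = 0) by lia.
        rewrite <- e in Ha. clear -Ha. induction A as [|b A IH]; auto.
        rewrite nsum_cons. destruct (Nat.eqb_spec (g p) b) as [e|e];
          [exfalso; apply Ha; cbn; auto |]. apply IH. intros Hb. apply Ha. cbn; auto.
      * destruct Hp as [->|Hp]; [congruence |]. apply IH; auto.
    + rewrite <- nsum_add, Nat.add_0_r. unfold nsum. f_equal. apply map_ext.
      intros a. rewrite Nat.add_comm. reflexivity.
Qed.

Lemma count_seq (s : list nat) a :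
  count_occ Nat.eq_dec s a =
  nsum (fun p => if nth p s 0 =? a then 1 else 0) (seq 0 (# s)).
Proof.
  induction s as [|x s IH] using rev_ind; [reflexivity |].
  rewrite length_app, Nat.add_1_r, seq_S, nsum_app, count_occ_app, IH.
  f_equal.
  - unfold nsum. f_equal. apply map_ext_in. intros p Hp. apply in_seq in Hp.
    rewrite app_nth1 by lia. reflexivity.
  - rewrite nsum_cons. cbn [Nat.add nsum map list_sum fold_right count_occ].
    rewrite app_nth2, Nat.sub_diag by lia. cbn [nth].
    destruct (Nat.eq_dec x a), (Nat.eqb_spec x a); congruence || reflexivity.
Qed.

(** A linear bound in the manner of a tangent to the logarithm at 2^m; it is how concavity enters
    the worst-case count. *)
Lemma log2_tangent m x : Nat.log2 x <= m + x / 2 ^ m.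
Proof.
  destruct (Nat.le_gt_cases (Nat.log2 x) m) as [H|H]; [lia |].
  assert (Hx : 0 < x) by (destruct x; [cbn in H; lia | lia]).
  assert (2 ^ (Nat.log2 x - m) <= x / 2 ^ m).
  { apply Nat.div_le_lower_bound; auto. rewrite <- Nat.pow_add_r.
    replace (m + (Nat.log2 x - m)) with (Nat.log2 x) by lia.
    now apply Nat.log2_spec. }
  pose proof (Nat.pow_gt_lin_r 2 (Nat.log2 x - m) ltac:(lia)). lia.
Qed.

Lemma occ_sum (s : list nat) :
  nsum (count_occ Nat.eq_dec s) (nodup Nat.eq_dec s) = # s.
Proof.
  transitivity (nsum (fun _ => 1) (seq 0 (# s))); [| rewrite nsum_const, length_seq; lia].
  rewrite (nsum_group (fun k => nth k s 0) (fun _ => 1) (nodup Nat.eq_dec s) (seq 0 (# s))).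
  - unfold nsum at 1 2. f_equal. apply map_ext. intros a. apply count_seq.
  - apply NoDup_nodup.
  - intros p Hp. apply in_seq in Hp. apply nodup_In, nth_In. lia.
Qed.

(** An occurrence of [a] at [P] moves [last_occ] from [prev f P] to P + 1, which is by its gap. The
    second part provides a first occurrence to charge these gaps to. *)
Lemma gaps_telescope (f : nat -> nat) a P :
  nsum (fun p => if f p =? a then if prev f p =? 0 then 0 else p + 1 - prev f p else 0)
    (seq 0 P) <= last_occ f a P /\
  (0 < last_occ f a P ->
   1 <= nsum (fun p => if f p =? a then if prev f p =? 0 then 1 else 0 else 0) (seq 0 P)).
Proof.
  induction P as [|P [IH1 IH2]]; [cbn; lia |].
  rewrite seq_S, !nsum_app, !nsum_cons. cbn [Nat.add nsum map list_sum fold_right last_occ].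
  fold (nsum (fun p => if f p =? a then if prev f p =? 0 then 0 else p + 1 - prev f p else 0)
    (seq 0 P)) in *.
  fold (nsum (fun p => if f p =? a then if prev f p =? 0 then 1 else 0 else 0) (seq 0 P)) in *.
  destruct (Nat.eqb_spec (f P) a) as [e|e]; [|lia].
  assert (Hpr : prev f P = last_occ f a P) by (unfold prev; now rewrite e).
  pose proof (last_occ_le f a P). rewrite Hpr.
  destruct (Nat.eqb_spec (last_occ f a P) 0); lia.
Qed.

Lemma gap_bounds (s : list nat) p : p < # s -> 0 < gap s p <= # s.
Proof.
  intros Hp. unfold gap, prev. pose proof (last_occ_le (fun k => nth k s 0) (nth p s 0) p). lia.
Qed.

Section Size.
Variables (s : list nat) (L G fx pi : nat).
Notation n := (# s).
Let f := fun k => nth k s 0.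
Notation occ := (count_occ Nat.eq_dec s).

Definition frequent (a : nat) : bool := n <? occ a * 2 ^ fx.
Definition gap_width (d : nat) : nat := round L G (Nat.log2 d + 1).

(** Gap classes share their weight evenly, as there are at most 2^pi of them. Frequent classes and
    [First] weigh at most n each in total, gap classes at most n + 2^pi <= 2n, so all fit into
    2^(L+2); hence the parameter of [code]. *)
Definition weight (k : cls) : nat :=
  match k with Freq a => occ a | First => n | Gap _ => n / 2 ^ pi + 1 end.

Definition classes : list cls :=
  map Freq (filter frequent (nodup Nat.eq_dec s)) ++ First :: map Gap (widths L G).

Definition code : cls -> list bool := sfe_code (L + 2) weight classes.

Hypothesis Hn1 : 2 ^ (L - 1) <= n.
Hypothesis Hn2 : n < 2 ^ L.
Hypothesis HL : 0 < L.
Hypothesis Hwid : # (widths L G) <= 2 ^ pi.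
Hypothesis Hpin : 2 ^ pi <= n.
Hypothesis Hfx : fx < L.
Hypothesis Hfx0 : 0 < fx.
Hypothesis Hpi : pi < L.

Notation cl := (cls_of s frequent gap_width).

Lemma n_pos : 0 < n.
Proof. pose proof (pow2_pos pi). lia. Qed.

Lemma classes_nodup : NoDup classes.
Proof.
  unfold classes. apply NoDup_app.
  - apply FinFun.Injective_map_NoDup; [intros x y [= ->]; auto |].
    apply NoDup_filter, NoDup_nodup.
  - constructor.
    + intros Hin. apply in_map_iff in Hin as (? & ? & _). discriminate.
    + apply FinFun.Injective_map_NoDup; [intros x y [= ->]; auto |]. apply NoDup_nodup.
  - intros k Hk Hk'. apply in_map_iff in Hk as (a & <- & _).
    destruct Hk' as [Hk'|Hk']; [discriminate |].
    apply in_map_iff in Hk' as (? & ? & _). discriminate.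
Qed.

Lemma gap_log p : p < n -> Nat.log2 (gap s p) + 1 <= L.
Proof.
  intros Hp. pose proof (gap_bounds s p Hp).
  assert (Nat.log2 (gap s p) < L); [apply Nat.log2_lt_pow2 |]; lia.
Qed.

Lemma classes_all p : p < n -> In (cl p) classes.
Proof.
  intros Hp. unfold cls_of, classes. change (nth p s 0) with (f p).
  change (prev (fun k => nth k s 0) p) with (prev f p). apply in_or_app.
  destruct (frequent (f p)) eqn:Ef.
  - left. apply in_map, filter_In. split; auto. apply nodup_In, nth_In. auto.
  - right. destruct (prev f p =? 0); [cbn; auto |]. right. apply in_map.
    apply widths_in. pose proof (gap_log p Hp). lia.
Qed.

Lemma gap_width_ok p : p < n -> gap s p < 2 ^ gap_width (gap s p).
Proof.
  intros Hp. pose proof (gap_bounds s p Hp). pose proof (gap_log p Hp).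
  unfold gap_width. eapply Nat.lt_le_trans; [apply (Nat.log2_spec (gap s p)); lia |].
  rewrite <- (Nat.add_1_r (Nat.log2 (gap s p))).
  apply Nat.pow_le_mono_r; [lia |]. now apply round_ge.
Qed.

Lemma weight_sum : nsum weight classes <= 2 ^ (L + 2).
Proof.
  unfold classes. rewrite nsum_app, nsum_cons, !nsum_map. cbn [weight].
  pose proof (nsum_filter_le (fun a => occ a) frequent (nodup Nat.eq_dec s)) as H1.
  rewrite (occ_sum s : nsum (fun a => occ a) _ = _) in H1.
  assert (H2 : nsum (fun _ : nat => n / 2 ^ pi + 1) (widths L G) <= n + 2 ^ pi).
  { rewrite nsum_const. pose proof (Nat.Div0.mul_div_le n (2 ^ pi)). nia. }
  rewrite Nat.pow_add_r. cbn [Nat.pow]. lia.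
Qed.

Lemma weight_pos k : In k classes -> 0 < weight k.
Proof.
  unfold classes. intros Hk. apply in_app_or in Hk as [Hk|[<-|Hk]].
  - apply in_map_iff in Hk as (a & <- & Ha). apply filter_In in Ha as [Ha _].
    apply nodup_In in Ha. now apply count_occ_In.
  - apply n_pos.
  - apply in_map_iff in Hk as (b & <- & _). cbn [weight]. lia.
Qed.

Lemma code_prefix_free k k' : In k classes -> In k' classes ->
  (exists z, code k = code k' ++ z) -> k = k'.
Proof. apply sfe_code_free; [exact weight_pos | exact weight_sum]. Qed.

Lemma code_length k : # (code k) = L + 3 - Nat.log2 (weight k).
Proof. unfold code. rewrite sfe_code_length. lia. Qed.

Lemma log2_lower q x : q < L -> n < x * 2 ^ q -> L - 1 - q <= Nat.log2 x.
Proof.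
  intros Hq Hx. apply Nat.log2_le_pow2.
  - destruct x; lia.
  - assert (2 ^ (L - 1) = 2 ^ (L - 1 - q) * 2 ^ q).
    { rewrite <- Nat.pow_add_r. f_equal. lia. }
    pose proof (pow2_pos q). nia.
Qed.

Lemma code_freq a : frequent a = true -> # (code (Freq a)) <= fx + 4.
Proof.
  intros Ha. rewrite code_length. cbn [weight]. apply Nat.ltb_lt in Ha.
  pose proof (log2_lower fx (occ a) Hfx Ha). lia.
Qed.

Lemma code_first : # (code First) <= 4.
Proof.
  rewrite code_length. cbn [weight].
  assert (L - 1 <= Nat.log2 n) by (apply Nat.log2_le_pow2; [apply n_pos | auto]). lia.
Qed.

Lemma code_gap b : # (code (Gap b)) <= pi + 4.
Proof.
  rewrite code_length. cbn [weight].
  assert (H : n < (n / 2 ^ pi + 1) * 2 ^ pi).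
  { pose proof (Nat.div_mod n (2 ^ pi) (pow2_neq0 pi)).
    pose proof (Nat.mod_upper_bound n (2 ^ pi) (pow2_neq0 pi)). nia. }
  pose proof (log2_lower pi _ Hpi H). lia.
Qed.

Lemma code_bound k : In k classes -> # (code k) <= fx + pi + 4.
Proof.
  unfold classes. intros Hk. apply in_app_or in Hk as [Hk|[<-|Hk]].
  - apply in_map_iff in Hk as (a & <- & Ha). apply filter_In in Ha as [_ Ha].
    pose proof (code_freq a Ha). lia.
  - pose proof code_first. lia.
  - apply in_map_iff in Hk as (b & <- & _). pose proof (code_gap b). lia.
Qed.

Lemma frequent_count : # (filter frequent (nodup Nat.eq_dec s)) <= 2 ^ fx.
Proof.
  assert (H : nsum (fun _ => n) (filter frequent (nodup Nat.eq_dec s)) <=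
    nsum (fun a => 2 ^ fx * occ a) (filter frequent (nodup Nat.eq_dec s))).
  { apply nsum_le. intros a Ha. apply filter_In in Ha as [_ Ha]. apply Nat.ltb_lt in Ha. lia. }
  rewrite nsum_const, nsum_mul in H.
  pose proof (nsum_filter_le occ frequent (nodup Nat.eq_dec s)) as H'. rewrite occ_sum in H'.
  pose proof n_pos. pose proof (pow2_pos fx). nia.
Qed.

Definition gap_pos (p : nat) : bool := negb (frequent (f p)) && negb (prev f p =? 0).
Definition first_pos (p : nat) : bool := negb (frequent (f p)) && (prev f p =? 0).

Notation bcost := (bit_cost code).

(** The gaps of a rare character that occurs sum to at most n, and it has a first occurrence on the
    right-hand side. Frequent characters appear on neither side. *)
Lemma gap_sum :
  nsum (fun p => if gap_pos p then gap s p else 0) (seq 0 n) <=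
  n * nsum (fun p => if first_pos p then 1 else 0) (seq 0 n).
Proof.
  assert (Hin : forall p, In p (seq 0 n) -> In (f p) (nodup Nat.eq_dec s)).
  { intros p Hp. apply in_seq in Hp. apply nodup_In, nth_In. lia. }
  rewrite !(nsum_group f _ (nodup Nat.eq_dec s) (seq 0 n)) by (auto using NoDup_nodup).
  rewrite <- nsum_mul. apply nsum_le. intros a _.
  destruct (gaps_telescope f a n) as [H1 H2]. pose proof (last_occ_le f a n) as H3.
  destruct (frequent a) eqn:Ea.
  - enough (nsum (fun p => if f p =? a then if gap_pos p then gap s p else 0 else 0) (seq 0 n) <=
      nsum (fun _ => 0) (seq 0 n)) by (rewrite nsum_const in *; lia).
    apply nsum_le. intros p _. unfold gap_pos. destruct (Nat.eqb_spec (f p) a) as [->|]; auto.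
    rewrite Ea. cbn. lia.
  - assert (E1 : nsum (fun p => if f p =? a then if gap_pos p then gap s p else 0 else 0) (seq 0 n) =
      nsum (fun p => if f p =? a then if prev f p =? 0 then 0 else p + 1 - prev f p else 0) (seq 0 n)).
    { unfold nsum. f_equal. apply map_ext. intros p. unfold gap_pos.
      destruct (Nat.eqb_spec (f p) a) as [->|]; auto. rewrite Ea.
      destruct (prev f p =? 0); reflexivity. }
    assert (E2 : nsum (fun p => if f p =? a then if first_pos p then 1 else 0 else 0) (seq 0 n) =
      nsum (fun p => if f p =? a then if prev f p =? 0 then 1 else 0 else 0) (seq 0 n)).
    { unfold nsum. f_equal. apply map_ext. intros p. unfold first_pos.
      destruct (Nat.eqb_spec (f p) a) as [->|]; auto. rewrite Ea.
      destruct (prev f p =? 0); reflexivity. }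
    rewrite E1, E2. destruct (last_occ f a n); [lia |]. nia.
Qed.

Lemma cost_cases p : p < n ->
  (frequent (f p) = true /\ gap_pos p = false /\ first_pos p = false /\
     bcost (cl p) = # (code (Freq (f p)))) \/
  (frequent (f p) = false /\ gap_pos p = false /\ first_pos p = true /\
     bcost (cl p) <= 4) \/
  (frequent (f p) = false /\ gap_pos p = true /\ first_pos p = false /\
     bcost (cl p) <= pi + 5 + gap_width (gap s p)).
Proof.
  intros Hp. unfold gap_pos, first_pos, bit_cost, cls_of. change (nth p s 0) with (f p).
  change (prev (fun k => nth k s 0) p) with (prev f p).
  destruct (frequent (f p)); cbn [negb andb].
  - left. repeat split; auto.
  - right. destruct (prev f p =? 0); cbn [negb].
    + left. repeat split; auto. pose proof code_first. lia.
    + right. repeat split; auto. pose proof (code_gap (gap_width (gap s p))). lia.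
Qed.

(* Worst case size: it must stay below the 2^w addressable words even if the
   entropy is maximal and w = lg n. *)
Lemma bits_worst :
  fx + 4 + fx <= L + 6 -> 2 ^ fx + fx <= 2 * L ->
  2 * nsum (fun p => bcost (cl p)) (seq 0 n) + n * fx <= n * (2 * L + 2 * pi + 12).
Proof.
  intros Hs1 Hs2. rewrite <- nsum_mul.
  (* An amortized count. [round_half] and the tangent at 2^(L - fx) give each gap position its
     saving [fx] at a charge of gap / 2^(L - fx). A first occurrence costs at most 4 bits and
     therefore has room to save 2^fx as well. *)
  assert (H : nsum (fun p => 2 * bcost (cl p)) (seq 0 n) + nsum (fun _ => fx) (seq 0 n) +
      nsum (fun p => if first_pos p then 2 ^ fx else 0) (seq 0 n) <=
    nsum (fun _ => 2 * L + 2 * pi + 12) (seq 0 n) +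
    nsum (fun p => (if gap_pos p then gap s p else 0) / 2 ^ (L - fx)) (seq 0 n)).
  { rewrite <- !nsum_add. apply nsum_le. intros p Hp. apply in_seq in Hp.
    destruct (cost_cases p ltac:(lia)) as [(Hf & -> & -> & ->)|[(_ & -> & -> & Hc)|(_ & -> & -> & Hc)]].
    - pose proof (code_freq _ Hf). lia.
    - lia.
    - pose proof (gap_log p ltac:(lia)) as Hl.
      pose proof (round_half L G (Nat.log2 (gap s p) + 1) Hl) as Hr.
      fold (gap_width (gap s p)) in Hr.
      pose proof (log2_tangent (L - fx) (gap s p)). lia. }
  rewrite !nsum_const, !length_seq in H.
  assert (Hdiv : nsum (fun p => (if gap_pos p then gap s p else 0) / 2 ^ (L - fx)) (seq 0 n) <=
    nsum (fun p => if gap_pos p then gap s p else 0) (seq 0 n) / 2 ^ (L - fx)).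
  { clear. induction (seq 0 n) as [|p l IH]; [cbn; lia |]. rewrite !nsum_cons.
    set (x := if gap_pos p then gap s p else 0). set (q := 2 ^ (L - fx)) in *.
    apply Nat.div_le_lower_bound; [apply pow2_neq0 |].
    pose proof (Nat.Div0.mul_div_le x q).
    pose proof (Nat.Div0.mul_div_le (nsum (fun p => if gap_pos p then gap s p else 0) l) q). nia. }
  assert (Hg := gap_sum). set (Sg := nsum (fun p => if gap_pos p then gap s p else 0) (seq 0 n)) in *.
  set (S1 := nsum (fun p => if first_pos p then 1 else 0) (seq 0 n)) in *.
  assert (E1 : nsum (fun p => if first_pos p then 2 ^ fx else 0) (seq 0 n) = 2 ^ fx * S1).
  { unfold S1. rewrite <- nsum_mul. unfold nsum. f_equal. apply map_ext. intros p.
    destruct (first_pos p); lia. }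
  (* The extra savings of the first occurrences pay for all charges, by [gap_sum] and n < 2^L. *)
  assert (Sg / 2 ^ (L - fx) <= 2 ^ fx * S1).
  { apply Nat.Div0.div_le_upper_bound.
    rewrite Nat.mul_assoc, <- Nat.pow_add_r. replace (L - fx + fx) with L by lia. nia. }
  lia.
Qed.

End Size.

(** * Entropy bound *)

Definition rsum {T} (F : T -> R) (l : list T) : R :=
  fold_right (fun x acc => (F x + acc)%R) 0%R l.

Lemma rsum_cons {T} (F : T -> R) x l : rsum F (x :: l) = (F x + rsum F l)%R.
Proof. reflexivity. Qed.

Lemma rsum_ext {T} (F F' : T -> R) l : (forall x, In x l -> F x = F' x) -> rsum F l = rsum F' l.
Proof.
  induction l as [|x l IH]; intros H; auto. rewrite !rsum_cons, (H x), IH; cbn; auto.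
  intros y Hy. apply H. cbn; auto.
Qed.

Lemma rsum_le {T} (F F' : T -> R) l :
  (forall x, In x l -> (F x <= F' x)%R) -> (rsum F l <= rsum F' l)%R.
Proof.
  induction l as [|x l IH]; intros H; [cbn; lra | rewrite !rsum_cons].
  pose proof (H x (or_introl eq_refl)). specialize (IH (fun y Hy => H y (or_intror Hy))). lra.
Qed.

Lemma rsum_add {T} (F F' : T -> R) l : rsum (fun x => (F x + F' x)%R) l = (rsum F l + rsum F' l)%R.
Proof. induction l; [cbn; lra |]. rewrite !rsum_cons, IHl. lra. Qed.

Lemma rsum_mul {T} c (F : T -> R) l : rsum (fun x => (c * F x)%R) l = (c * rsum F l)%R.
Proof. induction l; [cbn; lra |]. rewrite !rsum_cons, IHl. lra. Qed.

Lemma rsum_const {T} c (l : list T) : rsum (fun _ => c) l = (c * INR (# l))%R.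
Proof.
  induction l as [|x l IH]; [cbn; lra |]. cbn [length]. rewrite rsum_cons, S_INR, IH. lra.
Qed.

Lemma INR_nsum {T} (F : T -> nat) l : INR (nsum F l) = rsum (fun x => INR (F x)) l.
Proof. induction l as [|x l IH]; auto. rewrite nsum_cons, plus_INR, IH. reflexivity. Qed.

Lemma rsum_map {T U} (g : U -> T) (F : T -> R) l : rsum F (map g l) = rsum (fun x => F (g x)) l.
Proof. induction l; auto. cbn [map]. rewrite !rsum_cons. congruence. Qed.

Lemma rsum_group (F : nat -> R) A l : NoDup A -> incl l A ->
  rsum F l = rsum (fun a => (INR (count_occ Nat.eq_dec l a) * F a)%R) A.
Proof.
  intros HN. induction l as [|x l IH]; intros Hincl.
  - clear. induction A; [reflexivity |]. rewrite rsum_cons, <- IHA. cbn. lra.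
  - rewrite rsum_cons, IH by (intros y Hy; apply Hincl; cbn; auto).
    assert (Hx : In x A) by (apply Hincl; cbn; auto). clear IH Hincl.
    induction A as [|a A IHA]; [destruct Hx |].
    inversion HN as [|? ? Ha HN']; subst. rewrite !rsum_cons. cbn [count_occ].
    destruct (Nat.eq_dec x a) as [e|e].
    + subst a. rewrite S_INR.
      rewrite (rsum_ext (fun a => (INR (if Nat.eq_dec x a then S (count_occ Nat.eq_dec l a)
         else count_occ Nat.eq_dec l a) * F a)%R)
         (fun a => (INR (count_occ Nat.eq_dec l a) * F a)%R) A).
      * lra.
      * intros b Hb. destruct (Nat.eq_dec x b) as [e|]; [congruence | auto].
    + destruct Hx as [Hx|Hx]; [congruence |]. specialize (IHA HN' Hx).
      cbn [count_occ] in IHA. lra.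
Qed.

Lemma map_nth_seq (s : list nat) : map (fun k => nth k s 0) (seq 0 (# s)) = s.
Proof.
  apply (nth_ext _ _ 0 0).
  - now rewrite length_map, length_seq.
  - intros k Hk. rewrite length_map, length_seq in Hk.
    rewrite (nth_indep _ 0 (nth 0 s 0)) by now rewrite length_map, length_seq.
    rewrite (map_nth (fun k => nth k s 0)), seq_nth by auto. reflexivity.
Qed.

Lemma ln2_bounds : (1 / 2 < ln 2 <= 1)%R.
Proof.
  split; [pose proof ln_lt_2; lra |].
  pose proof (exp_ineq1 1 ltac:(lra)). rewrite <- (ln_exp 1).
  left. apply ln_increasing; lra.
Qed.

Lemma ln_le_sub x : (0 < x)%R -> (ln x <= x - 1)%R.
Proof.
  intros Hx. destruct (Req_dec (ln x) 0) as [e|e].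
  - rewrite e. assert (x = 1)%R; [|lra]. rewrite <- (exp_ln x Hx), e. apply exp_0.
  - pose proof (exp_ineq1 (ln x) e) as H. rewrite exp_ln in H by auto. lra.
Qed.

Lemma log2_mult x y : (0 < x)%R -> (0 < y)%R -> log2 (x * y) = (log2 x + log2 y)%R.
Proof. intros. unfold log2. rewrite ln_mult by auto. lra. Qed.

Lemma log2_pow k : log2 (INR (2 ^ k)) = INR k.
Proof.
  pose proof ln2_bounds. unfold log2. rewrite pow_INR, ln_pow by (cbn; lra).
  replace (INR 2) with 2%R by (cbn; lra). field. lra.
Qed.

Lemma log2_le x y : (0 < x)%R -> (x <= y)%R -> (log2 x <= log2 y)%R.
Proof.
  intros Hx Hxy. pose proof ln2_bounds. unfold log2.
  apply Rmult_le_compat_r; [left; apply Rinv_0_lt_compat; lra |].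
  destruct Hxy as [Hxy| ->]; [left; apply ln_increasing; auto | lra].
Qed.

Lemma log2_lt x y : (0 < x)%R -> (x < y)%R -> (log2 x < log2 y)%R.
Proof.
  intros Hx Hxy. pose proof ln2_bounds. unfold log2.
  apply Rmult_lt_compat_r; [apply Rinv_0_lt_compat; lra |]. apply ln_increasing; auto.
Qed.

(** Crude, but applied only to gaps divided by their mean, where the linear term sums to O(n); this
    stands in for Jensen's inequality. *)
Lemma log2_le_lin x : (0 < x)%R -> (log2 x <= 2 * x)%R.
Proof.
  intros Hx. pose proof ln2_bounds. pose proof (ln_le_sub x Hx). unfold log2.
  apply (Rmult_le_reg_r (ln 2)); [lra |].
  replace (ln x / ln 2 * ln 2)%R with (ln x) by (field; lra). nra.
Qed.

Lemma log2_nat m : 0 < m ->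
  (INR (Nat.log2 m) <= log2 (INR m) < INR (Nat.log2 m) + 1)%R.
Proof.
  intros Hm. destruct (Nat.log2_spec m Hm) as [H1 H2].
  rewrite <- S_INR, <- (log2_pow (Nat.log2 m)), <- (log2_pow (S (Nat.log2 m))). split.
  - apply log2_le; [|now apply le_INR]. apply lt_0_INR. auto.
  - apply log2_lt; [|now apply lt_INR]. apply lt_0_INR. auto.
Qed.

Section Entropy.
Variables (s : list nat) (L G fx pi : nat).
Notation n := (# s).
Let f := fun k => nth k s 0.
Notation occ := (count_occ Nat.eq_dec s).

Hypothesis Hn1 : 2 ^ (L - 1) <= n.
Hypothesis Hn2 : n < 2 ^ L.
Hypothesis HL : 0 < L.
Hypothesis Hwid : # (widths L G) <= 2 ^ pi.
Hypothesis Hpin : 2 ^ pi <= n.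
Hypothesis Hfx : fx < L.
Hypothesis Hfx0 : 0 < fx.
Hypothesis Hpi : pi < L.

Notation freq := (frequent s fx).
Notation cl := (cls_of s freq (gap_width L G)).
Notation bcost := (bit_cost (code s L G fx pi)).

Definition info (a : nat) : R := log2 (INR n / INR (occ a)).

Lemma entropy_sum : rsum (fun p => info (f p)) (seq 0 n) = (INR n * H0 s)%R.
Proof.
  rewrite <- (rsum_map f info). unfold f. rewrite map_nth_seq.
  rewrite (rsum_group _ (nodup Nat.eq_dec s)).
  - change (H0 s) with (rsum (fun a => (INR (occ a) / INR n * log2 (INR n / INR (occ a)))%R)
      (nodup Nat.eq_dec s)).
    rewrite <- rsum_mul. apply rsum_ext. intros a Ha. apply nodup_In in Ha.
    assert (0 < n) by (destruct s; [destruct Ha | cbn; lia]).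
    apply lt_0_INR in H. unfold info. field. lra.
  - apply NoDup_nodup.
  - intros a Ha. now apply nodup_In.
Qed.

Lemma info_bounds p : p < n -> (0 <= info (f p))%R /\ (0 < INR (occ (f p)) <= INR n)%R.
Proof.
  intros Hp. assert (Ho : 0 < occ (f p)) by (apply count_occ_In, nth_In; auto).
  assert (Hb : (0 < INR (occ (f p)) <= INR n)%R).
  { split; [now apply lt_0_INR | apply le_INR, count_occ_bound]. }
  split; auto. unfold info. change 0%R with (INR 0). rewrite <- (log2_pow 0).
  apply log2_le; [cbn; lra |]. cbn.
  apply (Rmult_le_reg_r (INR (occ (f p)))); [lra |].
  replace (INR n / INR (occ (f p)) * INR (occ (f p)))%R with (INR n) by (field; lra). lra.
Qed.

(** The gap relative to n / n_a, so that its logarithm is what the logarithm of the gap exceeds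
    [info] by. *)
Definition spread (p : nat) : R := (INR (gap s p) * INR (occ (f p)) / INR n)%R.

(** For each character the gaps telescope to at most n; weighted by its number of occurrences and
    summed over the characters they give at most n * n. *)
Lemma spread_sum :
  (rsum (fun p => if gap_pos s fx p then spread p else 0%R) (seq 0 n) <= INR n)%R.
Proof.
  assert (Hn : (0 < INR n)%R) by (apply lt_0_INR; pose proof (pow2_pos pi); lia).
  assert (Hin : forall p, In p (seq 0 n) -> In (f p) (nodup Nat.eq_dec s)).
  { intros p Hp. apply in_seq in Hp. apply nodup_In, nth_In. lia. }
  assert (H : nsum (fun p => if gap_pos s fx p then gap s p * occ (f p) else 0) (seq 0 n) <= n * n).
  { rewrite (nsum_group f _ (nodup Nat.eq_dec s) (seq 0 n)) by (auto using NoDup_nodup).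
    transitivity (n * nsum occ (nodup Nat.eq_dec s)); [| now rewrite occ_sum].
    rewrite <- nsum_mul. apply nsum_le. intros a _.
    destruct (gaps_telescope f a n) as [H1 _]. pose proof (last_occ_le f a n) as H3.
    etransitivity; [| apply Nat.mul_le_mono_r; etransitivity; [exact H1 | exact H3]].
    rewrite Nat.mul_comm, <- nsum_mul. apply nsum_le. intros p _.
    unfold gap_pos. change (gap s p) with (p + 1 - prev f p).
    change (prev (fun k => nth k s 0) p) with (prev f p).
    destruct (Nat.eqb_spec (f p) a) as [->|]; [|lia].
    set (d := p + 1 - prev f p).
    destruct (prev f p =? 0); destruct (negb _); cbn [negb andb]; nia. }
  apply le_INR in H. rewrite INR_nsum, mult_INR in H.
  apply (Rmult_le_reg_l (INR n)); [auto |]. rewrite <- rsum_mul.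
  eapply Rle_trans; [| exact H]. right. apply rsum_ext. intros p _.
  destruct (gap_pos s fx p); [|cbn; lra]. unfold spread. rewrite mult_INR. field. lra.
Qed.

(** A gap position pays at most pi + 5 + b bits, with b at most (1 + D) (info + 2 spread + 1) and D
    = 2^-G <= 1. A rare character has info at least [fx], so [pi] is at most the fraction pi / fx of
    it; 5 + 2 gives 7, and the spread gets the factor 4. A frequent character pays at most info +
    5. *)
Lemma cost_entropy p : p < n ->
  (INR (bcost (cl p)) <= info (f p) * (1 + INR pi / INR fx + / INR (2 ^ G)) + 7 +
     4 * (if gap_pos s fx p then spread p else 0))%R.
Proof.
  intros Hp. destruct (info_bounds p Hp) as [Hi [Ho Ho']].
  assert (Hfx' : (0 < INR fx)%R) by now apply lt_0_INR.
  assert (HG : (0 < / INR (2 ^ G) <= 1)%R).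
  { assert (1 <= INR (2 ^ G))%R.
    { change 1%R with (INR 1). apply le_INR. pose proof (pow2_pos G). lia. }
    split; [apply Rinv_0_lt_compat; lra |]. rewrite <- Rinv_1. apply Rinv_le_contravar; lra. }
  assert (Hpf : (0 <= INR pi / INR fx)%R).
  { apply Rmult_le_pos; [apply pos_INR | left; now apply Rinv_0_lt_compat]. }
  assert (Hn : (0 < INR n)%R) by lra.
  set (E := (INR pi / INR fx)%R) in *. set (D := (/ INR (2 ^ G))%R) in *.
  assert (Hbase : (info (f p) <= info (f p) * (1 + E + D))%R) by nra.
  destruct (cost_cases s L G fx pi Hn1 Hn2 HL Hwid Hpin Hfx Hfx0 Hpi p Hp)
    as [(Hf & -> & _ & ->)|[(_ & -> & _ & Hc)|(Hf & -> & _ & Hc)]].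
  - rewrite code_length by auto. cbn [weight]. change (nth p s 0) with (f p).
    assert (Ho0 : 0 < occ (f p)) by (apply INR_lt; exact Ho).
    assert (Hlog := log2_nat (occ (f p)) Ho0).
    assert (HLn : (INR L - 1 <= log2 (INR n))%R).
    { replace (INR L - 1)%R with (INR (L - 1)) by (rewrite minus_INR by lia; reflexivity).
      rewrite <- (log2_pow (L - 1)). apply log2_le; [apply lt_0_INR; auto | now apply le_INR]. }
    assert (Hle : Nat.log2 (occ (f p)) <= L + 3).
    { assert (Nat.log2 (occ (f p)) < L); [apply Nat.log2_lt_pow2; auto | lia].
      apply INR_le in Ho'. lia. }
    rewrite minus_INR, plus_INR by auto. cbn [INR].
    assert (Hinfo : info (f p) = (log2 (INR n) - log2 (INR (occ (f p))))%R).
    { enough (info (f p) + log2 (INR (occ (f p))) = log2 (INR n))%R by lra.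
      unfold info. rewrite <- log2_mult; [| apply Rdiv_lt_0_compat; lra | lra].
      f_equal. field. lra. }
    lra.
  - apply le_INR in Hc. cbn [INR] in Hc. lra.
  - set (d := gap s p) in *.
    assert (Hd : 0 < d) by apply (gap_bounds s p Hp).
    assert (Hdr : (0 < INR d)%R) by now apply lt_0_INR.
    pose proof (round_rel L G (Nat.log2 d + 1) ltac:(lia)) as Hr.
    fold (gap_width L G d) in Hr. set (b := gap_width L G d) in *.
    apply le_INR in Hr, Hc. rewrite plus_INR, !mult_INR in Hr.
    rewrite !plus_INR in Hc. rewrite plus_INR in Hr. cbn [INR] in Hc, Hr.
    assert (Hlog := log2_nat d Hd).
    assert (Hs : log2 (INR d) = (info (f p) + log2 (spread p))%R).
    { unfold info, spread. fold d. rewrite <- log2_mult.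
      - f_equal. field. split; lra.
      - apply Rdiv_lt_0_compat; lra.
      - apply Rdiv_lt_0_compat; nra. }
    assert (Hsp : (0 < spread p)%R).
    { unfold spread. fold d. apply Rdiv_lt_0_compat; [apply Rmult_lt_0_compat |]; lra. }
    assert (Hlin := log2_le_lin (spread p) Hsp).
    assert (Hb : (INR b <= (1 + D) * (INR (Nat.log2 d) + 1))%R).
    { unfold D. assert (HG0 : (0 < INR (2 ^ G))%R) by (apply lt_0_INR; auto).
      apply (Rmult_le_reg_l (INR (2 ^ G))); auto.
      replace (INR (2 ^ G) * ((1 + / INR (2 ^ G)) * (INR (Nat.log2 d) + 1)))%R with
        (INR (2 ^ G) * (INR (Nat.log2 d) + 1) + (INR (Nat.log2 d) + 1))%R by (field; lra).
      exact Hr. }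
    assert (Hrare : (INR fx <= info (f p))%R).
    { unfold info. rewrite <- (log2_pow fx). apply log2_le; [apply lt_0_INR; auto |].
      apply Nat.ltb_ge, le_INR in Hf. rewrite mult_INR in Hf.
      apply (Rmult_le_reg_r (INR (occ (f p)))); [lra |].
      replace (INR n / INR (occ (f p)) * INR (occ (f p)))%R with (INR n) by (field; lra).
      change (nth p s 0) with (f p) in Hf. lra. }
    assert (Hpi' : (INR pi <= E * info (f p))%R).
    { replace (INR pi) with (E * INR fx)%R by (unfold E; field; lra).
      apply Rmult_le_compat_l; auto. }
    assert (INR b <= (1 + D) * (info (f p) + 2 * spread p + 1))%R.
    { eapply Rle_trans; [exact Hb |]. apply Rmult_le_compat_l; lra. }
    nra.
Qed.

(** 11 is the constant 7 of [cost_entropy] plus 4 from [spread_sum]. *)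
Lemma bits_entropy :
  (INR (nsum (fun p => bcost (cl p)) (seq 0 n)) <=
   INR n * H0 s * (1 + INR pi / INR fx + / INR (2 ^ G)) + 11 * INR n)%R.
Proof.
  rewrite INR_nsum. eapply Rle_trans.
  - apply rsum_le. intros p Hp. apply in_seq in Hp. apply cost_entropy. lia.
  - rewrite !rsum_add, rsum_const, length_seq, rsum_mul.
    rewrite (rsum_ext _ (fun p => ((1 + INR pi / INR fx + / INR (2 ^ G)) * info (f p))%R))
      by (intros; lra).
    rewrite rsum_mul, entropy_sum. pose proof spread_sum. lra.
Qed.

End Entropy.

(** * Choice of the parameters *)

Lemma square_le_pow x : 4 <= x -> x * x <= 2 ^ x.
Proof.
  induction x as [|x IH]; intros Hx; [lia |].
  destruct (Nat.eq_dec x 3) as [->|]; [cbn; lia |].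
  specialize (IH ltac:(lia)). cbn [Nat.pow]. nia.
Qed.

Lemma log_small M : exists g0, forall g, g0 <= g -> M * (Nat.log2 g + 1) <= g.
Proof.
  exists (2 ^ (2 * M + 4)). intros g Hg.
  assert (Hg0 : 0 < g) by (pose proof (pow2_pos (2 * M + 4)); lia).
  assert (HG : 2 * M + 4 <= Nat.log2 g) by (now apply Nat.log2_le_pow2).
  pose proof (square_le_pow (Nat.log2 g) ltac:(lia)) as Hs.
  pose proof (proj1 (Nat.log2_spec g Hg0)). nia.
Qed.

Lemma lg_bounds x : 0 < x -> 2 ^ (lg x - 1) <= x < 2 ^ lg x.
Proof.
  intros Hx. unfold lg. rewrite Nat.sub_succ, Nat.sub_0_r. now apply Nat.log2_spec.
Qed.

Lemma lg_ge x k : 2 ^ k <= x -> k <= lg x.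
Proof.
  intros H. pose proof (pow2_pos k). unfold lg.
  assert (k <= Nat.log2 x) by (apply Nat.log2_le_pow2; lia). lia.
Qed.

Lemma lg_le x k : x < 2 ^ k -> 0 < x -> lg x <= k.
Proof. intros H Hx. unfold lg. apply Nat.log2_lt_pow2 in H; lia. Qed.

Lemma loglog_small M : exists N, forall n, N <= n ->
  M * (Nat.log2 (lg (lg n)) + 1) <= lg (lg n).
Proof.
  destruct (log_small M) as [g0 Hg0]. exists (2 ^ (2 ^ g0)). intros n Hn.
  apply Hg0, lg_ge, lg_ge, Hn.
Qed.

Lemma poly_small M : exists L0, forall L, L0 <= L -> M * L ^ 4 <= 2 ^ (L / 2).
Proof.
  exists (4 * (M * 2 ^ 16) + 16). intros L HL.
  (* L^4 is at most 2^16 * 2^(4x), whose second factor takes a quarter of the L bits; the constant M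
     * 2^16 fits into another quarter. *)
  set (x := L / 16).
  assert (Hx : L < 16 * (x + 1)).
  { pose proof (Nat.div_mod L 16 ltac:(lia)). pose proof (Nat.mod_upper_bound L 16 ltac:(lia)).
    fold x in H. lia. }
  pose proof (Nat.pow_gt_lin_r 2 x ltac:(lia)) as Hp.
  assert (HL4 : L ^ 4 <= (16 * 2 ^ x) ^ 4) by (apply Nat.pow_le_mono_l; lia).
  rewrite Nat.pow_mul_l, <- Nat.pow_mul_r in HL4.
  set (y := L / 4).
  assert (Hy : 4 * x <= y).
  { unfold x, y. apply Nat.div_le_lower_bound; [lia |].
    pose proof (Nat.Div0.mul_div_le L 16). lia. }
  assert (Hy2 : y + y <= L / 2).
  { unfold y. apply Nat.div_le_lower_bound; [lia |].
    pose proof (Nat.Div0.mul_div_le L 4). lia. }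
  assert (HM : M * 2 ^ 16 <= 2 ^ y).
  { assert (M * 2 ^ 16 <= y) by (apply Nat.div_le_lower_bound; lia).
    pose proof (Nat.pow_gt_lin_r 2 y ltac:(lia)). lia. }
  transitivity (2 ^ y * 2 ^ y).
  - change (16 ^ 4) with ((2 ^ 4) ^ 4) in HL4. rewrite <- Nat.pow_mul_r in HL4.
    change (4 * 4) with 16 in HL4.
    replace (x * 4) with (4 * x) in HL4 by lia.
    assert (2 ^ (4 * x) <= 2 ^ y) by (apply Nat.pow_le_mono_r; lia).
    transitivity (M * (2 ^ 16 * 2 ^ (4 * x))); [apply Nat.mul_le_mono_l; exact HL4 |].
    rewrite Nat.mul_assoc. apply Nat.mul_le_mono; auto.
  - rewrite <- Nat.pow_add_r. apply Nat.pow_le_mono_r; lia.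
Qed.

Lemma quadratic_le_pow x : 8 <= x -> (x + 1) * (2 * x + 10) <= 2 ^ x.
Proof.
  induction x as [|x IH]; intros Hx; [lia |].
  destruct (Nat.eq_dec x 7) as [->|]; [cbn; lia |].
  specialize (IH ltac:(lia)). cbn [Nat.pow]. nia.
Qed.

(** 2^kap = 256 (2^lg w)^2 exceeds the bits of a block, and w / kap relative counters fill one word.
    With [tau] about L / 2 the table has O(sqrt n) entries and a word needs at most 2c lookups. The
    group size 256 is what [structure_fits] relies on. *)
Definition param (L w : nat) : params :=
  let kap := 2 * lg w + 8 in mkParams w kap (w / kap) 256 (L / 2 + 1).

Definition freq_bits (L : nat) : nat := lg L / 2.
Definition prec (L : nat) : nat := Nat.log2 (lg L).
Definition class_bits (L : nat) : nat := 2 * prec L + 4.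
Definition depth (L : nat) : nat := freq_bits L + class_bits L + 4.

(** There are O(L^2) vectors, each with a last block of O(w^2) = O(c^2 L^2) bits; this makes c^2
    L^4, with a generous constant. *)
Definition poly_coef (c : nat) : nat := 5000 * 5000 * (c * c).

Record large (c n : nat) : Prop := {
  large_loglog : (1000 + lg c) * (prec (lg n) + 1) <= lg (lg n);
  large_poly : 4 * poly_coef c * lg n ^ 4 <= 2 ^ (lg n / 2)
}.

Lemma large_eventually c : exists N, forall n, N <= n -> large c n.
Proof.
  destruct (loglog_small (1000 + lg c)) as [N1 H1].
  destruct (poly_small (4 * poly_coef c)) as [L0 H2].
  exists (N1 + 2 ^ L0). intros n Hn. constructor.
  - apply H1. lia.
  - apply H2, lg_ge. lia.
Qed.

(** * Inequalities between the parameters for large n *)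

Section Large.
Variables (c n : nat).
Hypothesis Hlarge : large c n.
Notation L := (lg n).
Notation g := (lg (lg n)).
Notation G := (prec (lg n)).
Notation fx := (freq_bits (lg n)).
Notation pi := (class_bits (lg n)).
Notation h := (depth (lg n)).

Lemma g_large : 1000 <= g.
Proof. pose proof (large_loglog _ _ Hlarge). nia. Qed.

Lemma L_bounds : 2 ^ (g - 1) <= L < 2 ^ g.
Proof. apply lg_bounds. unfold lg at 1. lia. Qed.

Lemma L_gt_g : g < L.
Proof.
  pose proof g_large. pose proof L_bounds.
  pose proof (square_le_pow (g - 1) ltac:(lia)). nia.
Qed.

Lemma large_pos : 0 < n.
Proof.
  apply Nat.neq_0_lt_0. intros e. pose proof g_large as H. rewrite e in H.
  change (lg (lg 0)) with 1 in H. lia.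
Qed.

Lemma n_bounds : 2 ^ (L - 1) <= n < 2 ^ L.
Proof. apply lg_bounds, large_pos. Qed.

Lemma G_bounds : 2 ^ G <= g < 2 ^ S G.
Proof. apply Nat.log2_spec. pose proof g_large. lia. Qed.

Lemma fx_bounds : 2 * fx <= g <= 2 * fx + 1.
Proof.
  unfold freq_bits. pose proof (Nat.div_mod g 2 ltac:(lia)).
  pose proof (Nat.mod_upper_bound g 2 ltac:(lia)). lia.
Qed.

Lemma pi_small : 100 * pi <= g.
Proof. pose proof (large_loglog _ _ Hlarge). unfold class_bits. nia. Qed.

Lemma pow_fx : 2 ^ fx <= L.
Proof.
  pose proof L_bounds. pose proof fx_bounds. pose proof g_large.
  etransitivity; [| apply H]. apply Nat.pow_le_mono_r; lia.
Qed.

Lemma pow_pi : 2 ^ pi <= 16 * (g * g).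
Proof.
  pose proof G_bounds. unfold class_bits.
  replace (2 * G + 4) with (G + (G + 4)) by lia. rewrite !Nat.pow_add_r.
  replace (2 ^ 4) with 16 by reflexivity. nia.
Qed.

Lemma pow_pi_L : 2 ^ pi <= 32 * L.
Proof.
  pose proof pow_pi. pose proof L_bounds. pose proof g_large.
  pose proof (square_le_pow g ltac:(lia)).
  assert (2 ^ g = 2 * 2 ^ (g - 1)).
  { replace g with (S (g - 1)) at 1 by lia. reflexivity. }
  lia.
Qed.

Lemma h_small : h <= g.
Proof.
  pose proof pi_small. pose proof fx_bounds. pose proof g_large. unfold depth. lia.
Qed.

Lemma pow_h : 2 ^ h <= 512 * (L * L).
Proof.
  unfold depth. rewrite !Nat.pow_add_r. pose proof pow_fx. pose proof pow_pi_L.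
  replace (2 ^ 4) with 16 by reflexivity. nia.
Qed.

Lemma half_L : 2 ^ (L / 2) * 2 ^ (L / 2) <= 2 * n.
Proof.
  pose proof n_bounds. pose proof g_large. pose proof L_gt_g.
  rewrite <- Nat.pow_add_r.
  assert (2 ^ L = 2 * 2 ^ (L - 1)).
  { replace L with (S (L - 1)) at 1 by lia. reflexivity. }
  assert (2 ^ (L / 2 + L / 2) <= 2 ^ L).
  { apply Nat.pow_le_mono_r; [lia |]. pose proof (Nat.Div0.mul_div_le L 2). lia. }
  lia.
Qed.

Lemma poly_n k : k <= poly_coef c * L ^ 4 -> 2 * k <= n.
Proof.
  intros Hk. pose proof (large_poly _ _ Hlarge) as Hp. pose proof half_L.
  rewrite <- Nat.mul_assoc in Hp. set (X := poly_coef c * L ^ 4) in *. clearbody X.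
  pose proof (pow2_pos (L / 2)). nia.
Qed.

End Large.

Section Words.
Variables (c n w : nat).
Hypothesis Hc : 1 <= c.
Hypothesis Hlarge : large c n.
Hypothesis Hw : lg n <= w <= c * lg n.
Notation L := (lg n).
Notation g := (lg (lg n)).
Notation P := (param (lg n) w).

Lemma q_le : lg w <= g + lg c.
Proof.
  pose proof (L_gt_g c n Hlarge). apply lg_le; [|lia].
  pose proof (L_bounds n). pose proof (lg_bounds c Hc). rewrite Nat.pow_add_r. nia.
Qed.

Lemma q_ge : g <= lg w.
Proof.
  unfold lg at 1 3. apply le_n_S, Nat.log2_le_mono. lia.
Qed.

Lemma w_pos : 1000 < w.
Proof. pose proof (L_gt_g c n Hlarge). pose proof (g_large c n Hlarge). lia. Qed.

Lemma w_bounds : 2 ^ (lg w - 1) <= w < 2 ^ lg w.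
Proof. apply lg_bounds. pose proof w_pos. lia. Qed.

Lemma kap_quadratic : lg w * (2 * lg w + 8) <= w.
Proof.
  pose proof q_ge. pose proof (g_large c n Hlarge). pose proof w_bounds.
  pose proof (quadratic_le_pow (lg w - 1) ltac:(lia)) as Hq.
  replace (lg w - 1 + 1) with (lg w) in Hq by lia.
  replace (2 * (lg w - 1) + 10) with (2 * lg w + 8) in Hq by lia. lia.
Qed.

(** The lower bound on A makes the counters an O(1 / lg lg n) fraction in [structure_size]; the last
    bound gives the sharper fraction needed in [structure_fits]. *)
Lemma A_bounds : lg w <= pA P /\ pkap P * pA P <= w /\ w <= 2 * (pkap P * pA P).
Proof.
  cbn [pA pkap param]. pose proof kap_quadratic. pose proof q_ge. pose proof (g_large c n Hlarge).
  set (k := 2 * lg w + 8) in *.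
  assert (H2 : lg w <= w / k) by (apply Nat.div_le_lower_bound; lia).
  pose proof (Nat.div_mod w k ltac:(lia)). pose proof (Nat.mod_upper_bound w k ltac:(lia)).
  nia.
Qed.

Lemma kap_lt_w : pkap P < w.
Proof.
  cbn [pkap param]. pose proof kap_quadratic. pose proof q_ge. pose proof (g_large c n Hlarge). nia.
Qed.

Lemma bw_lt : bw P < 2 ^ pkap P.
Proof.
  unfold bw, gw. destruct A_bounds as (_ & H & _). cbn [pgam pw pkap] in *.
  change (pkap P) with (2 * lg w + 8) in *. change (pw P) with w. change (pgam P) with 256.
  pose proof w_bounds. pose proof w_pos.
  replace (2 * lg w + 8) with (lg w + (lg w + 8)) by lia. rewrite !Nat.pow_add_r.
  replace (2 ^ 8) with 256 by reflexivity.
  assert (8 * pA P <= w) by nia. set (q := 2 ^ lg w) in *. nia.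
Qed.

Lemma bw_w2 : bw P <= 2 ^ 10 * (w * w).
Proof.
  unfold bw, gw. destruct A_bounds as (_ & H & _).
  change (pkap P) with (2 * lg w + 8) in *. change (pw P) with w. change (pgam P) with 256.
  assert (pA P <= w) by nia. replace (2 ^ 10) with 1024 by reflexivity. nia.
Qed.

Lemma sb_le_bw : 2 * sb P <= bw P.
Proof.
  unfold sb, bw, gw. destruct A_bounds as (H & _ & _). pose proof w_pos. pose proof q_ge.
  pose proof (g_large c n Hlarge). change (pw P) with w. change (pgam P) with 256. nia.
Qed.

End Words.

(** * The theorem *)

Section Structure.
Variables (s : list nat) (w : nat).
Notation n := (# s).
Notation L := (lg (# s)).
Notation g := (lg (lg (# s))).
Notation G := (prec (lg (# s))).
Notation fx := (freq_bits (lg (# s))).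
Notation pi := (class_bits (lg (# s))).
Notation h := (depth (lg (# s))).
Notation P := (param (lg (# s)) w).

Definition str_classes : list cls := classes s L G fx.
Definition str_code : cls -> list bool := code s L G fx pi.
Definition str_pcode : nat -> list bool := pcode s (frequent s fx) (gap_width L G) str_code.
Definition str_descs : list desc := descs w str_classes str_code.
Definition str_prev : nat -> nat := prev (fun k => nth k s 0).
Definition structure : list nat := data P n str_pcode str_prev h str_descs.
Definition str_vectors : list (list bool) := vectors n str_pcode str_prev h str_descs.

Variable c : nat.
Hypothesis Hc : 1 <= c.
Hypothesis Hlarge : large c n.
Hypothesis Hw : L <= w <= c * L.

Lemma base_facts :
  2 ^ (L - 1) <= n /\ n < 2 ^ L /\ 0 < L /\ # (widths L G) <= 2 ^ pi /\
  2 ^ pi <= n /\ fx < L /\ 0 < fx /\ pi < L.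
Proof.
  pose proof (n_bounds c n Hlarge). pose proof (g_large c n Hlarge).
  pose proof (L_gt_g c n Hlarge). pose proof (fx_bounds n).
  pose proof (pi_small c n Hlarge).
  pose proof (L_bounds n). pose proof (G_bounds c n Hlarge).
  assert (# (widths L G) <= 2 ^ pi) by (apply (widths_length L G g); lia).
  assert (2 ^ pi <= 2 ^ (L - 1)) by (apply Nat.pow_le_mono_r; lia).
  repeat split; lia.
Qed.

Lemma n_lt_w : n < 2 ^ w.
Proof.
  pose proof (n_bounds c n Hlarge).
  assert (2 ^ L <= 2 ^ w) by (apply Nat.pow_le_mono_r; lia). lia.
Qed.

Lemma str_classes_all p : p < n -> In (cls_of s (frequent s fx) (gap_width L G) p) str_classes.
Proof. destruct base_facts as (F1 & F2 & F3 & F4 & F5 & F6 & F7 & F8). now apply (classes_all s L G fx pi). Qed.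

Lemma str_code_free k k' : In k str_classes -> In k' str_classes ->
  (exists z, str_code k = str_code k' ++ z) -> k = k'.
Proof. destruct base_facts as (F1 & F2 & F3 & F4 & F5 & F6 & F7 & F8). now apply (code_prefix_free s L G fx pi). Qed.

Lemma str_descs_ok d : In d str_descs ->
  dkind d <= 2 /\ dbits d < 2 ^ w /\ # (dcode d) <= h /\ unambiguous n str_pcode (dcode d).
Proof.
  destruct base_facts as (F1 & F2 & F3 & F4 & F5 & F6 & F7 & F8).
  intros Hd. apply in_map_iff in Hd as (k & <- & Hk). cbn [dkind dbits dcode].
  repeat split.
  - destruct k; cbn; lia.
  - assert (Hww := Nat.pow_gt_lin_r 2 w ltac:(lia)).
    destruct k as [a| |b]; cbn [width]; auto.
    apply in_app_or in Hk as [Hk|[Hk|Hk]].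
    + apply in_map_iff in Hk as (? & ? & _). discriminate.
    + discriminate.
    + apply in_map_iff in Hk as (b' & [= <-] & Hb). apply nodup_In, in_map_iff in Hb as (y & <- & _).
      pose proof (round_le L G y). lia.
  - apply (code_bound s L G fx pi); auto.
  - apply pcode_unambiguous with (CL := str_classes);
      [exact str_classes_all | exact str_code_free | exact Hk].
Qed.

Lemma str_descs_length : # str_descs <= 2 ^ fx + 1 + 2 ^ pi.
Proof.
  destruct base_facts as (F1 & F2 & F3 & F4 & F5 & F6 & F7 & F8).
  unfold str_descs, descs, str_classes, classes.
  rewrite length_map, length_app. cbn [length]. rewrite !length_map.
  pose proof (frequent_count s L G fx pi). lia.
Qed.

Lemma str_stream_len : stream_len str_descs <= (2 ^ fx + 1 + 2 ^ pi) * (2 * h + 2 * L + 5).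
Proof.
  etransitivity; [| apply Nat.mul_le_mono_r, str_descs_length].
  rewrite Nat.mul_comm, <- nsum_const. unfold stream_len. apply nsum_le. intros d Hd.
  destruct (str_descs_ok d Hd) as (_ & _ & Hl & _). unfold class_len.
  destruct (Nat.eqb_spec (dkind d) 2) as [e|]; [|lia].
  enough (dbits d <= L) by lia.
  apply in_map_iff in Hd as (k & <- & Hk). cbn [dbits dkind] in *.
  destruct k as [a| |b]; cbn [kind width] in *; try discriminate.
  apply in_app_or in Hk as [Hk|[Hk|Hk]].
  - apply in_map_iff in Hk as (? & ? & _). discriminate.
  - discriminate.
  - apply in_map_iff in Hk as (b' & [= <-] & Hb). apply nodup_In, in_map_iff in Hb as (y & <- & _).
    apply round_le.
Qed.

Lemma str_vectors_length : # str_vectors <= 2 ^ h + 2 ^ pi * (L + 1).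
Proof.
  destruct base_facts as (? & ? & ? & Hwid & ? & ? & ? & ?).
  unfold str_vectors, vectors. rewrite length_app, node_vectors_length.
  enough (# (flat_map (payload n str_pcode str_prev) str_descs) <= 2 ^ pi * (L + 1)) by lia.
  etransitivity; [| apply Nat.mul_le_mono_r, Hwid].
  unfold str_descs, descs, str_classes, classes.
  rewrite map_app, flat_map_app, length_app. cbn [map flat_map]. unfold payload at 2. cbn [kind dkind Nat.eqb app].
  assert (E : forall l, flat_map (payload n str_pcode str_prev)
     (map (fun k => mkDesc (kind k) (width w k) (str_code k)) (map Freq l)) = []).
  { induction l; cbn; auto. }
  rewrite E. cbn [length Nat.add].
  assert (Hb : forall b, In b (widths L G) -> b <= L).
  { intros b Hb. apply nodup_In, in_map_iff in Hb as (y & <- & _). apply round_le. }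
  clear Hwid E. induction (widths L G) as [|b l IH]; [cbn; lia |].
  cbn [map flat_map]. rewrite length_app. unfold payload at 1.
  cbn [kind dkind Nat.eqb width dbits]. rewrite matrix_vectors_length.
  specialize (IH (fun b' Hb' => Hb b' (or_intror Hb'))). specialize (Hb b (or_introl eq_refl)).
  cbn [length]. lia.
Qed.

Notation bcost := (bit_cost str_code).
Notation cl := (cls_of s (frequent s fx) (gap_width L G)).

Definition bits_total : nat := nsum (fun p => bcost (cl p)) (seq 0 n).

Lemma str_vectors_total : total str_vectors <= bits_total.
Proof.
  apply (vectors_total s (frequent s fx) (gap_width L G) w str_classes str_code);
    [apply classes_nodup | exact str_classes_all | exact str_code_free | exact n_lt_w].
Qed.

(** Only these blocks are charged to the stored bits; the additional last block of each vector goes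
    to [overhead]. *)
Definition full_blocks : nat := nsum (fun V => # V / bw P) str_vectors.

Definition overhead : nat :=
  12 + 2 ^ ptau P + # str_vectors * sb P + stream_len str_descs.

Lemma structure_length : # structure = full_blocks * sb P + overhead.
Proof.
  unfold structure, overhead. rewrite data_length by exact str_descs_ok.
  rewrite vector_words_length. fold str_vectors.
  assert (E : nsum (vsize P) str_vectors = full_blocks * sb P + # str_vectors * sb P).
  { unfold full_blocks. induction str_vectors as [|V VS IH]; [reflexivity |].
    rewrite !nsum_cons, IH. unfold vsize, nblocks. cbn [length]. lia. }
  rewrite E. lia.
Qed.

Lemma full_blocks_bits : full_blocks * bw P <= bits_total.
Proof.
  etransitivity; [| apply str_vectors_total]. unfold full_blocks.
  rewrite Nat.mul_comm, <- nsum_mul. unfold total. apply nsum_le.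
  intros V _. apply Nat.Div0.mul_div_le.
Qed.

Lemma overhead_small : 2 * (overhead * w) <= n.
Proof.
  pose proof (L_gt_g c n Hlarge) as HLg. pose proof (g_large c n Hlarge) as Hg.
  pose proof (half_L c n Hlarge) as HL2.
  pose proof (large_poly _ _ Hlarge) as HP.
  assert (HL4 : L ^ 4 = L * L * (L * L)) by (cbn [Nat.pow]; lia).
  assert (Htau : 8 * (2 ^ ptau P * w) <= n).
  { cbn [ptau param]. rewrite Nat.add_1_r. cbn [Nat.pow].
    set (X := 2 ^ (L / 2)) in *.
    assert (HX : 32 * w <= X).
    { etransitivity; [| exact HP]. rewrite HL4. unfold poly_coef.
      assert (c <= c * c) by nia. assert (L <= L * L) by nia.
      assert (L <= L * L * (L * L)) by (set (l := L * L) in *; nia).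
      set (y := L * L * (L * L)) in *. set (d := c * c) in *.
      assert (c * L <= d * y) by (apply Nat.mul_le_mono; auto). lia. }
    apply (Nat.mul_le_mono_l _ _ X) in HX. lia. }
  enough (Hrest : 2 * (4 * ((12 + # str_vectors * sb P + stream_len str_descs) * w)) <= n).
  { unfold overhead. set (a := 2 ^ ptau P) in *. clearbody a. lia. }
  apply (poly_n c n Hlarge). rewrite HL4. unfold poly_coef.
  pose proof (pow_h c n Hlarge) as Hh. pose proof (pow_pi_L c n Hlarge) as Hpi.
  pose proof (pow_fx c n Hlarge) as Hfx. pose proof (h_small c n Hlarge) as Hhs.
  assert (Hnv : # str_vectors <= 576 * (L * L)).
  { etransitivity; [apply str_vectors_length |].
    assert (2 ^ pi * (L + 1) <= 32 * L * (L + 1)) by (apply Nat.mul_le_mono_r; auto). nia. }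
  assert (Hsl : stream_len str_descs <= 34 * L * (5 * L)).
  { etransitivity; [apply str_stream_len |]. apply Nat.mul_le_mono; lia. }
  assert (Hsb : sb P * w <= 2048 * (w * w)).
  { pose proof (bw_w2 c n w Hc Hlarge Hw) as Hb2.
    replace (2 ^ 10) with 1024 in Hb2 by reflexivity.
    assert (E : sb P * w = bw P + 2 * w).
    { unfold sb, bw, gw. change (pgam P) with 256. change (pw P) with w. lia. }
    rewrite E. nia. }
  assert (Hww : w * w <= c * c * (L * L)).
  { replace (c * c * (L * L)) with (c * L * (c * L)) by lia. apply Nat.mul_le_mono; lia. }
  assert (Hww0 : w <= w * w) by nia.
  assert (HL1 : L <= L * L) by nia.
  set (l := L * L) in *. set (d := c * c) in *. set (v := w * w) in *.
  assert (H1 : # str_vectors * (sb P * w) <= 576 * l * (2048 * (d * l))).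
  { apply Nat.mul_le_mono; [auto |]. lia. }
  assert (H2 : stream_len str_descs * w <= 170 * l * (d * l)).
  { apply Nat.mul_le_mono; lia. }
  assert (H3 : w <= d * l) by lia.
  assert (H4 : d * l <= l * (d * l)) by nia.
  set (z := d * l) in *. replace (d * (l * l)) with (l * z) by (unfold z; lia).
  rewrite !Nat.mul_add_distr_r, <- (Nat.mul_assoc (# str_vectors)).
  replace (5000 * 5000 * d * (l * l)) with (5000 * (5000 * (l * z))) by (unfold z; lia).
  lia.
Qed.

(** Since n < 2^w, this makes every stored word addressable, whatever the entropy. The saving of
    [bits_worst] has to outweigh the class codes, the counters and the overhead. *)
Lemma structure_fits : # structure < n.
Proof.
  destruct base_facts as (F1 & F2 & F3 & F4 & F5 & F6 & F7 & F8).
  pose proof (L_gt_g c n Hlarge) as HLg. pose proof (g_large c n Hlarge) as Hg.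
  pose proof (fx_bounds n) as Hfx.
  pose proof (pi_small c n Hlarge) as Hpi.
  pose proof (pow_fx c n Hlarge) as Hpfx.
  destruct (A_bounds c n w Hc Hlarge Hw) as (HA1 & HA2 & HA3).
  pose proof (q_le c n w Hc Hlarge Hw) as Hq.
  pose proof (large_loglog _ _ Hlarge) as Hll.
  assert (HT : 2 * bits_total + n * fx <= n * (2 * L + 2 * pi + 12)).
  { apply bits_worst; auto; lia. }
  pose proof full_blocks_bits as HQ. pose proof overhead_small as HO.
  rewrite structure_length.
  set (Q := full_blocks) in *. set (TB := bits_total) in *.
  assert (Ebw : bw P = 256 * (pA P * w)) by (unfold bw, gw; change (pgam P) with 256; change (pw P) with w; lia).
  assert (Esb : sb P * w = bw P + 2 * w) by (unfold sb, bw, gw; change (pgam P) with 256; change (pw P) with w; lia).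
  set (k := pkap P) in *. assert (Ek : k = 2 * lg w + 8) by reflexivity.
  set (a := pA P) in *.
  assert (HTB : TB <= n * (2 * w)).
  { assert (n * (2 * L + 2 * pi + 12) <= n * (4 * w)) by (apply Nat.mul_le_mono_l; lia). lia. }
  (* A full block has two counter words against 256 a data words, where a is at least w / (2k), and
     the data amounts to at most 2 n w bits. *)
  assert (HQw : 64 * (Q * w) <= n * k).
  { apply (Nat.mul_le_mono_pos_r _ _ w ltac:(lia)).
    assert (Q * w * w <= Q * w * (2 * (k * a))) by (apply Nat.mul_le_mono_l; auto).
    assert (Q * w * (2 * (k * a)) * 128 = Q * bw P * k) by (rewrite Ebw; lia).
    assert (Q * bw P * k <= TB * k) by (apply Nat.mul_le_mono_r; auto).
    assert (TB * k <= n * (2 * w) * k) by (apply Nat.mul_le_mono_r; auto).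
    lia. }
  (* Both sides are linear in g: k is at most 2 g + 2 lg c + 8, while 16 fx is at least 8 g - 8 and
     [pi] is at most g / 100. *)
  assert (Hkey : 16 * (2 * pi + 12) + k + 64 <= 16 * fx).
  { assert (2 * lg c <= 2 * g) by lia. nia. }
  apply (Nat.mul_lt_mono_pos_r (2 * w)); [lia |].
  assert (E1 : (Q * sb P + overhead) * (2 * w) = 2 * (Q * bw P) + 4 * (Q * w) + 2 * (overhead * w)).
  { transitivity (2 * (Q * (sb P * w)) + 2 * (overhead * w)); [lia |]. rewrite Esb. lia. }
  rewrite E1.
  assert (E2 : n * (16 * (2 * pi + 12) + k + 64) <= n * (16 * fx)) by (apply Nat.mul_le_mono_l; auto).
  assert (E3 : n * L <= n * w) by (apply Nat.mul_le_mono_l; lia).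
  pose proof (pow2_pos pi).
  lia.
Qed.

Lemma param_facts :
  0 < pw P /\ pkap P < pw P /\ pkap P * pA P <= pw P /\ pA P * gw P < 2 ^ pkap P /\
  0 < pgam P /\ 0 < pA P /\ 0 < ptau P /\ ptau P < pw P /\ pw P <= ptau P * (2 * c) /\
  # structure < 2 ^ pw P /\ n < 2 ^ pw P /\ bw P < 2 ^ pw P /\ sb P < 2 ^ pw P.
Proof.
  pose proof (g_large c n Hlarge) as Hg. pose proof (L_gt_g c n Hlarge) as HLg.
  destruct (A_bounds c n w Hc Hlarge Hw) as (HA1 & HA2 & HA3).
  pose proof (q_ge c n w Hc Hw). pose proof (kap_lt_w c n w Hc Hlarge Hw) as Hk.
  pose proof (bw_lt c n w Hc Hlarge Hw) as Hb. pose proof (sb_le_bw c n w Hc Hlarge Hw).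
  assert (2 ^ pkap P < 2 ^ w) by (apply Nat.pow_lt_mono_r; lia).
  pose proof n_lt_w. pose proof structure_fits.
  pose proof (Nat.div_mod L 2 ltac:(lia)). pose proof (Nat.mod_upper_bound L 2 ltac:(lia)).
  assert (Hcw : w <= (L / 2 + 1) * (2 * c)).
  { transitivity (c * L); [lia |].
    replace ((L / 2 + 1) * (2 * c)) with (c * (2 * (L / 2) + 2)) by lia.
    apply Nat.mul_le_mono_l. lia. }
  change (pA P * gw P) with (bw P).
  change (pw P) with w. change (pgam P) with 256. change (ptau P) with (L / 2 + 1).
  split; [lia |]. split; [lia |]. split; [lia |]. split; [lia |]. split; [lia |].
  split; [lia |]. split; [lia |]. split; [lia |]. split; [exact Hcw |].
  split; [lia |]. split; [lia |]. split; lia.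
Qed.

Lemma structure_bound : Forall (fun x => x < 2 ^ w) structure.
Proof.
  destruct param_facts as (? & ? & ? & ? & ? & ? & ? & ? & ? & ? & ? & ? & ?).
  apply (data_bound P n str_pcode str_prev h str_descs (2 * c)); auto.
  - exact str_descs_ok.
  - apply population_descs;
      [apply classes_nodup | exact str_classes_all | exact str_code_free | exact n_lt_w].
Qed.

Lemma structure_query i j : 1 <= i <= j -> j <= n ->
  exists T st, T <= 24 + stream_time P (2 * c) str_descs /\
    run w prog T (init_state structure i j) = Some st /\
    reg st 0 = count_distinct s i j.
Proof.
  intros Hij Hj.
  destruct param_facts as (? & ? & ? & ? & ? & ? & ? & ? & ? & ? & ? & ? & ?).
  destruct (query_ok P n str_pcode str_prev h str_descs (2 * c)) with (i := i) (j := j)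
    as (T & st & HT & Hrun & Hreg); auto.
  - exact str_descs_ok.
  - apply population_descs;
      [apply classes_nodup | exact str_classes_all | exact str_code_free | exact n_lt_w].
  - exists T, st. split; [auto | split; [exact Hrun |]]. rewrite Hreg.
    destruct base_facts as (F1 & F2 & F3 & F4 & F5 & F6 & F7 & F8).
    apply (descs_correct s (frequent s fx) (gap_width L G) w str_classes str_code); auto.
    + apply classes_nodup.
    + exact str_classes_all.
    + exact str_code_free.
    + apply (gap_width_ok s L G fx pi); auto.
Qed.

(** At most 2^fx + 1 <= 2 L classes have no matrix and cost O(g) ranks each; the at most 2^pi =
    O(g^2) gap classes cost O(L) ranks each and dominate. *)
Lemma query_time :
  24 + stream_time P (2 * c) str_descs <= 1300 * loop_time 256 (2 * c) * (L * (g * g)).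
Proof.
  destruct base_facts as (? & ? & ? & Hwid & ? & ? & ? & ?).
  pose proof (g_large c n Hlarge) as Hg. pose proof (L_gt_g c n Hlarge) as HLg.
  pose proof (pow_fx c n Hlarge) as Hpfx.
  pose proof (pow_pi c n Hlarge) as Hpi. pose proof (h_small c n Hlarge) as Hh.
  set (Lam := loop_time 256 (2 * c)).
  assert (HLam : step_time 256 (2 * c) <= Lam /\ 50 <= Lam).
  { unfold Lam, loop_time, step_time, rank_time. lia. }
  assert (Hcost : forall kd l b,
    class_time 256 (2 * c) kd l b + 3 <= (l + 2 * (if kd =? 2 then b else 0) + 5) * Lam).
  { intros kd l b. unfold class_time, gap_time, half_time. fold Lam.
    set (b' := if kd =? 2 then b else 0). nia. }
  assert (Hsum : stream_time P (2 * c) str_descs <=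
    (2 ^ fx + 1) * ((h + 5) * Lam) + 2 ^ pi * ((h + 2 * L + 5) * Lam) + 1).
  { unfold stream_time. apply Nat.add_le_mono_r.
    change (pgam P) with 256. unfold str_descs, descs. rewrite nsum_map. cbn [dkind dcode dbits].
    unfold str_classes, classes. rewrite nsum_app, nsum_cons.
    assert (Hcb : forall k, In k str_classes -> # (str_code k) <= h)
      by (intros k Hk; apply (code_bound s L G fx pi); auto).
    assert (B1 : nsum (fun k => class_time 256 (2 * c) (kind k) (# (str_code k)) (width w k) + 3)
      (map Freq (filter (frequent s fx) (nodup Nat.eq_dec s))) <= 2 ^ fx * ((h + 5) * Lam)).
    { transitivity (nsum (fun _ => (h + 5) * Lam)
        (map Freq (filter (frequent s fx) (nodup Nat.eq_dec s)))).
      - apply nsum_le. intros k Hk.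
        assert (Hk' : # (str_code k) <= h) by (apply Hcb, in_or_app; auto).
        apply in_map_iff in Hk as (a & <- & _). etransitivity; [apply Hcost |].
        cbn [kind Nat.eqb]. apply Nat.mul_le_mono_r. lia.
      - rewrite nsum_const, length_map, Nat.mul_comm. apply Nat.mul_le_mono_r.
        apply (frequent_count s L G fx pi); auto. }
    assert (B2 : class_time 256 (2 * c) (kind First) (# (str_code First)) (width w First) + 3 <=
      (h + 5) * Lam).
    { etransitivity; [apply Hcost |]. cbn [kind Nat.eqb]. apply Nat.mul_le_mono_r.
      assert (# (str_code First) <= h); [|lia]. apply Hcb, in_or_app. right. cbn. auto. }
    assert (B3 : nsum (fun k => class_time 256 (2 * c) (kind k) (# (str_code k)) (width w k) + 3)
      (map Gap (widths L G)) <= 2 ^ pi * ((h + 2 * L + 5) * Lam)).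
    { transitivity (nsum (fun _ => (h + 2 * L + 5) * Lam) (map Gap (widths L G))).
      - apply nsum_le. intros k Hk.
        assert (Hk' : # (str_code k) <= h) by (apply Hcb, in_or_app; right; right; auto).
        apply in_map_iff in Hk as (b & <- & Hb). etransitivity; [apply Hcost |].
        cbn [kind Nat.eqb width]. apply Nat.mul_le_mono_r.
        apply nodup_In, in_map_iff in Hb as (y & <- & _). pose proof (round_le L G y). lia.
      - rewrite nsum_const, length_map, Nat.mul_comm. apply Nat.mul_le_mono_r. auto. }
    lia. }
  assert (T1 : (2 ^ fx + 1) * ((h + 5) * Lam) <= 2 * L * (2 * g * Lam)).
  { apply Nat.mul_le_mono; [lia |]. apply Nat.mul_le_mono_r. lia. }
  assert (T2 : 2 ^ pi * ((h + 2 * L + 5) * Lam) <= 16 * (g * g) * (4 * L * Lam)).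
  { apply Nat.mul_le_mono; [lia |]. apply Nat.mul_le_mono_r. lia. }
  assert (T3 : L * g * Lam <= L * (g * g) * Lam).
  { apply Nat.mul_le_mono_r, Nat.mul_le_mono_l.
    rewrite <- (Nat.mul_1_l g) at 1. apply Nat.mul_le_mono_r. lia. }
  assert (T4 : 1 * (1 * 1) <= L * (g * g)).
  { apply Nat.mul_le_mono; [lia |]. apply Nat.mul_le_mono; lia. }
  set (X := L * (g * g)) in *.
  apply (Nat.mul_le_mono_r _ _ Lam) in T4.
  assert (E2 : 16 * (g * g) * (4 * L * Lam) = 64 * (X * Lam)) by (unfold X; lia).
  rewrite E2 in T2.
  replace (1300 * Lam * X) with (1300 * (X * Lam)) by lia.
  replace (2 * L * (2 * g * Lam)) with (4 * (L * g * Lam)) in T1 by lia. lia.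
Qed.

(** The three sources of redundancy: class codes of rare positions, rounding of the widths, and, in
    the second factor, the rank counters. *)
Definition slack (m : nat) : R :=
  ((1 + INR (class_bits (lg m)) / INR (freq_bits (lg m)) + / INR (2 ^ prec (lg m))) *
   (1 + / INR (lg (lg m))) - 1)%R.

Lemma structure_size :
  (INR (# structure * w) <= INR n * H0 s + 23 * INR n + slack n * (INR n * H0 s))%R.
Proof.
  destruct base_facts as (F1 & F2 & F3 & F4 & F5 & F6 & F7 & F8).
  pose proof (g_large c n Hlarge) as Hg.
  destruct (A_bounds c n w Hc Hlarge Hw) as (HA & _ & _).
  pose proof (q_ge c n w Hc Hw) as Hq.
  pose proof full_blocks_bits as HQ. pose proof overhead_small as HO.
  assert (HE : (INR bits_total <= INR n * H0 s * (1 + INR pi / INR fx + / INR (2 ^ G)) + 11 * INR n)%R)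
    by (apply bits_entropy; auto).
  assert (Ebw : bw P = 256 * (pA P * w)) by (unfold bw, gw; change (pgam P) with 256; change (pw P) with w; lia).
  assert (Esb : sb P * w = bw P + 2 * w) by (unfold sb, bw, gw; change (pgam P) with 256; change (pw P) with w; lia).
  (* The counters are at most 1 / g of the full blocks because A >= lg w >= g. Multiplying by g
     keeps the inequality in the integers. *)
  assert (HD : # structure * w * g <= bits_total * (g + 1) + n * g).
  { rewrite structure_length.
    transitivity ((full_blocks * bw P + 2 * (full_blocks * w) + overhead * w) * g).
    - apply Nat.mul_le_mono_r.
      rewrite Nat.mul_add_distr_r, <- Nat.mul_assoc, Esb. lia.
    - assert (full_blocks * w * (2 * g) <= full_blocks * bw P).
      { rewrite Ebw, <- Nat.mul_assoc. apply Nat.mul_le_mono_l. nia. }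
      assert (full_blocks * bw P * g <= bits_total * g) by (apply Nat.mul_le_mono_r; auto).
      assert (overhead * w * g <= n * g) by (apply Nat.mul_le_mono_r; lia).
      lia. }
  apply le_INR in HD. rewrite plus_INR, !(mult_INR _ g), (mult_INR bits_total), plus_INR in HD.
  cbn [INR] in HD.
  assert (Hgr : (1 <= INR g)%R) by (change 1%R with (INR 1); apply le_INR; lia).
  assert (Hnr : (0 <= INR n)%R) by apply pos_INR.
  assert (HD' : (INR (# structure * w) <= INR bits_total * (1 + / INR g) + INR n)%R).
  { apply (Rmult_le_reg_r (INR g)); [lra |].
    replace ((INR bits_total * (1 + / INR g) + INR n) * INR g)%R with
      (INR bits_total * (INR g + 1) + INR n * INR g)%R by (field; lra). exact HD. }
  assert (Hinv : (0 < / INR g <= 1)%R).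
  { split; [apply Rinv_0_lt_compat; lra |]. rewrite <- Rinv_1. apply Rinv_le_contravar; lra. }
  unfold slack. set (E := (1 + INR pi / INR fx + / INR (2 ^ G))%R) in *.
  set (B := (INR n * H0 s)%R) in *. set (y := (/ INR g)%R) in *.
  (* As y is at most 1, the linear term is at most 2 * 11 + 1 = 23 times n. *)
  assert (INR bits_total * (1 + y) <= (B * E + 11 * INR n) * (1 + y))%R
    by (apply Rmult_le_compat_r; lra).
  nra.
Qed.

End Structure.

Lemma slack_vanishes delta : (0 < delta)%R ->
  exists N, forall n, N <= n -> (Rabs (slack n) <= delta)%R.
Proof.
  (* With u = 1 / M <= 1, the three terms of [slack] are at most 16 u, 2 u and u, and (1 + 18 u) (1
     + u) - 1 <= 37 u. *)
  intros Hd. destruct (INR_unbounded (37 / delta)) as [M HM].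
  destruct (loglog_small (M + 4)) as [N HN]. exists N. intros n Hn.
  specialize (HN n Hn). unfold slack.
  fold (prec (lg n)) in HN.
  set (g := lg (lg n)) in *. set (G := prec (lg n)) in *.
  assert (HG0 : 0 < g) by (unfold g, lg at 1; lia).
  assert (HG : g < 2 ^ S G) by (apply Nat.log2_spec; auto).
  assert (Hfx : g <= 4 * freq_bits (lg n)).
  { unfold freq_bits. fold g. pose proof (Nat.div_mod g 2 ltac:(lia)).
    pose proof (Nat.mod_upper_bound g 2 ltac:(lia)). lia. }
  assert (Hpi : class_bits (lg n) <= 4 * (G + 1)) by (unfold class_bits; fold G; lia).
  set (fx := freq_bits (lg n)) in *. set (p := class_bits (lg n)) in *.
  assert (HMr : (0 < INR M)%R).
  { eapply Rlt_trans; [| exact HM]. apply Rdiv_lt_0_compat; lra. }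
  assert (Hgr : (0 < INR g)%R) by now apply lt_0_INR.
  assert (Hfr : (0 < INR fx)%R) by (apply lt_0_INR; lia).
  assert (Hpr : (0 <= INR p)%R) by apply pos_INR.
  assert (HMG : M * (G + 1) <= g) by nia.
  assert (B1 : (INR p / INR fx <= 16 / INR M)%R).
  { assert (Hx : p * M <= 16 * fx) by nia.
    apply le_INR in Hx. rewrite !mult_INR in Hx.
    replace (INR 16) with 16%R in Hx by (cbn; lra).
    apply (Rmult_le_reg_r (INR fx * INR M)); [nra |].
    replace (INR p / INR fx * (INR fx * INR M))%R with (INR p * INR M)%R by (field; lra).
    replace (16 / INR M * (INR fx * INR M))%R with (16 * INR fx)%R by (field; lra). exact Hx. }
  assert (B2 : (/ INR (2 ^ G) <= 2 / INR M)%R).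
  { assert (Hx : M <= 2 * 2 ^ G) by (cbn [Nat.pow] in HG; nia).
    apply le_INR in Hx. rewrite mult_INR in Hx. replace (INR 2) with 2%R in Hx by (cbn; lra).
    assert (0 < INR (2 ^ G))%R by (apply lt_0_INR; auto).
    apply (Rmult_le_reg_r (INR (2 ^ G) * INR M)); [nra |].
    replace (/ INR (2 ^ G) * (INR (2 ^ G) * INR M))%R with (INR M) by (field; lra).
    replace (2 / INR M * (INR (2 ^ G) * INR M))%R with (2 * INR (2 ^ G))%R by (field; lra).
    exact Hx. }
  assert (B3 : (/ INR g <= 1 / INR M)%R).
  { assert (Hx : M <= g) by nia. apply le_INR in Hx. unfold Rdiv. rewrite Rmult_1_l.
    apply Rinv_le_contravar; auto. }
  assert (HM1 : (1 / INR M <= 1)%R).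
  { assert (H : 1 <= M) by exact (INR_lt 0 M HMr). apply le_INR in H. cbn in H.
    apply (Rmult_le_reg_r (INR M)); [lra |]. unfold Rdiv. rewrite Rmult_assoc, Rinv_l; lra. }
  assert (P1 : (0 <= INR p / INR fx)%R) by (apply Rmult_le_pos; [lra | left; now apply Rinv_0_lt_compat]).
  assert (P2 : (0 < / INR (2 ^ G))%R) by (apply Rinv_0_lt_compat, lt_0_INR; auto).
  assert (P3 : (0 < / INR g)%R) by now apply Rinv_0_lt_compat.
  assert (Hfin : (37 * (1 / INR M) <= delta)%R).
  { apply (Rmult_le_reg_r (INR M)); [lra |].
    replace (37 * (1 / INR M) * INR M)%R with 37%R by (field; lra).
    apply (Rmult_lt_compat_r delta) in HM; [|lra].
    replace (37 / delta * delta)%R with 37%R in HM by (field; lra). lra. }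
  set (a := (INR p / INR fx)%R) in *. set (b := (/ INR (2 ^ G))%R) in *.
  set (y := (/ INR g)%R) in *. set (u := (1 / INR M)%R) in *.
  replace (16 / INR M)%R with (16 * u)%R in B1 by (unfold u; field; lra).
  replace (2 / INR M)%R with (2 * u)%R in B2 by (unfold u; field; lra).
  rewrite Rabs_pos_eq by nra. nra.
Qed.

(** Replacing [lg] by the real logarithm costs at most a factor 2 in each of the three factors,
    hence 8. *)
Lemma time_real n : 4 <= lg (lg n) ->
  (INR (lg n * (lg (lg n) * lg (lg n))) <=
   8 * (log2 (INR n) * log2 (log2 (INR n)) ^ 2))%R.
Proof.
  intros Hg. set (L := lg n) in *. set (g := lg L) in *.
  assert (Hn : 0 < n).
  { apply Nat.neq_0_lt_0. intros e. unfold g, L in Hg. rewrite e in Hg.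
    change (lg (lg 0)) with 1 in Hg. lia. }
  destruct (lg_bounds n Hn) as [H1 _]. fold L in H1.
  assert (HL0 : 0 < L) by (unfold L, lg; lia).
  destruct (lg_bounds L HL0) as [H2 _]. fold g in H2.
  assert (HL8 : 8 <= L).
  { etransitivity; [| exact H2]. change 8 with (2 ^ 3). apply Nat.pow_le_mono_r; lia. }
  assert (R1 : (INR (L - 1) <= log2 (INR n))%R).
  { rewrite <- (log2_pow (L - 1)). apply log2_le; [apply lt_0_INR; auto | now apply le_INR]. }
  assert (H3 : 2 ^ (g - 2) <= L - 1).
  { replace (g - 1) with (S (g - 2)) in H2 by lia. cbn [Nat.pow] in H2. lia. }
  assert (R2 : (INR (g - 2) <= log2 (log2 (INR n)))%R).
  { rewrite <- (log2_pow (g - 2)). apply log2_le; [apply lt_0_INR; auto |].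
    eapply Rle_trans; [apply le_INR, H3 | exact R1]. }
  assert (R1' : (INR L <= 2 * log2 (INR n))%R).
  { rewrite minus_INR in R1 by lia. apply le_INR in HL8. cbn [INR] in *. lra. }
  assert (R2' : (INR g <= 2 * log2 (log2 (INR n)))%R).
  { rewrite minus_INR in R2 by lia. apply le_INR in Hg. cbn [INR] in *. lra. }
  rewrite !mult_INR. pose proof (pos_INR L). pose proof (pos_INR g).
  set (a := log2 (INR n)) in *. set (b := log2 a) in *.
  assert (INR g * INR g <= 4 * (b * b))%R by nra.
  assert (0 <= INR g * INR g)%R by nra.
  replace (8 * (a * b ^ 2))%R with (2 * a * (4 * (b * b)))%R by ring.
  apply Rmult_le_compat; auto.
Qed.

Open Scope R_scope.

Theorem theorem2 :
  forall c : nat, (1 <= c)%nat ->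
  exists (prog : list instr) (build : nat -> list nat -> list nat)
         (K : R) (eps : nat -> R) (N0 : nat),
    (forall delta : R, 0 < delta ->
       exists N : nat, forall n : nat, (N <= n)%nat -> Rabs (eps n) <= delta) /\
    forall (s : list nat) (w : nat),
      (N0 <= length s)%nat ->
      (lg (length s) <= w <= c * lg (length s))%nat ->
      let n := length s in
      let D := build w s in
      Forall (fun x => (x < 2 ^ w)%nat) D /\
      INR (length D * w) <=
        INR n * H0 s + K * INR n + eps n * (INR n * H0 s) /\
      (forall i j : nat, (1 <= i <= j)%nat -> (j <= n)%nat ->
         exists (T : nat) (st : state),
           INR T <= K * (log2 (INR n) * (log2 (log2 (INR n))) ^ 2) /\
           run w prog T (init_state D i j) = Some st /\
           reg st 0 = count_distinct s i j).
Proof.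
  intros c Hc. destruct (large_eventually c) as [N0 HN0].
  set (Lam := loop_time 256 (2 * c)).
  (* One constant serves both bounds: 23 for the linear term of the size, and 8 times the factor of
     [query_time] for the time. *)
  exists prog, (fun w s => structure s w), (23 + INR (1300 * Lam) * 8), slack, N0.
  split; [exact slack_vanishes |].
  intros s w Hn Hw. cbv zeta.
  assert (Hlarge := HN0 _ Hn). pose proof (pos_INR (1300 * Lam)) as HLam.
  split; [| split].
  - exact (structure_bound s w c Hc Hlarge Hw).
  - pose proof (structure_size s w c Hc Hlarge Hw). pose proof (pos_INR (length s)). nra.
  - intros i j Hij Hj.
    destruct (structure_query s w c Hc Hlarge Hw i j Hij Hj) as (T & st & HT & Hrun & Hreg).
    exists T, st. split; [| split; [exact Hrun | exact Hreg]].
    pose proof (query_time s w c Hc Hlarge Hw) as HQ. fold Lam in HQ.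
    assert (HT' := le_INR _ _ (Nat.le_trans _ _ _ HT HQ)). rewrite mult_INR in HT'.
    assert (Hg : (4 <= lg (lg (length s)))%nat).
    { pose proof (g_large c (length s) Hlarge). lia. }
    pose proof (time_real (length s) Hg) as HR.
    assert (0 <= log2 (INR (length s)) * log2 (log2 (INR (length s))) ^ 2).
    { pose proof (pos_INR (lg (length s) * (lg (lg (length s)) * lg (lg (length s))))). lra. }
    apply (Rmult_le_compat_l _ _ _ HLam) in HR. nra.
Qed.
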